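(* Let $\varphi\colon\mathbb{D}\to\mathbb{A}$ be a bijective conformal map from the open unit disk $\mathbb{D}$ onto a simply connected domain $\mathbb{A}\subset\mathbb{C}$, and let $G\in\mathcal{E}_2(\mathbb{A})$. Let $r\ge 1$ and consider functions of the form $$G_r(\cdot)=\left(\sum_{j=1}^r\frac{\phi_j}{\varphi^{-1}(\cdot)-\lambda_j}+d_r\right)\frac{1}{[\varphi'(\varphi^{-1}(\cdot))]^{1/2}},\qquad \lambda_j,\phi_j,d_r\in\mathbb{C},\ |\lambda_j|>1,\ j=1,\dots,r .$$ Suppose that $G_r\in\mathcal{E}_2(\mathbb{A})$ of this form, with parameters $(\lambda_1,\dots,\lambda_r,\phi_1,\dots,\phi_r,d_r)$, is a local minimizer of $$\min_{\substack{\lambda_j,d_r,\phi_j\in\mathbb{C}\\ |\lambda_j|>1\\ j=1,\dots,r}}\|G-G_r\|_{\mathcal{E}_2(\mathbb{A})}.$$ Then, for $p=1,\dots,r$, $$G(\varphi(0))=G_r(\varphi(0)),\qquad G\!\left(\varphi\!\left(\tfrac{1}{\overline{\lambda_p}}\right)\right)=G_r\!\left(\varphi\!\left(\tfrac{1}{\overline{\lambda_p}}\right)\right),\qquad G'\!\left(\varphi\!\left(\tfrac{1}{\overline{\lambda_p}}\right)\right)=G_r'\!\left(\varphi\!\left(\tfrac{1}{\overline{\lambda_p}}\right)\right).$$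
   Context: A conformal map is an analytic map with nowhere vanishing derivative. $[\varphi']^{1/2}$ denotes a fixed analytic branch of the square root of $\varphi'$ on $\mathbb{D}$. $\mathcal{H}_2$ is the Hardy space of analytic $F\colon\mathbb{D}\to\mathbb{C}$ with $\sup_{0<\rho<1}\frac1{2\pi}\int_0^{2\pi}|F(\rho e^{\mathrm{i}\theta})|^2\,\mathrm{d}\theta<\infty$, with inner product $\langle F,H\rangle_{\mathcal{H}_2}=\frac1{2\pi}\int_0^{2\pi}F(e^{\mathrm{i}\theta})\overline{H(e^{\mathrm{i}\theta})}\,\mathrm{d}\theta$ (using radial boundary values) and the induced norm. For analytic $G\colon\mathbb{A}\to\mathbb{C}$ put $\mathcal{A}_G(\cdot)=G(\varphi(\cdot))[\varphi'(\cdot)]^{1/2}$ on $\mathbb{D}$. The space $\mathcal{E}_2(\mathbb{A})$ consists of the analytic $G\colon\mathbb{A}\to\mathbb{C}$ with $\mathcal{A}_G\in\mathcal{H}_2$, with inner product $\langle G,F\rangle_{\mathcal{E}_2(\mathbb{A})}=\langle\mathcal{A}_G,\mathcal{A}_F\rangle_{\mathcal{H}_2}$ and norm $\|G\|_{\mathcal{E}_2(\mathbb{A})}=\|\mathcal{A}_G\|_{\mathcal{H}_2}$. ''Local minimizer'' refers to the parameters $(\lambda_1,\dots,\lambda_r,\phi_1,\dots,\phi_r,d_r)$ in the open subset $\{|\lambda_j|>1,\ j=1,\dots,r\}$ of $\mathbb{C}^{2r+1}$. *)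

(* Defs.v *)
From HB Require Import structures.
From mathcomp Require Import all_boot all_order all_algebra.
From mathcomp Require Import complex.
From mathcomp Require Import all_classical all_reals all_analysis.

Set Implicit Arguments.
Unset Strict Implicit.
Unset Printing Implicit Defensive.

Import Order.TTheory GRing.Theory Num.Theory.
Import numFieldNormedType.Exports.

Local Open Scope classical_set_scope.
Local Open Scope complex_scope.
Local Open Scope ring_scope.

(* Gives R[i] the topology of its modulus and makes it a normed space over
   itself, so that [derivable] and [derive1] on R[i] are complex notions. *)
HB.instance Definition _ (R : realType) := NormedModule.copy R[i] R[i]^o.

Section ComplexAnalysis.
Context {R : realType}.
Local Notation C := R[i].
Implicit Types (U A : set C) (F G H : C -> C).

Definition disk : set C := [set z | `|z| < 1].

(* U is meant to be open; functions on U are represented by total functions, of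
   which only the values on U matter. *)
Definition analytic_on U F : Prop :=
  forall z, U z -> exists (a : nat -> C) (e : R), 0 < e /\
    forall w : C, `|w - z| < e%:C ->
      [series a n * (w - z) ^+ n]_n @ \oo --> F w.

Definition conformal_on U F : Prop :=
  analytic_on U F /\ forall z, U z -> derive1 F z != 0.

Definition simply_connected U : Prop :=
  forall g : R -> C, {within `[0, 1], continuous g} ->
    (forall t : R, 0 <= t <= 1 -> U (g t)) -> g 0 = g 1 ->
  exists h : R * R -> C,
    [/\ {within `[0, 1] `*` `[0, 1], continuous h},
        forall s t : R, 0 <= s <= 1 -> 0 <= t <= 1 -> U (h (s, t)),
        forall t : R, 0 <= t <= 1 -> h (0, t) = g t,
        forall t : R, 0 <= t <= 1 -> h (1, t) = g 0 &
        forall s : R, 0 <= s <= 1 -> h (s, 0) = g 0 /\ h (s, 1) = g 0].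

Definition simply_connected_domain U : Prop :=
  [/\ U !=set0, open U, connected U & simply_connected U].

Definition polar (rho t : R) : C := rho%:C * (cos t +i* sin t).

(* The average over the circle of radius rho is extended-real valued, so the
   condition is the finiteness of the supremum with no integrability proviso. *)
Definition hardy2 F : Prop :=
  analytic_on disk F /\
  (ereal_sup [set ((2 * pi)^-1)%:E *
      \int[lebesgue_measure]_(t in `[0%R, (2 * pi)%R])
        ((complex.Re `|F (polar rho t)|) ^+ 2)%:E
    | rho in [set rho : R | (0 < rho < 1)%R]] < +oo)%E.

(* On hardy2 this limit exists for almost every t; elsewhere it is a junk value
   and does not affect the integrals below. *)
Definition radial_boundary F (t : R) : C :=
  lim ((fun rho : R => F (polar rho t)) @ (1 : R)^'-).

Definition cintegral (D : set R) (f : R -> C) : C :=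
  (\int[lebesgue_measure]_(t in D) complex.Re (f t)) +i*
  (\int[lebesgue_measure]_(t in D) complex.Im (f t)).

Definition hardy2_inner F H : C :=
  ((2 * pi)^-1)%:C *
  cintegral `[0, 2 * pi]
    (fun t => radial_boundary F t * (radial_boundary H t)^*%C).

Definition hardy2_norm F : R := Num.sqrt (complex.Re (hardy2_inner F F)).

Definition sqrt_deriv_branch (vphi s : C -> C) : Prop :=
  analytic_on disk s /\ forall z, disk z -> s z ^+ 2 = derive1 vphi z.

(* In what follows, s is the chosen branch of the square root of the derivative
   of vphi on the unit disk. *)
Definition pull (vphi s G : C -> C) : C -> C := fun z => G (vphi z) * s z.

Definition E2 A (vphi s G : C -> C) : Prop :=
  analytic_on A G /\ hardy2 (pull vphi s G).

Definition E2_norm (vphi s G : C -> C) : R := hardy2_norm (pull vphi s G).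

(* [pinv disk vphi] is the inverse of vphi : disk -> vphi @` disk. *)
Definition reduced_fun (vphi s : C -> C) (r : nat)
    (lam phi : 'rV[C]_r) (d : C) : C -> C :=
  fun x => let z := pinv disk vphi x in
    (\sum_(j < r) phi 0 j / (z - lam 0 j) + d) * (s z)^-1.

Definition outside_poles (r : nat) : set ('rV[C]_r * 'rV[C]_r * C) :=
  [set q : 'rV[C]_r * 'rV[C]_r * C | forall j : 'I_r, 1 < `|q.1.1 0 j|].

End ComplexAnalysis.

Definition local_minimizer {R : realType} {T : topologicalType}
    (U : set T) (J : T -> R) (q : T) : Prop :=
  U q /\ \forall q' \near q, U q' -> J q <= J q'.

(* Main.v *)
Require Import Defs.
From mathcomp Require Import all_boot all_order all_algebra.
From mathcomp Require Import complex.
From mathcomp Require Import all_classical all_reals all_analysis.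
From mathcomp Require Import measurable_realfun ring lra zify.
Import Order.TTheory GRing.Theory Num.Theory.
Import numFieldNormedType.Exports.
Local Open Scope classical_set_scope.
Local Open Scope complex_scope.
Local Open Scope ring_scope.

(** Pulled back to the disk, the error is e = F - R, where F is the pull-back
    of G and R is rational with its poles outside the closed disk.  The cost is
    the L^2 norm of the radial boundary values of e, so local minimality makes
    these orthogonal to 1 and to the functions 1/(z - lambda_p) and, after a
    variation of the pole, phi_p/(z - lambda_p)^2.  Cauchy's formula on the
    boundary turns this into e(0) = 0, e(w) = 0 and phi_p e'(w) = 0, with
    w = 1/conj(lambda_p).  If phi_p = 0 the pole lambda_p can be moved freely at
    no cost, so that e vanishes near w and e'(w) = 0 again.

    Cauchy's formula for boundary values requires the almost everywhere
    existence of radial limits of an H^2 function.  The Poisson formula bounds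
    the radial maximal function by the Hardy-Littlewood maximal function; since
    the restrictions of e to circles are Cauchy in L^2, the weak type inequality
    makes the radial oscillation vanish almost everywhere, and Fatou's lemma
    gives the convergence in the mean. *)

Set Implicit Arguments.
Unset Strict Implicit.
Unset Printing Implicit Defensive.

(** * The modulus and local power series *)

(** The norm integrates radial limits instead of being a limit of means over circles, so minimality
    says nothing about the inside of the disk until the boundary values are under control. The
    device is to compare F with its dilations z |-> F(s z): for s < 1 these are continuous up to the
    circle, so closeness of F to a dilation along a radius forces the radial values to be almost
    Cauchy. The L^2 Cauchy property comes from an exact identity in place of Fourier series: the
    square mean of F(b .) - F(a .) is a second difference of square means in log r, which yields
    monotonicity as well.

    The cost is never differentiated. If two admissible parameters have rational parts differing by
    h, then minimality reads 2 Re <e, h> <= |h|^2, and h is kept as a finite difference: linear in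
    the residue and the constant, of first order in the displacement of a pole. A pole is displaced
    by prescribing its reflected point z = 1/conj(lambda) in the disk, because in that variable the
    linear term is holomorphic and can be expanded at w. *)

Section Modulus.
Context {R : realType}.
Local Notation C := R[i].
(* The modulus as a real number: the norm of R[i] takes its values in R[i]. *)
Local Notation nc := (@Normc.normc R).
Local Notation re := (@complex.Re R).
Local Notation im := (@complex.Im R).
Implicit Types (z w : C) (x : R).

Lemma eq_ler (x y : R) : x = y -> x <= y.
Proof. by move=> ->. Qed.

Lemma nc_ge0 z : 0 <= nc z.
Proof. by case: z => a b; exact: sqrtr_ge0. Qed.

Lemma normE z : `|z| = (nc z)%:C.
Proof. by rewrite normc_def; case: z. Qed.

Lemma nc0 : nc 0 = 0.
Proof. exact: Normc.normc0. Qed.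

Lemma nc1 : nc 1 = 1.
Proof. exact: Normc.normc1. Qed.

Lemma ncM z w : nc (z * w) = nc z * nc w.
Proof. exact: Normc.normcM. Qed.

Lemma ncD z w : nc (z + w) <= nc z + nc w.
Proof. by rewrite -lecR rmorphD/= -!normE; exact: ler_normD. Qed.

Lemma ncN z : nc (- z) = nc z.
Proof. exact: normcN. Qed.

Lemma ncB z w : nc (z - w) <= nc z + nc w.
Proof. by rewrite -(ncN w) ncD. Qed.

Lemma ncC z w : nc (z - w) = nc (w - z).
Proof. by rewrite -opprB ncN. Qed.

Lemma nc_real x : nc x%:C = `|x|.
Proof. by rewrite /= expr0n addr0 sqrtr_sqr. Qed.

Lemma ncX z n : nc (z ^+ n) = nc z ^+ n.
Proof.
elim: n => [|n ih]; first by rewrite !expr0 nc1.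
by rewrite !exprS ncM ih.
Qed.

Lemma nc_conj z : nc z^*%C = nc z.
Proof. by case: z => a b /=; rewrite sqrrN. Qed.

Lemma nc_eq0 z : (nc z == 0) = (z == 0).
Proof.
apply/eqP/eqP => [|->]; [exact: Normc.eq0_normc|exact: nc0].
Qed.

Lemma nc_gt0 z : (0 < nc z) = (z != 0).
Proof. by rewrite lt0r nc_eq0 nc_ge0 andbT. Qed.

Lemma nc_sqr z : nc z ^+ 2 = re z ^+ 2 + im z ^+ 2.
Proof. by case: z => a b /=; rewrite sqr_sqrtr// addr_ge0 ?sqr_ge0. Qed.

Lemma le_Re_nc z : `|re z| <= nc z.
Proof.
rewrite -(@ler_pXn2r _ 2) ?nnegrE ?nc_ge0//.
by rewrite nc_sqr real_normK ?num_real// lerDl sqr_ge0.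
Qed.

Lemma le_Im_nc z : `|im z| <= nc z.
Proof.
rewrite -(@ler_pXn2r _ 2) ?nnegrE ?nc_ge0//.
by rewrite nc_sqr real_normK ?num_real// lerDr sqr_ge0.
Qed.

Lemma nc_le_ReIm z : nc z <= `|re z| + `|im z|.
Proof.
rewrite -(@ler_pXn2r _ 2) ?nnegrE ?nc_ge0 ?addr_ge0//.
by rewrite nc_sqr sqrrD !real_normK ?num_real// lerD2r lerDl mulrn_wge0 ?mulr_ge0.
Qed.

Lemma nc_nat n : nc (n%:R) = n%:R.
Proof. by rewrite -(rmorph_nat (real_complex R)) nc_real normr_nat. Qed.

Lemma nc_i : nc 'i%C = 1.
Proof. by rewrite /= expr0n expr1n add0r sqrtr1. Qed.

Lemma nc_sum (I : Type) (s : seq I) (P : pred I) (f : I -> C) :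
  nc (\sum_(i <- s | P i) f i) <= \sum_(i <- s | P i) nc (f i).
Proof.
elim/big_ind2 : _ => [|x1 x2 y1 y2 h1 h2|//]; first by rewrite nc0 lexx.
by rewrite (le_trans (ncD _ _))// lerD.
Qed.

Lemma cplx_dist_lt {T : Type} {F : set_system T} {FF : Filter F}
    (f : T -> C) (l : C) :
  f @ F --> l <-> forall e : R, 0 < e -> \forall x \near F, nc (f x - l) < e.
Proof.
split=> [/cvgrPdist_lt h e e0|h].
  have /h : 0 < e%:C by rewrite ltcR.
  by apply: filterS => x; rewrite normE ltcR ncC.
apply/cvgrPdist_lt => e e0.
have /h : 0 < re e by move: e0; rewrite ltcE => /andP[].
apply: filterS => x; rewrite ncC normE => hx.
suff -> : e = (re e)%:C by rewrite ltcR.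
by rewrite RRe_real// gtr0_real.
Qed.

Lemma cplx_cvgn_lt (f : nat -> C) (l : C) :
  f @ \oo --> l <-> forall e : R, 0 < e -> exists N, forall n, (N <= n)%N ->
    nc (f n - l) < e.
Proof.
rewrite cplx_dist_lt; split=> h e /h; first by move=> [N _ hN]; exists N.
by move=> [N hN]; exists N.
Qed.

End Modulus.

Section HolAt.
Context {R : realType}.
Local Notation C := R[i].
Local Notation nc := (@Normc.normc R).
Local Notation re := (@complex.Re R).
Local Notation im := (@complex.Im R).
Implicit Types (z w : C) (x : R).

(* Holomorphy near z0 in C^{1,1} form: the second-order Taylor estimate with a
   uniform constant is all that the contour arguments below use. *)
Definition hol_at (H : C -> C) (z0 : C) := exists (dH : C -> C) (K e : R),
  [/\ 0 < e, 0 <= K & forall u v, nc (u - z0) < e -> nc (v - z0) < e ->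
   [/\ nc (H v) <= K, nc (dH v) <= K &
       nc (H u - H v - dH v * (u - v)) <= K * nc (u - v) ^+ 2]].

(** Induction through T(n+1) = u T(n) + n v^(n-1) (u - v)^2 for the Taylor remainder T, with n^2 + n
    <= (n+1)^2. The factor d^2 stays on the left so that no exponent n - 2 occurs and d = 0 is
    allowed. *)
Lemma nc_taylor_monomial (d : R) (u v : C) n : nc u <= d -> nc v <= d ->
  d ^+ 2 * nc (u ^+ n - v ^+ n - (n%:R * v ^+ n.-1) * (u - v)) <=
  n%:R ^+ 2 * d ^+ n * nc (u - v) ^+ 2.
Proof.
move=> hu hv; have d0 : 0 <= d := le_trans (nc_ge0 _) hu.
elim: n => [|n ih].
  by rewrite !expr0 subrr mulr0n !mul0r subrr nc0 mulr0 !mulr_ge0 ?exprn_ge0 ?nc_ge0.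
have -> : u ^+ n.+1 - v ^+ n.+1 - (n.+1%:R * v ^+ n.+1.-1) * (u - v) =
   u * (u ^+ n - v ^+ n - (n%:R * v ^+ n.-1) * (u - v)) +
   n%:R * v ^+ n.-1 * (u - v) ^+ 2.
  case: n {ih} => [|n] /=; first by rewrite !expr1 !expr0; ring.
  rewrite !exprS; ring.
set T := _ - _ - _ in ih *.
apply: (@le_trans _ _ (d * (d ^+ 2 * nc T) +
   d ^+ 2 * (n%:R * d ^+ n.-1 * nc (u - v) ^+ 2))).
  rewrite [X in _ <= X + _]mulrCA -mulrDr ler_wpM2l ?exprn_ge0// (le_trans (ncD _ _))// lerD//.
    by rewrite ncM ler_wpM2r ?nc_ge0.
  rewrite ncM [nc (_ ^+ 2)]ncX !ncM ncX nc_nat ler_wpM2r ?exprn_ge0 ?nc_ge0//.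
  by rewrite ler_wpM2l// lerXn2r ?nnegrE ?nc_ge0.
apply: (@le_trans _ _ (d * (n%:R ^+ 2 * d ^+ n * nc (u - v) ^+ 2) +
   d ^+ 2 * (n%:R * d ^+ n.-1 * nc (u - v) ^+ 2))).
  by rewrite lerD2r; exact: ler_wpM2l.
case: n {ih T} => [|n] /=.
  by rewrite expr0n/= !(mul0r,mulr0) addr0 mulr_ge0 ?exprn_ge0 ?nc_ge0// mulr_ge0.
set D := nc _ ^+ 2; have D0 : 0 <= D by rewrite exprn_ge0 ?nc_ge0.
rewrite [leLHS](_ : _ = (n.+1%:R ^+ 2 + n.+1%:R) * d ^+ n.+2 * D); last first.
  by rewrite !exprS; ring.
rewrite ler_wpM2r// ler_wpM2r ?exprn_ge0//.
rewrite -(natr1 n.+1); have : 0 <= n.+1%:R :> R by []. nra.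
Qed.

Lemma sum_half_le (N : nat) : \sum_(0 <= n < N) (2^-1 : R) ^+ n <= 2.
Proof.
suff -> : \sum_(0 <= n < N) (2^-1 : R) ^+ n = 2 - 2 * 2^-1 ^+ N.
  by rewrite lerBlDr lerDl mulr_ge0// exprn_ge0// invr_ge0.
elim: N => [|N ih]; first by rewrite big_geq// expr0; ring.
by rewrite big_nat_recr//= ih exprS; field.
Qed.

(** Lets a factor 4^-n absorb the n^2 of the Taylor remainders and still leave the summable 2^-n. *)
Lemma sqr_le_4pow2 n : (n%:R ^+ 2 : R) <= 4 * 2 ^+ n.
Proof.
rewrite -!natrX -natrM ler_nat; elim: n => // n ih.
rewrite expnS; case: n ih => [//|[//|[//|n]]] ih.
move: ih; rewrite !expnS; lia.
Qed.

Lemma series_cvg_dominated (t : nat -> C) (M : R) :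
  (forall n, nc (t n) <= M * 2^-1 ^+ n) ->
  exists l : C, series t @ \oo --> l.
Proof.
move=> ht.
have hgeo : cvgn (series (geometric M (2^-1 : R))).
  by apply: is_cvg_geometric_series; rewrite ger0_norm ?invr_ge0// invf_lt1// ltr1n.
have key (f : C -> R) : (forall z, `|f z| <= nc z) -> cvgn (series (f \o t)).
  move=> hf; apply: normed_cvg; apply: (series_le_cvg _ _ _ hgeo) => n //=.
  - by rewrite (le_trans _ (ht n))// nc_ge0.
  - exact: le_trans (hf _) (ht n).
have /cvg_ex[/= a ha] := key _ le_Re_nc.
have /cvg_ex[/= b hb] := key _ le_Im_nc.
exists (a +i* b); apply/cplx_dist_lt => e e0.
have e2 : 0 < e / 2 by rewrite divr_gt0.
have hRe N : re (series t N) = series (re \o t) N.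
  rewrite /series/=; elim: N => [|N ih]; first by rewrite !big_geq.
  by rewrite !big_nat_recr//= -ih; case: (\sum_(0 <= _ < N) _); case: (t N).
have hIm N : im (series t N) = series (im \o t) N.
  rewrite /series/=; elim: N => [|N ih]; first by rewrite !big_geq.
  by rewrite !big_nat_recr//= -ih; case: (\sum_(0 <= _ < N) _); case: (t N).
near=> N.
apply: le_lt_trans (nc_le_ReIm _) _.
rewrite [ltRHS](splitr e); apply: ltrD.
- rewrite [X in `|X|](_ : _ = series (re \o t) N - a); last first.
    by rewrite -hRe; case: (series t N).
  by rewrite distrC; near: N; exact: cvgr_dist_lt.
- rewrite [X in `|X|](_ : _ = series (im \o t) N - b); last first.
    by rewrite -hIm; case: (series t N).
  by rewrite distrC; near: N; exact: cvgr_dist_lt.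
Unshelve. all: by end_near. Qed.

(** Convergence at one point at distance e/2 bounds [a n] by M (e/2)^-n. On the disk of radius e/8
    the terms, their derivatives and their Taylor remainders are then dominated by multiples of
    2^-n, and the bounds pass from the partial sums to the limits. *)
Lemma power_series_hol_at (F : C -> C) (a : nat -> C) (z0 : C) (e : R) :
  0 < e -> (forall w, nc (w - z0) < e ->
    [series a n * (w - z0) ^+ n]_n @ \oo --> F w) -> hol_at F z0.
Proof.
move=> e0 hF.
pose r0 := e / 2; have r00 : 0 < r0 by rewrite divr_gt0.
(* Beyond N consecutive partial sums are within 1 of the limit, so a term is at most 2; the finitely
   many earlier terms enter through their sum. *)
have [M M0 hM] : exists2 M, 0 <= M & forall n, nc (a n) * r0 ^+ n <= M.
  have /hF : nc (z0 + r0%:C - z0) < e.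
    by rewrite addrAC subrr add0r nc_real gtr0_norm// ltr_pdivrMr// ltr_pMr// ltr1n.
  rewrite addrAC subrr add0r => /cplx_cvgn_lt /(_ 1 ltr01)[N hN].
  exists (2 + \sum_(0 <= n < N) nc (a n) * r0 ^+ n).
    by rewrite addr_ge0// sumr_ge0// => i _; rewrite mulr_ge0 ?nc_ge0 ?exprn_ge0 ?ltW.
  move=> n; have hge0 k : 0 <= nc (a k) * r0 ^+ k.
    by rewrite mulr_ge0 ?nc_ge0 ?exprn_ge0 ?ltW.
  have [nN|Nn] := ltnP n N.
    rewrite big_mkord (bigD1 (Ordinal nN))//= addrCA lerDl addr_ge0// sumr_ge0//.
  have -> : nc (a n) * r0 ^+ n = nc (a n * r0%:C ^+ n).
    by rewrite ncM ncX nc_real gtr0_norm.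
  have -> : a n * r0%:C ^+ n = (series (fun n => a n * r0%:C ^+ n) n.+1 - F (z0 + r0%:C))
       - (series (fun n => a n * r0%:C ^+ n) n - F (z0 + r0%:C)).
    by rewrite /series/= big_nat_recr//=; ring.
  apply: le_trans (ncB _ _) _.
  rewrite -[leLHS]addr0 lerD ?sumr_ge0//.
  have /hN/ltW h1 := Nn; have /hN/ltW h2 := leqW Nn.
  by rewrite (_ : 2 = 1 + 1)// lerD.
(* The quotient 4 leaves a factor 4^-n: one 2^-n absorbs n or n^2, the other is summed. *)
pose d := r0 / 4; have d0 : 0 < d by rewrite divr_gt0.
have ha n : nc (a n) * d ^+ n <= M * 4^-1 ^+ n.
  by rewrite /d exprMn mulrA ler_wpM2r// exprn_ge0// invr_ge0.
have h42 n : (2 : R) ^+ n * 4^-1 ^+ n = 2^-1 ^+ n.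
  by rewrite -exprMn; congr (_ ^+ _); field.
have ncle v n : nc v < d -> nc v ^+ n <= d ^+ n.
  by move=> hv; rewrite lerXn2r ?nnegrE ?nc_ge0 ?(ltW d0)// ltW.
have nle n : (n%:R : R) <= 2 ^+ n.
  by rewrite -natrX ler_nat ltnW// ltn_expl.
have hd n v : nc v < d -> nc (a n * (n%:R * v ^+ n.-1)) <= M / d * 2^-1 ^+ n.
  move=> hv; rewrite !ncM ncX nc_nat.
  case: n => [|n]; first by rewrite mul0r mulr0 mulr_ge0 ?expr0 ?divr_ge0// ltW.
  apply: (@le_trans _ _ (nc (a n.+1) * (2 ^+ n.+1 * d ^+ n.+1 / d))).
    rewrite ler_wpM2l ?nc_ge0// exprS -mulrA (mulrC 2) -mulrA [d ^+ n.+1]exprS.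
    have -> : 2 ^+ n * (2 * (d * d ^+ n / d)) = 2 ^+ n.+1 * d ^+ n.
      by rewrite exprS; field; rewrite gt_eqF.
    by rewrite ler_pM ?exprn_ge0 ?nc_ge0 ?ncle.
  have -> : nc (a n.+1) * (2 ^+ n.+1 * d ^+ n.+1 / d) =
     nc (a n.+1) * d ^+ n.+1 * (2 ^+ n.+1 / d) by ring.
  apply: le_trans (ler_wpM2r _ (ha _)) _.
    by rewrite divr_ge0 ?exprn_ge0 ?(ltW d0).
  by rewrite -h42; apply: eq_ler; ring.
pose S N u := series (fun n => a n * u ^+ n) N.
pose dS N u := series (fun n => a n * (n%:R * u ^+ n.-1)) N.
have hS N v : nc v < d -> nc (S N v) <= M * 2.
  move=> hv; apply: le_trans (nc_sum _ _ _) _.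
  apply: le_trans (ler_wpM2l M0 (sum_half_le N)); rewrite mulr_sumr.
  apply: ler_sum => n _; rewrite ncM ncX.
  apply: (@le_trans _ _ (M * 4^-1 ^+ n)).
    by rewrite (le_trans _ (ha n))// ler_wpM2l ?nc_ge0 ?ncle.
  rewrite ler_wpM2l// lerXn2r ?nnegrE ?invr_ge0//.
  by rewrite lef_pV2 ?posrE// ler_nat.
have hdS N v : nc v < d -> nc (dS N v) <= M / d * 2.
  move=> hv; apply: le_trans (nc_sum _ _ _) _.
  have Md : 0 <= M / d by rewrite divr_ge0// ltW.
  apply: le_trans (ler_wpM2l Md (sum_half_le N)); rewrite mulr_sumr.
  by apply: ler_sum => n _; exact: hd.
have hT N u v : nc u < d -> nc v < d ->
    nc (S N u - S N v - dS N v * (u - v)) <= (8 * M / d ^+ 2) * nc (u - v) ^+ 2.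
  move=> hu hv; rewrite /S /dS /series/= mulr_suml -!sumrB.
  apply: le_trans (nc_sum _ _ _) _.
  apply: (@le_trans _ _ (\sum_(0 <= n < N)
      (4 * M / d ^+ 2 * nc (u - v) ^+ 2) * 2^-1 ^+ n)); last first.
    rewrite -mulr_sumr; apply: le_trans (ler_wpM2l _ (sum_half_le N)) _.
      by rewrite mulr_ge0 ?exprn_ge0 ?nc_ge0// divr_ge0 ?exprn_ge0 ?(ltW d0)// mulr_ge0.
    by apply: eq_ler; ring.
  apply: ler_sum => n _.
  rewrite (_ : _ - _ - _ = a n * (u ^+ n - v ^+ n - (n%:R * v ^+ n.-1) * (u - v))); last by ring.
  rewrite ncM -(ler_pM2r (exprn_gt0 2 d0)).
  have := nc_taylor_monomial n (ltW hu) (ltW hv) => /(ler_wpM2l (nc_ge0 (a n))).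
  rewrite mulrCA mulrC => /le_trans; apply.
  rewrite (_ : _ * (_ * _ * _) = nc (a n) * d ^+ n * (n%:R ^+ 2 * nc (u - v) ^+ 2)); last by ring.
  apply: (@le_trans _ _ (M * 4^-1 ^+ n * (4 * 2 ^+ n * nc (u - v) ^+ 2))).
    apply: ler_pM; rewrite ?ha//.
    - by rewrite mulr_ge0 ?nc_ge0 ?exprn_ge0 ?ltW.
    - by rewrite mulr_ge0 ?exprn_ge0 ?nc_ge0.
    - by rewrite ler_wpM2r ?exprn_ge0 ?nc_ge0// sqr_le_4pow2.
  by rewrite -h42; apply: eq_ler; field; rewrite gt_eqF.
(* The derivative is the sum of the differentiated series, taken pointwise by choice; outside the
   disk of radius d its value is arbitrary. *)
have hex : forall v, exists l : C, nc v < d -> (fun N => dS N v) @ \oo --> l.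
  move=> v; have [hv|hv] := ltP (nc v) d; last by exists 0.
  have [n|l hl] := @series_cvg_dominated (fun n => a n * (n%:R * v ^+ n.-1)) (M / d).
    exact: hd.
  by exists l.
have [dF hdF] := boolp.choice hex.
have de : d < e by rewrite /d /r0; lra.
exists (fun z => dF (z - z0)), (M * 2 + M / d * 2 + 8 * M / d ^+ 2), d; split => //.
  by rewrite !addr_ge0// ?mulr_ge0 ?invr_ge0// ?exprn_ge0// ltW.
move=> u v hu hv.
set K := M * 2 + _ + _.
have K1 : M * 2 <= K.
  by rewrite /K -addrA lerDl addr_ge0// !mulr_ge0 ?invr_ge0 ?exprn_ge0// ltW.
have K2 : M / d * 2 <= K.
  by rewrite /K addrAC lerDr addr_ge0// !mulr_ge0 ?invr_ge0 ?exprn_ge0// ltW.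
have K3 : 8 * M / d ^+ 2 <= K.
  by rewrite /K lerDr addr_ge0// !mulr_ge0 ?invr_ge0 ?exprn_ge0// ltW.
have /cplx_cvgn_lt cu := hF _ (lt_trans hu de).
have /cplx_cvgn_lt cv := hF _ (lt_trans hv de).
have /cplx_cvgn_lt cd := hdF _ hv.
have big (x y : C) (B : R) : (forall e, 0 < e -> exists2 y, nc (x - y) < e & nc y <= B) -> nc x <= B.
  move=> h; apply/ler_addgt0Pr => eps /h[y' h1 h2].
  by rewrite -(subrK y' x) addrC (le_trans (ncD _ _))// lerD// ltW.
split.
- apply: le_trans K1; apply: (big) => // eps /cv[N /(_ N (leqnn N)) hN].
  by exists (S N (v - z0)); [rewrite ncC|exact: hS].
- apply: le_trans K2; apply: (big) => // eps /cd[N /(_ N (leqnn N)) hN].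
  by exists (dS N (v - z0)); [rewrite ncC|exact: hdS].
apply: (@le_trans _ _ (8 * M / d ^+ 2 * nc (u - v) ^+ 2)); last first.
  by rewrite ler_wpM2r ?exprn_ge0 ?nc_ge0.
apply: (big) => // eps eps0.
(* Three limits are replaced by partial sums, one of them multiplied by u - v; with this m the total
   error is below eps. *)
pose m := eps / (3 + nc (u - v)).
have m30 : 0 < 3 + nc (u - v) by rewrite ltr_pwDl ?nc_ge0.
have m0 : 0 < m by rewrite divr_gt0.
have [N1 hN1] := cu _ m0; have [N2 hN2] := cv _ m0; have [N3 hN3] := cd _ m0.
pose N := maxn N1 (maxn N2 N3).
exists (S N (u - z0) - S N (v - z0) - dS N (v - z0) * (u - v)).
  rewrite (_ : _ - _ = - (S N (u - z0) - F u) + (S N (v - z0) - F v) +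
      (dS N (v - z0) - dF (v - z0)) * (u - v)); last by ring.
  apply: le_lt_trans (ncD _ _) _; rewrite ncM.
  have h3 : nc (dS N (v - z0) - dF (v - z0)) < m by apply: hN3; rewrite /N !leq_max leqnn ?orbT.
  have h2 : nc (S N (v - z0) - F v) < m by apply: hN2; rewrite /N !leq_max leqnn ?orbT.
  have h1 : nc (S N (u - z0) - F u) < m by apply: hN1; rewrite /N !leq_max leqnn ?orbT.
  have h4 := ncD (- (S N (u - z0) - F u)) (S N (v - z0) - F v).
  rewrite ncN in h4.
  have h5 : nc (dS N (v - z0) - dF (v - z0)) * nc (u - v) <= m * nc (u - v).
    by rewrite ler_wpM2r ?nc_ge0// ltW.
  have h6 : eps = 3 * m + m * nc (u - v) by rewrite /m; field; rewrite gt_eqF.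
  lra.
have := hT N (u - z0) (v - z0) hu hv.
by rewrite (_ : u - z0 - (v - z0) = u - v)//; ring.
Qed.

End HolAt.

(** * Stability of the quadratic Taylor estimate under algebraic operations, composition and
    reflection *)

Section HolClosure.
Context {R : realType}.
Local Notation C := R[i].
Local Notation nc := (@Normc.normc R).

(** A radius at most 1 gives |u - v| <= 2, so the quadratic remainder is at most 2 K |u - v|; the
    linear term adds K |u - v|, whence the Lipschitz constant 3 K. *)
Lemma hol_at_normalized (H : C -> C) z0 : hol_at H z0 ->
  exists (dH : C -> C) (K e : R), [/\ 0 < e, e <= 1, 0 <= K &
   forall u v, nc (u - z0) < e -> nc (v - z0) < e ->
   [/\ nc (H v) <= K, nc (dH v) <= K,
       nc (H u - H v - dH v * (u - v)) <= K * nc (u - v) ^+ 2 &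
       nc (H u - H v) <= 3 * K * nc (u - v)]].
Proof.
move=> [dH [K [e [e0 K0 h]]]]; exists dH, K, (Num.min e 1); split => //.
- by rewrite lt_min e0 ltr01.
- by rewrite ge_min lexx orbT.
move=> u v; rewrite !lt_min => /andP[u1 u2] /andP[v1 v2].
have [h1 h2 h3] := h _ _ u1 v1; split => //.
have d2 : nc (u - v) <= 2.
  rewrite (_ : u - v = (u - z0) - (v - z0)); last by ring.
  by rewrite (le_trans (ncB _ _))// (_ : 2 = 1 + 1)// lerD// ltW.
have -> : H u - H v = (H u - H v - dH v * (u - v)) + dH v * (u - v) by ring.
apply: le_trans (ncD _ _) _; rewrite ncM.
have h4 : nc (dH v) * nc (u - v) <= K * nc (u - v) by rewrite ler_wpM2r ?nc_ge0.
have h5 : K * nc (u - v) ^+ 2 <= K * (2 * nc (u - v)).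
  by rewrite ler_wpM2l// expr2 ler_wpM2r ?nc_ge0.
lra.
Qed.

Lemma hol_at_cst (c z0 : C) : hol_at (fun=> c) z0.
Proof.
exists (fun=> 0), (nc c), 1; split => //; first exact: nc_ge0.
move=> u v _ _; split; rewrite ?lexx ?nc0 ?nc_ge0//.
by rewrite mul0r subrr subr0 nc0 mulr_ge0 ?exprn_ge0 ?nc_ge0.
Qed.

Lemma hol_at_id (z0 : C) : hol_at id z0.
Proof.
exists (fun=> 1), (nc z0 + 1), 1; split => //; first by rewrite addr_ge0 ?nc_ge0.
move=> u v _ hv; split.
- by rewrite -(subrK z0 v) addrC (le_trans (ncD _ _))// lerD// ltW.
- by rewrite nc1 lerDr nc_ge0.
- by rewrite mul1r subrr nc0 mulr_ge0 ?exprn_ge0 ?addr_ge0 ?nc_ge0.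
Qed.

Lemma hol_at_add (F G : C -> C) z0 : hol_at F z0 -> hol_at G z0 ->
  hol_at (fun z => F z + G z) z0.
Proof.
move=> [dF [K [e [e0 K0 hF]]]] [dG [L [e' [e'0 L0 hG]]]].
exists (fun z => dF z + dG z), (K + L), (Num.min e e'); split.
- by rewrite lt_min e0.
- by rewrite addr_ge0.
move=> u v; rewrite !lt_min => /andP[u1 u2] /andP[v1 v2].
have [h1 h2 h3] := hF _ _ u1 v1; have [g1 g2 g3] := hG _ _ u2 v2; split.
- by rewrite (le_trans (ncD _ _))// lerD.
- by rewrite (le_trans (ncD _ _))// lerD.
rewrite (_ : _ - _ - _ = (F u - F v - dF v * (u - v)) + (G u - G v - dG v * (u - v))); last by ring.
by rewrite (le_trans (ncD _ _))// mulrDl lerD.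
Qed.

(** The 5 is 1 + 1 + 3: the remainder of F, the remainder of G, and the mixed increment, bounded
    with the Lipschitz constant 3 L of G. *)
Lemma hol_at_mul (F G : C -> C) z0 : hol_at F z0 -> hol_at G z0 ->
  hol_at (fun z => F z * G z) z0.
Proof.
move=> /hol_at_normalized[dF [K [e [e0 e1 K0 hF]]]].
move=> /hol_at_normalized[dG [L [e' [e'0 e'1 L0 hG]]]].
exists (fun z => dF z * G z + F z * dG z), (5 * (K * L)), (Num.min e e'); split.
- by rewrite lt_min e0.
- by rewrite !mulr_ge0.
have KL0 : 0 <= K * L by rewrite mulr_ge0.
have prod a b : nc a <= K -> nc b <= L -> nc (a * b) <= K * L.
  by move=> ha hb; rewrite ncM ler_pM ?nc_ge0.
move=> u v; rewrite !lt_min => /andP[u1 u2] /andP[v1 v2].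
have [h1 h2 h3 _] := hF _ _ u1 v1; have [g1 g2 g3 g4] := hG _ _ u2 v2.
have [gu _ _ _] := hG _ _ v2 u2; split.
- by have := prod _ _ h1 g1; lra.
- apply: le_trans (ncD _ _) _.
  by have := prod _ _ h2 g1; have := prod _ _ h1 g2; lra.
rewrite (_ : _ - _ - _ = (F u - F v - dF v * (u - v)) * G u +
  F v * (G u - G v - dG v * (u - v)) + dF v * (u - v) * (G u - G v)); last by ring.
set D := nc (u - v) in h3 g3 g4 *; have D0 : 0 <= D := nc_ge0 _.
apply: le_trans (ncD _ _) _.
apply: (@le_trans _ _ (K * L * D ^+ 2 + K * L * D ^+ 2 + 3 * (K * L) * D ^+ 2)); last lra.
rewrite lerD//; first apply: le_trans (ncD _ _) _; first apply: lerD.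
- by rewrite ncM mulrAC ler_pM ?nc_ge0.
- by rewrite ncM -mulrA ler_pM ?nc_ge0.
- rewrite !ncM -/D (_ : 3 * _ * _ = (K * D) * (3 * L * D)); last by ring.
  by rewrite ler_pM ?mulr_ge0 ?nc_ge0// ler_wpM2r.
Qed.

(** The remainder is exactly (u - v)^2 / ((u - w) (v - w)^2), and within d/2 of z0 the distance to w
    stays at least d/2. *)
Lemma hol_at_inv (w z0 : C) : z0 != w -> hol_at (fun z => (z - w)^-1) z0.
Proof.
rewrite -subr_eq0 -nc_gt0; set d := nc (z0 - w) => d0.
have hlow u : nc (u - z0) < d / 2 -> d / 2 <= nc (u - w).
  move=> hu; have : d <= nc (u - w) + nc (u - z0).
    rewrite /d (_ : z0 - w = (u - w) - (u - z0)); last by ring.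
    exact: ncB.
  lra.
have d2 : 0 < d / 2 by rewrite divr_gt0.
have hneq u : nc (u - z0) < d / 2 -> u - w != 0.
  by move=> /hlow h; rewrite -nc_gt0 (lt_le_trans d2).
have hinv u n : nc (u - z0) < d / 2 -> nc ((u - w)^-1 ^+ n) <= (d / 2)^-1 ^+ n.
  move=> hu; rewrite ncX Normc.normcV lerXn2r ?nnegrE ?invr_ge0 ?nc_ge0 ?(ltW d2)//.
  by rewrite lef_pV2 ?posrE ?nc_gt0 ?hneq ?hlow.
pose A := (d / 2)^-1; have A0 : 0 < A by rewrite invr_gt0.
exists (fun z => - ((z - w)^-1 ^+ 2)), (A + A ^+ 2 + A ^+ 3), (d / 2); split => //.
  by rewrite !addr_ge0 ?exprn_ge0 ?(ltW A0).
have AA : 0 < A ^+ 2 by rewrite exprn_gt0.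
have AAA : 0 < A ^+ 3 by rewrite exprn_gt0.
move=> u v hu hv; split.
- by have := hinv v 1 hv; rewrite !expr1 -/A; lra.
- by rewrite ncN; have := hinv v 2 hv; rewrite -/A; lra.
rewrite (_ : _ - _ - _ = (u - w)^-1 ^+ 1 * (v - w)^-1 ^+ 2 * (u - v) ^+ 2); last first.
  by rewrite expr1; field; rewrite !hneq.
rewrite [nc _]ncM ncX ler_wpM2r ?exprn_ge0 ?nc_ge0//.
apply: (@le_trans _ _ (A ^+ 3)); last by lra.
by rewrite ncM (exprS A 2) -{1}(expr1 A) ler_pM ?nc_ge0 ?hinv.
Qed.

Lemma hol_at_comp (H g : C -> C) z0 : hol_at g z0 -> hol_at H (g z0) ->
  hol_at (H \o g) z0.
Proof.
move=> /hol_at_normalized[dg [K [e [e0 e1 K0 hg]]]].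
move=> [dH [L [e' [e'0 L0 hH]]]].
have K1 : 0 < 3 * K + 1 by rewrite ltr_wpDl ?mulr_ge0.
have KL0 : 0 <= K * L by rewrite mulr_ge0.
have KKL0 : 0 <= L * K ^+ 2 by rewrite mulr_ge0 ?exprn_ge0.
pose d := Num.min e (e' / (3 * K + 1)).
have hd u : nc (u - z0) < d -> nc (u - z0) < e /\ nc (g u - g z0) < e'.
  rewrite lt_min => /andP[h1 h2]; split => //.
  have [_ _ _ h3] := hg u z0 h1 (eq_ind_r (fun x => nc x < e) (eq_ind_r (fun x => x < e) e0 nc0) (subrr z0)).
  apply: le_lt_trans h3 _; rewrite ltr_pdivlMr// in h2.
  apply: le_lt_trans h2; rewrite mulrC ler_wpM2l ?nc_ge0//; lra.
exists (fun z => dH (g z) * dg z), (L + K * L + 9 * (L * K ^+ 2)), d; split; [by rewrite lt_min e0 divr_gt0|lra|].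
move=> u v /hd[u1 u2] /hd[v1 v2].
have [h1 h2 h3 h4] := hg _ _ u1 v1; have [g1 g2 g3] := hH _ _ u2 v2; split => /=; first lra.
  have : nc (dH (g v) * dg v) <= K * L by rewrite ncM mulrC ler_pM ?nc_ge0.
  lra.
rewrite (_ : _ - _ - _ = (H (g u) - H (g v) - dH (g v) * (g u - g v)) +
   dH (g v) * (g u - g v - dg v * (u - v))); last by ring.
set D := nc (u - v) in h3 h4 *; have D0 : 0 <= D := nc_ge0 _.
have D20 : 0 <= L * D ^+ 2 by rewrite mulr_ge0// exprn_ge0.
apply: le_trans (ncD _ _) _.
have a1 : L * nc (g u - g v) ^+ 2 <= 9 * (L * K ^+ 2) * D ^+ 2.
  rewrite (_ : 9 * _ * _ = L * (3 * K * D) ^+ 2); last by ring.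
  by rewrite ler_wpM2l// lerXn2r ?nnegrE ?nc_ge0// !mulr_ge0.
have a2 : nc (dH (g v) * (g u - g v - dg v * (u - v))) <= K * L * D ^+ 2.
  by rewrite ncM (_ : K * L * _ = L * (K * D ^+ 2)) ?ler_pM ?nc_ge0//; ring.
lra.
Qed.

(** Schwarz reflection in the real axis; composed with z |-> c / z it becomes the reflection in a
    circle on which the square means rely. *)
Lemma hol_at_conj (F : C -> C) z0 : hol_at F z0^*%C ->
  hol_at (fun z => (F z^*%C)^*%C) z0.
Proof.
move=> [dF [K [e [e0 K0 hF]]]].
exists (fun z => (dF z^*%C)^*%C), K, e; split => // u v hu hv.
have hc (a b : C) : nc (a^*%C - b^*%C) = nc (a - b) by rewrite -rmorphB nc_conj.
have hu' : nc (u^*%C - z0^*%C) < e by rewrite hc.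
have hv' : nc (v^*%C - z0^*%C) < e by rewrite hc.
have [h1 h2 h3] := hF _ _ hu' hv'.
split; rewrite ?nc_conj//.
rewrite -(nc_conj (_ - _ - _)) !rmorphB rmorphM/= !conjcK rmorphB.
by move: h3; rewrite hc.
Qed.

Lemma hol_at_near (F G : C -> C) z0 (e : R) : 0 < e ->
  (forall z, nc (z - z0) < e -> F z = G z) -> hol_at F z0 -> hol_at G z0.
Proof.
move=> e0 FG [dF [K [e' [e'0 K0 hF]]]].
exists dF, K, (Num.min e e'); split => //; first by rewrite lt_min e0.
move=> u v; rewrite !lt_min => /andP[u1 u2] /andP[v1 v2].
by rewrite -!FG//; exact: hF.
Qed.

Lemma analytic_hol_at (U : set C) F z0 : analytic_on U F -> U z0 -> hol_at F z0.
Proof.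
move=> hF /hF[a [e [e0 h]]]; apply: (power_series_hol_at e0) => w hw.
by apply: h; rewrite normE ltcR.
Qed.

Lemma hol_at_continuous (H : C -> C) z0 : hol_at H z0 ->
  exists K e : R, [/\ 0 < e, 0 <= K & forall u, nc (u - z0) < e ->
    nc (H u - H z0) <= K * nc (u - z0)].
Proof.
move=> /hol_at_normalized[dH [K [e [e0 e1 K0 h]]]].
exists (3 * K), e; split => //; first by rewrite mulr_ge0.
by move=> u hu; have [|//] := h u z0 hu; rewrite subrr nc0.
Qed.

(* The junk value of the quotient at w is replaced by the derivative, found in
   the power series as the coefficient of degree one. *)
Lemma hol_at_slope (U : set C) (F : C -> C) (w : C) : analytic_on U F -> U w ->
  exists Q : C -> C, hol_at Q w /\ forall z, z != w -> Q z = (F z - F w) / (z - w).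
Proof.
move=> hF /hF[a [e [e0 h]]].
have Fw : F w = a 0%N.
  have ww : `|w - w| < e%:C by rewrite subrr normr0 ltcR.
  apply/esym; apply: (cvg_unique _ _ (h w ww)); first exact: norm_hausdorff.
  apply/cplx_cvgn_lt => eps eps0; exists 1%N => -[//|n] _.
  rewrite /series/= big_nat_recl//= expr0 mulr1 big1 ?addr0 ?subrr ?nc0// => i _.
  by rewrite ?subrr expr0n/= mulr0.
exists (fun z => if z == w then a 1%N else (F z - F w) / (z - w)); split; last first.
  by move=> z /negPf ->.
(* Dropping [a 0] and dividing by z - w shifts the coefficients by one, so n terms of the quotient
   correspond to n + 1 terms of F. *)
apply: (@power_series_hol_at _ _ (fun n => a n.+1) w e e0) => z hz.
apply/cplx_cvgn_lt => eps eps0.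
have [->|zw] := eqVneq z w.
  exists 1%N => -[//|n] _.
  rewrite /series/= big_nat_recl//= expr0 mulr1 big1 ?addr0 ?subrr ?nc0// => i _.
  by rewrite ?subrr expr0n/= mulr0.
have zw0 : z - w != 0 by rewrite subr_eq0.
have /h/cplx_cvgn_lt hh : `|z - w| < e%:C by rewrite normE ltcR.
have [|N hN] := hh (eps * nc (z - w)); first by rewrite mulr_gt0// nc_gt0.
exists N => n Nn; have := hN n.+1 (leqW Nn).
rewrite /series/= big_nat_recl//= expr0 mulr1 -Fw.
rewrite (_ : _ - _ = (\sum_(0 <= i < n) a i.+1 * (z - w) ^+ i -
    (F z - F w) / (z - w)) * (z - w)).
  by rewrite ncM ltr_pM2r// nc_gt0.
rewrite mulrBl divfK// mulr_suml.
under [X in _ = X - _]eq_bigr do rewrite -mulrA -exprSr.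
by ring.
Qed.

End HolClosure.

(** * Circle integrals *)

Section Trigonometry.
Context {R : realType}.
Local Notation C := R[i].
Local Notation nc := (@Normc.normc R).

(** Applied repeatedly, it integrates 1 - cos >= 0 into Taylor bounds for sin, then cos, then sin
    again. *)
Lemma nondecreasing_from0 (f df : R -> R) (x : R) :
  (forall y : R, is_derive y 1 f (df y)) ->
  (forall y, 0 <= y -> 0 <= df y) -> 0 <= x -> f 0 <= f x.
Proof.
move=> hf hdf x0; have [|c /itvP hc e] := @MVT_segment R f df 0 x x0 (fun y _ => hf y).
  by apply: derivable_within_continuous => y _; case: (hf y).
by rewrite -subr_ge0 e subr0 mulr_ge0// hdf// hc.
Qed.

Lemma sin_le_id (x : R) : 0 <= x -> sin x <= x.
Proof.
move=> x0; rewrite -subr_ge0.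
have := @nondecreasing_from0 (fun y => y - sin y) (fun y => 1 - cos y) x.
rewrite sin0 subrr; apply => // y _; by rewrite subr_ge0 cos_le1.
Qed.

Lemma cos_ge_sqr (x : R) : 1 - x ^+ 2 / 2 <= cos x.
Proof.
wlog x0 : x / 0 <= x.
  move=> h; have [/h//|x0] := leP 0 x.
  by rewrite -cosN -sqrrN h// oppr_ge0 ltW.
have := @nondecreasing_from0 (fun y => cos y - (1 - y ^+ 2 / 2)) (fun y => y - sin y) x.
rewrite cos0 expr0n/= mul0r subr0 subrr subr_ge0; apply => //.
  move=> y; apply: is_derive_eq; rewrite /GRing.scale/=; by field.
by move=> y y0; rewrite subr_ge0 sin_le_id.
Qed.

Lemma sin_ge_cubic (x : R) : 0 <= x -> x - x ^+ 3 / 6 <= sin x.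
Proof.
move=> x0.
have := @nondecreasing_from0 (fun y => sin y - (y - y ^+ 3 / 6)) (fun y => cos y - (1 - y ^+ 2 / 2)) x.
rewrite sin0 expr0n/= mul0r !subr0 subr_ge0; apply => //.
  move=> y; apply: is_derive_eq; rewrite /GRing.scale/=; by field.
by move=> y y0; rewrite subr_ge0 cos_ge_sqr.
Qed.

Lemma norm_sin_le (x : R) : `|sin x| <= `|x|.
Proof.
wlog x0 : x / 0 <= x.
  move=> h; have [/h//|x0] := leP 0 x.
  by rewrite -normrN -sinN -(normrN x) h// oppr_ge0 ltW.
rewrite (ger0_norm x0) ler_norml sin_le_id// andbT.
have [x1|x1] := leP x 1; last by rewrite (le_trans _ (sin_geN1 x))// lerN2 ltW.
apply: le_trans (sin_ge_cubic x0).
have : x ^+ 3 <= x * 1 by rewrite exprS ler_wpM2l// expr_le1.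
lra.
Qed.

Lemma norm_sinB_le (x : R) : `|x| <= 1 -> `|sin x - x| <= x ^+ 2.
Proof.
wlog x0 : x / 0 <= x.
  move=> h; have [/h//|x0] := leP 0 x.
  rewrite -normrN -(normrN (_ - _)) -sqrrN (_ : - (_ - _) = sin (- x) - - x).
    by move=> x1; rewrite h// oppr_ge0 ltW.
  by rewrite sinN; ring.
rewrite ger0_norm// => x1.
have h1 := sin_le_id x0; have h2 := sin_ge_cubic x0.
have : x ^+ 3 <= x ^+ 2 by rewrite exprS -[leRHS]mul1r ler_wpM2r// exprn_ge0.
have : 0 <= x ^+ 2 by rewrite exprn_ge0.
rewrite ler0_norm ?subr_le0//; lra.
Qed.

Lemma norm_cosB1_le (x : R) : `|cos x - 1| <= `|x|.
Proof.
rewrite ler0_norm ?subr_le0 ?cos_le1// opprB.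
have [x2|x2] := leP `|x| 2; last by rewrite (le_trans _ (ltW x2))//; have := cos_geN1 x; lra.
have := cos_ge_sqr x; rewrite -(real_normK (num_real x)).
by have : 0 <= `|x| by []; nra.
Qed.

(** 1 - cos x = 2 sin(x/2)^2, and sin y >= y - y^3/6 >= y/3 for 0 <= y <= 2, which covers y = x/2 <=
    pi/2. Hence 2 (x/6)^2 = x^2/18. *)
Lemma one_minus_cos_ge (x : R) : `|x| <= pi -> x ^+ 2 / 18 <= 1 - cos x.
Proof.
move=> xpi.
have -> : cos x = cos ((x / 2) *+ 2) by congr cos; rewrite mulr2n; field.
rewrite cos_mulr2n cos2sin2 mulr2n.
have : (x / 6) ^+ 2 <= sin (x / 2) ^+ 2; last by lra.
rewrite -[leLHS]real_normK ?num_real// -[leRHS]real_normK ?num_real//.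
rewrite lerXn2r ?nnegrE//.
wlog x0 : x xpi / 0 <= x.
  move=> h; have [/h|x0] := leP 0 x; first exact.
  rewrite -normrN -(normrN (sin _)) -sinN -!mulNr h ?normrN// oppr_ge0 ltW//.
rewrite ger0_norm ?divr_ge0//; apply: le_trans (ler_norm _).
have y0 : 0 <= x / 2 by rewrite divr_ge0.
apply: le_trans (sin_ge_cubic y0); rewrite ger0_norm// in xpi.
have := @pihalf_lt2 R; set y := x / 2 in y0 *.
have -> : x / 6 = y / 3 by rewrite /y; field.
move=> p2; have : y <= 2 by rewrite /y; lra.
move=> y2; have : y * y <= 2 * 2 by rewrite ler_pM.
rewrite !exprS expr0; nra.
Qed.

Definition cis (t : R) : C := cos t +i* sin t.

Lemma polarE (r t : R) : polar r t = r%:C * cis t.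
Proof. by []. Qed.

Lemma cisD (a b : R) : cis (a + b) = cis a * cis b.
Proof. by rewrite /cis cosD sinD; simpc; rewrite [_ * sin b + _]addrC. Qed.

Lemma nc_cis (t : R) : nc (cis t) = 1.
Proof. by rewrite /= cos2Dsin2 sqrtr1. Qed.

Lemma nc_polar (r t : R) : nc (polar r t) = `|r|.
Proof. by rewrite polarE ncM nc_cis mulr1 nc_real. Qed.

Lemma conj_cis (t : R) : (cis t)^*%C = (cis t)^-1.
Proof.
have c0 : cis t != 0 by rewrite -nc_gt0 nc_cis.
apply: (mulIf c0); rewrite mulVf//.
rewrite /cis; simpc; rewrite -!expr2 cos2Dsin2 mulrC subrr.
by [].
Qed.

Lemma cis_periodic (t : R) : cis (t + 2 * pi) = cis t.
Proof.
by rewrite /cis mulr_natl sinD2pi cosD2pi.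
Qed.

Lemma nc_cisB1_le (x : R) : nc (cis x - 1) <= 2 * `|x|.
Proof.
apply: le_trans (nc_le_ReIm _) _ => /=; rewrite subr0.
by have := norm_cosB1_le x; have := norm_sin_le x; lra.
Qed.

Lemma nc_cisB_le (s t : R) : nc (cis s - cis t) <= 2 * `|s - t|.
Proof.
have -> : cis s - cis t = cis t * (cis (s - t) - 1).
  by rewrite mulrBr mulr1 -cisD addrCA subrr addr0.
by rewrite ncM nc_cis mul1r nc_cisB1_le.
Qed.

Lemma nc_polarB_le (r s t : R) : nc (polar r s - polar r t) <= 2 * `|r| * `|s - t|.
Proof.
rewrite !polarE -mulrBr ncM nc_real mulrAC [leRHS]mulrC ler_wpM2l//.
exact: nc_cisB_le.
Qed.

Lemma nc_cis_taylor (x : R) : `|x| <= 1 -> nc (cis x - 1 - 'i%C * x%:C) <= 2 * x ^+ 2.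
Proof.
move=> x1; apply: le_trans (nc_le_ReIm _) _.
have -> : cis x - 1 - 'i%C * x%:C = (cos x - 1) +i* (sin x - x).
  by apply/eqP; rewrite eq_complex /=; apply/andP; split; apply/eqP; ring.
rewrite /=; have := norm_sinB_le x1.
have : `|cos x - 1| <= x ^+ 2 / 2.
  by rewrite ler0_norm ?subr_le0 ?cos_le1// opprB; have := cos_ge_sqr x; lra.
have : 0 <= x ^+ 2 by rewrite sqr_ge0.
lra.
Qed.

End Trigonometry.

(** * Integrals of complex-valued functions of a real variable *)

Section ComplexIntegral.
Context {R : realType}.
Local Notation C := R[i].
Local Notation nc := (@Normc.normc R).
Local Notation re := (@complex.Re R).
Local Notation im := (@complex.Im R).
Local Notation mu := (@lebesgue_measure R).
Implicit Types (D : set R) (f g : R -> C) (h k : R -> R).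

Definition cintegrable D f :=
  mu.-integrable D (fun t => (re (f t))%:E) /\
  mu.-integrable D (fun t => (im (f t))%:E).

Definition ccont f :=
  continuous (fun t : R => re (f t) : R) /\ continuous (fun t : R => im (f t) : R).

Lemma ReD (z w : C) : re (z + w) = re z + re w.
Proof. by case: z; case: w. Qed.

Lemma ImD (z w : C) : im (z + w) = im z + im w.
Proof. by case: z; case: w. Qed.

Lemma ReN (z : C) : re (- z) = - re z.
Proof. by case: z. Qed.

Lemma ImN (z : C) : im (- z) = - im z.
Proof. by case: z. Qed.

Lemma ReM (z w : C) : re (z * w) = re z * re w - im z * im w.
Proof. by case: z; case: w. Qed.

Lemma ImM (z w : C) : im (z * w) = re z * im w + im z * re w.
Proof. by case: z; case: w. Qed.

Lemma complex_eqP (z w : C) : re z = re w -> im z = im w -> z = w.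
Proof. by case: z => a b; case: w => c d /= -> ->. Qed.

Lemma ccontP f : ccont f <-> forall t e, 0 < e ->
  exists2 d : R, 0 < d & forall s, `|s - t| < d -> nc (f s - f t) < e.
Proof.
split=> [[cr ci] t e e0|h].
  have e2 : 0 < e / 2 by rewrite divr_gt0.
  have /cvgrPdist_lt/(_ _ e2)/nbhs_ballP[d1 /= d10 h1] := cr t.
  have /cvgrPdist_lt/(_ _ e2)/nbhs_ballP[d2 /= d20 h2] := ci t.
  exists (Num.min d1 d2); first by rewrite lt_min d10.
  move=> s; rewrite lt_min => /andP[s1 s2].
  apply: le_lt_trans (nc_le_ReIm _) _; rewrite ReD ReN ImD ImN.
  rewrite distrC [X in _ + X]distrC (splitr e) ltrD//.
  - by apply: h1; rewrite /ball/= distrC.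
  - by apply: h2; rewrite /ball/= distrC.
split=> t; apply/cvgrPdist_lt => e /(h t)[d d0 hd]; apply/nbhs_ballP; exists d => //= s;
    rewrite /ball/= distrC => /hd hs; rewrite distrC.
- by rewrite -ReN -ReD (le_lt_trans (le_Re_nc _)).
- by rewrite -ImN -ImD (le_lt_trans (le_Im_nc _)).
Qed.

Lemma ccont_cst (c : C) : ccont (fun=> c).
Proof. by split=> t; exact: cvg_cst. Qed.

Lemma ccontD f g : ccont f -> ccont g -> ccont (fun t => f t + g t).
Proof.
move=> [f1 f2] [g1 g2]; split=> t.
- by under eq_fun do rewrite ReD; apply: cvgD; [exact: f1|exact: g1].
- by under eq_fun do rewrite ImD; apply: cvgD; [exact: f2|exact: g2].
Qed.

Lemma ccontN f : ccont f -> ccont (fun t => - f t).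
Proof.
move=> [f1 f2]; split=> t.
- by under eq_fun do rewrite ReN; apply: cvgN; exact: f1.
- by under eq_fun do rewrite ImN; apply: cvgN; exact: f2.
Qed.

Lemma ccontB f g : ccont f -> ccont g -> ccont (fun t => f t - g t).
Proof. by move=> cf cg; apply: ccontD => //; exact: ccontN. Qed.

Lemma ccontM f g : ccont f -> ccont g -> ccont (fun t => f t * g t).
Proof.
move=> [f1 f2] [g1 g2]; split=> t.
- under eq_fun do rewrite ReM.
  by apply: cvgB; apply: cvgM; [exact: f1|exact: g1|exact: f2|exact: g2].
- under eq_fun do rewrite ImM.
  by apply: cvgD; apply: cvgM; [exact: f1|exact: g2|exact: f2|exact: g1].
Qed.

Lemma ccont_conj f : ccont f -> ccont (fun t => (f t)^*%C).
Proof.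
move=> /ccontP h; apply/ccontP => t e /(h t)[d d0 hd]; exists d => // s /hd.
by rewrite -rmorphB nc_conj.
Qed.

Lemma ccont_nc f : ccont f -> continuous (fun t : R => nc (f t) : R).
Proof.
move=> /ccontP h t; apply/cvgrPdist_lt => e /(h t)[d d0 hd].
apply/nbhs_ballP; exists d => //= s; rewrite /ball/= distrC => /hd; apply: le_lt_trans.
rewrite ler_norml; apply/andP; split.
- by rewrite lerNl opprB lerBlDr (le_trans _ (ncD _ _))// subrK.
- by rewrite lerBlDr -{1}(subrK (f s) (f t)) (le_trans (ncD _ _))// ncC.
Qed.

Lemma ccont_nc2 f : ccont f -> continuous (fun t : R => nc (f t) ^+ 2 : R).
Proof. by move=> /ccont_nc h t; apply: cvgM; exact: h. Qed.

Lemma ccont_real h : continuous h -> ccont (fun t => (h t)%:C).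
Proof. by move=> ch; split=> t /=; [exact: ch|exact: cvg_cst]. Qed.

Lemma ccont_cis : ccont (@cis R).
Proof. by split; [exact: continuous_cos|exact: continuous_sin]. Qed.

Lemma ccont_polar (r : R) : ccont (polar r).
Proof. by apply: ccontM; [exact: ccont_cst|exact: ccont_cis]. Qed.

Lemma ccont_shift f (c : R) : ccont f -> ccont (fun t => f (t + c)).
Proof.
move=> /ccontP h; apply/ccontP => t e /(h (t + c))[d d0 hd]; exists d => // s hs.
by apply: hd; rewrite opprD addrACA subrr addr0.
Qed.

Lemma ccont_inv f : ccont f -> (forall t, f t != 0) -> ccont (fun t => (f t)^-1).
Proof.
move=> cf f0.
have -> : (fun t => (f t)^-1) = (fun t => (f t)^*%C * ((nc (f t) ^+ 2)^-1)%:C).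
  apply/funext => t; apply: (mulfI (f0 t)); rewrite divff// mulrA.
  have -> : f t * (f t)^*%C = (nc (f t) ^+ 2)%:C.
    rewrite nc_sqr; case: (f t) => a b; simpc; rewrite -!expr2; congr (_ +i* _).
    by rewrite addrC mulrC subrr.
  by rewrite -rmorphM/= divff// expf_eq0/= nc_eq0.
apply: ccontM; first exact: ccont_conj.
apply: ccont_real => t; apply: cvgV; last exact: ccont_nc2.
by rewrite expf_eq0/= nc_eq0.
Qed.

Lemma continuous_itv_integrable h (a b : R) : continuous h ->
  mu.-integrable `[a, b] (fun t => (h t)%:E).
Proof.
move=> ch; apply: continuous_compact_integrable; first exact: segment_compact.
exact: continuous_subspaceT.
Qed.

Lemma ccont_cintegrable f (a b : R) : ccont f -> cintegrable `[a, b] f.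
Proof. by move=> [? ?]; split; exact: continuous_itv_integrable. Qed.

Lemma cintegralD D f g : measurable D -> cintegrable D f -> cintegrable D g ->
  cintegral D (fun t => f t + g t) = cintegral D f + cintegral D g.
Proof.
move=> mD [f1 f2] [g1 g2]; apply: complex_eqP; rewrite ?ReD ?ImD/=.
- by under eq_Rintegral do rewrite ReD; rewrite RintegralD.
- by under eq_Rintegral do rewrite ImD; rewrite RintegralD.
Qed.

Lemma integrable_lin D h k (a b : R) : measurable D ->
  mu.-integrable D (fun t => (h t)%:E) -> mu.-integrable D (fun t => (k t)%:E) ->
  mu.-integrable D (fun t => (a * h t + b * k t)%:E).
Proof.
move=> mD ih ik.
apply: (@eq_integrable _ _ _ mu D mD (fun t => a%:E * (h t)%:E + b%:E * (k t)%:E)%E) => //.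
by apply: integrableD => //; exact: integrableZl.
Qed.

Lemma Rintegral_lin D h k (a b : R) : measurable D ->
  mu.-integrable D (fun t => (h t)%:E) -> mu.-integrable D (fun t => (k t)%:E) ->
  (\int[mu]_(t in D) (a * h t + b * k t) =
   a * \int[mu]_(t in D) h t + b * \int[mu]_(t in D) k t)%R.
Proof.
move=> mD ih ik.
have i1 : mu.-integrable D (EFin \o (fun t => a * h t)) 
  
  by apply: (@eq_integrable _ _ _ mu D mD (fun t => a%:E * (h t)%:E)%E) => //; exact: integrableZl.
have i2 : mu.-integrable D (EFin \o (fun t => b * k t)) 
  
  by apply: (@eq_integrable _ _ _ mu D mD (fun t => b%:E * (k t)%:E)%E) => //; exact: integrableZl.
by rewrite RintegralD// !RintegralZl.
Qed.

Lemma cintegrableD D f g : measurable D -> cintegrable D f -> cintegrable D g ->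
  cintegrable D (fun t => f t + g t).
Proof.
move=> mD [f1 f2] [g1 g2]; split.
- by under eq_fun do rewrite ReD -(mul1r (re (f _))) -(mul1r (re (g _))); exact: integrable_lin.
- by under eq_fun do rewrite ImD -(mul1r (im (f _))) -(mul1r (im (g _))); exact: integrable_lin.
Qed.

Lemma cintegrableZ D f (c : C) : measurable D -> cintegrable D f ->
  cintegrable D (fun t => c * f t).
Proof.
move=> mD [f1 f2]; split.
- by under eq_fun do rewrite ReM -mulNr; exact: integrable_lin.
- by under eq_fun do rewrite ImM; exact: integrable_lin.
Qed.

Lemma cintegralZ D f (c : C) : measurable D -> cintegrable D f ->
  cintegral D (fun t => c * f t) = c * cintegral D f.
Proof.
move=> mD [f1 f2]; apply: complex_eqP; rewrite ?ReM ?ImM /cintegral/=.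
- by rewrite -mulNr -Rintegral_lin//; apply: eq_Rintegral => t _; rewrite ReM mulNr.
- by rewrite -Rintegral_lin//; apply: eq_Rintegral => t _; rewrite ImM.
Qed.

Lemma cintegralB D f g : measurable D -> cintegrable D f -> cintegrable D g ->
  cintegral D (fun t => f t - g t) = cintegral D f - cintegral D g.
Proof.
move=> mD cf cg; have cg' := cintegrableZ (-1) mD cg.
rewrite -mulN1r -cintegralZ// -cintegralD//.
by under [in RHS]eq_fun do rewrite mulN1r.
Qed.

(** The factor 2 is the price of estimating the real and imaginary parts separately. *)
Lemma nc_cintegral_le D f h : measurable D -> cintegrable D f ->
  mu.-integrable D (fun t => (h t)%:E) -> (forall t, D t -> nc (f t) <= h t) ->
  nc (cintegral D f) <= 2 * (\int[mu]_(t in D) h t)%R.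
Proof.
move=> mD [f1 f2] ih fh; apply: le_trans (nc_le_ReIm _) _ => /=.
rewrite (_ : 2 = 1 + 1)// mulrDl mul1r lerD//.
- apply: le_trans (@le_normr_Rintegral _ _ _ mu D (fun t => re (f t)) mD f1) _; apply: le_Rintegral => //.
    exact: integrable_norm.
  by move=> t Dt; rewrite (le_trans (le_Re_nc _))// fh.
- apply: le_trans (@le_normr_Rintegral _ _ _ mu D (fun t => im (f t)) mD f2) _; apply: le_Rintegral => //.
    exact: integrable_norm.
  by move=> t Dt; rewrite (le_trans (le_Im_nc _))// fh.
Qed.

Lemma cintegral_cst (a b : R) (c : C) : a <= b ->
  cintegral `[a, b] (fun=> c) = (b - a)%:C * c.
Proof.
move=> ab; apply: complex_eqP; rewrite /cintegral/= Rintegral_cst//= lebesgue_measure_itv/=;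
  rewrite lte_fin; case: ltgtP ab => //= [ab|->] _; case: c => x y /=; rewrite ?subrr; ring.
Qed.

Lemma Rintegral_derive h k (a b : R) : a < b -> continuous k ->
  (forall x, a <= x <= b -> is_derive x 1 h (k x)) ->
  (\int[mu]_(t in `[a, b]) k t)%R = h b - h a.
Proof.
move=> ab ck hd; rewrite /Rintegral (@continuous_FTC2 _ _ h)//.
- exact: continuous_subspaceT.
- have hc x : a <= x <= b -> {for x, continuous h}.
    by move=> /hd [dx _]; apply/differentiable_continuous/derivable1_diffP.
  split.
  + by move=> x; rewrite in_itv/= => /andP[ax xb]; case: (hd x) => //; rewrite !ltW.
  + by apply: cvg_at_right_filter; apply: hc; rewrite lexx ltW.
  + by apply: cvg_at_left_filter; apply: hc; rewrite lexx ltW.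
- move=> x; rewrite in_itv/= => /andP[ax xb]; rewrite derive1E.
  by case: (hd x) => //; rewrite !ltW.
Qed.

Lemma is_derive_shift_arg k (x c d : R) : is_derive (x + c) 1 k d ->
  is_derive x 1 (fun t => k (t + c)) d.
Proof.
move=> kd.
have hs : is_derive x (1 : R) (fun t : R => t + c) (1 : R).
  by apply: is_derive_eq; rewrite addr0.
by have := @is_derive1_comp R k (fun t => t + c) x d 1 kd hs; rewrite mulr1.
Qed.

(** The fundamental theorem is applied on [M, x + 1], which contains x in its interior; one function
    thus serves on the whole half-line. *)
Lemma continuous_primitive k (M : R) : continuous k ->
  exists h : R -> R, forall x, M < x -> is_derive x 1 h (k x).
Proof.
move=> ck; exists (fun x => \int[mu]_(t in `[M, x]) k t)%R => x Mx.
have [||||d1 d2] := @continuous_FTC1_closed R k M x (x + 1) => //.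
- by rewrite ltrDl.
- exact: continuous_itv_integrable.
- exact: ck.
by split => //; rewrite -derive1E.
Qed.

Lemma Rintegral_shift k (a b c : R) : a < b -> continuous k ->
  (\int[mu]_(t in `[a, b]) k (t + c) = \int[mu]_(t in `[(a + c), (b + c)]) k t)%R.
Proof.
move=> ab ck; have [h hd] := continuous_primitive (Num.min a (a + c) - 1) ck.
have ab' : a + c < b + c by rewrite ltrD2r.
have ck' : continuous (fun t => k (t + c)).
  move=> t; apply: (@continuous_comp _ _ _ (fun t : R => t + c) k); last exact: ck.
  by apply: cvgD; [exact: cvg_id|exact: cvg_cst].
have lt1 x : a <= x -> Num.min a (a + c) - 1 < x + c.
  move=> xa; apply: (@lt_le_trans _ _ (a + c)); last by rewrite lerD2r.
  by rewrite ltrBlDr; apply: (@le_lt_trans _ _ (a + c)); rewrite ?ge_min ?lexx ?orbT// ltrDl.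
have -> : (\int[mu]_(t in `[a, b]) k (t + c) = h (b + c) - h (a + c))%R.
  apply: (@Rintegral_derive (fun t => h (t + c)) (fun t => k (t + c))) => //.
  move=> x /andP[xa _]; have hh := hd _ (lt1 _ xa).
  exact: is_derive_shift_arg.
apply/esym; apply: Rintegral_derive => // x /andP[xa _]; apply: hd.
by rewrite (lt_le_trans (lt1 a _)).
Qed.

(** With h a primitive of k, the function h(x + T) - h(x) has derivative k(x + T) - k(x) = 0. The
    point M lies below both c and 0, so this function takes the same value at both. *)
Lemma Rintegral_periodic k (T c : R) : 0 < T -> continuous k ->
  (forall t, k (t + T) = k t) ->
  (\int[mu]_(t in `[c, (c + T)]) k t = \int[mu]_(t in `[0, T]) k t)%R.
Proof.
move=> T0 ck pk; pose M := - `|c| - 1.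
have [h hd] := continuous_primitive M ck.
have M0 : M < 0 by rewrite /M; have : 0 <= `|c| by []; lra.
have Mc : M < c by rewrite /M; have := ler_norm (- c); rewrite normrN; lra.
have -> : (\int[mu]_(t in `[c, (c + T)]) k t = h (c + T) - h c)%R.
  apply: Rintegral_derive; rewrite ?ltrDl// => x /andP[xc _]; apply: hd.
  exact: lt_le_trans Mc xc.
have -> : (\int[mu]_(t in `[0, T]) k t = h T - h 0)%R.
  apply: Rintegral_derive => // x /andP[xc _]; apply: hd.
  exact: lt_le_trans M0 xc.
pose D x := h (x + T) - h x.
have hD x : M < x -> is_derive x 1 D 0.
  move=> Mx; have h1 := hd _ Mx.
  have h2 : is_derive (x + T) 1 h (k (x + T)).
    by apply: hd; rewrite (lt_trans Mx)// ltrDl.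
  have h3 : is_derive x 1 (fun t => h (t + T)) (k (x + T)) by exact: is_derive_shift_arg.
  have -> : D = (fun t => h (t + T)) - h by apply/funext.
  by apply: is_derive_eq; rewrite pk subrr.
have key a b : a <= b -> M < a -> D b = D a.
  move=> ab Ma; have [|||y _ e] := @MVT_segment R D (fun=> 0) a b => //.
  - by move=> x; rewrite in_itv/= => /andP[ax _]; apply: hD; exact: lt_trans Ma ax.
  - apply: derivable_within_continuous => x; rewrite in_itv/= => /andP[ax _].
    by case: (hD x) => //; exact: lt_le_trans Ma ax.
  - by apply/eqP; rewrite -subr_eq0 e mul0r.
have : D c = D 0.
  by case: (leP 0 c) => h0; [rewrite (key 0 c)|rewrite (key c 0)// ltW].
by rewrite /D add0r.
Qed.

End ComplexIntegral.

(** * Cauchy and Poisson formulas *)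

Section CircleIntegrals.
Context {R : realType}.
Local Notation C := R[i].
Local Notation nc := (@Normc.normc R).
Local Notation re := (@complex.Re R).
Local Notation im := (@complex.Im R).

(** Integration is in dt. Since dz = i z dt, this is the contour integral of H(z) / (i z); mean
    values come out directly and Cauchy's kernel appears as z / (z - w). *)
Definition circle_integral (H : C -> C) (r : R) : C :=
  cintegral `[0, 2 * pi] (fun t => H (polar r t)).

Lemma polar_periodic (r t : R) : polar r (t + 2 * pi) = polar r t.
Proof. by rewrite !polarE cis_periodic. Qed.

Lemma pi2_gt0 : 0 < 2 * pi :> R.
Proof. by rewrite mulr_gt0// pi_gt0. Qed.

Lemma hol_ccont (H : C -> C) (r : R) : (forall t, hol_at H (polar r t)) ->
  ccont (fun t => H (polar r t)).
Proof.
move=> hH; apply/ccontP => t e e0.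
have [K [d [d0 K0 h]]] := hol_at_continuous (hH t).
have K1 : 0 < K + 1 by rewrite ltr_wpDl.
pose m := Num.min d (e / (K + 1)); have m0 : 0 < m by rewrite lt_min d0 divr_gt0.
have L0 : 0 < 2 * `|r| + 1 by rewrite ltr_wpDl// mulr_ge0.
exists (m / (2 * `|r| + 1)); first by rewrite divr_gt0.
move=> s; rewrite ltr_pdivlMr// => hs.
have hst : nc (polar r s - polar r t) < m.
  apply: le_lt_trans (nc_polarB_le _ _ _) _; apply: le_lt_trans hs.
  by rewrite mulrC ler_wpM2l// lerDl.
have [h1 h2] : nc (polar r s - polar r t) < d /\ nc (polar r s - polar r t) < e / (K + 1).
  by apply/andP; rewrite -lt_min.
apply: le_lt_trans (h _ h1) _; rewrite ltr_pdivlMr// in h2; apply: le_lt_trans h2.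
by rewrite mulrC ler_wpM2l ?nc_ge0// lerDl.
Qed.

Lemma cintegral_rotate (f : R -> C) (c : R) : ccont f ->
  (forall t, f (t + 2 * pi) = f t) ->
  cintegral `[0, 2 * pi] (fun t => f (t + c)) = cintegral `[0, 2 * pi] f.
Proof.
move=> [cr ci] pf; rewrite /cintegral; congr (_ +i* _).
- rewrite (@Rintegral_shift _ (fun t => re (f t)) 0 (2 * pi) c pi2_gt0 cr).
  rewrite add0r [2 * pi + c]addrC (@Rintegral_periodic _ (fun t => re (f t)))//.
    exact: pi2_gt0.
  by move=> t; rewrite pf.
- rewrite (@Rintegral_shift _ (fun t => im (f t)) 0 (2 * pi) c pi2_gt0 ci).
  rewrite add0r [2 * pi + c]addrC (@Rintegral_periodic _ (fun t => im (f t)))//.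
    exact: pi2_gt0.
  by move=> t; rewrite pf.
Qed.

(** Quadratic increments mean a zero derivative. Composition with the clamp onto [a, b], which is
    1-Lipschitz, extends this to the whole line, so that no one-sided derivative is met at a or
    b. *)
Lemma eq_of_quadratic_increments (g : R -> R) (a b : R) : a <= b ->
  (forall x, a <= x <= b -> exists K d : R, [/\ 0 < d, 0 <= K &
     forall y, a <= y <= b -> `|y - x| < d -> `|g y - g x| <= K * (y - x) ^+ 2]) ->
  g a = g b.
Proof.
move=> ab hg; pose cl (x : R) := Num.max a (Num.min x b).
have cl1 x : a <= cl x <= b by rewrite /cl le_max lexx ge_max ab ge_min lexx orbT.
have cl2 x y : `|cl x - cl y| <= `|x - y|.
  have lmin u v : `|Num.min u b - Num.min v b| <= `|u - v|.
    by rewrite !minEle; case: (leP u b) => ?; case: (leP v b) => ?;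
      rewrite ler_norml; apply/andP; split; case: (ger0P (u - v)) => ?; lra.
  have lmax u v : `|Num.max a u - Num.max a v| <= `|u - v|.
    by rewrite !maxEle; case: (leP a u) => ?; case: (leP a v) => ?;
      rewrite ler_norml; apply/andP; split; case: (ger0P (u - v)) => ?; lra.
  exact: le_trans (lmax _ _) (lmin _ _).
have hd (x : R) : is_derive x 1 (g \o cl) 0.
  have [K [d [d0 K0 h]]] := hg _ (cl1 x).
  have hc : (fun h : R => h^-1 *: ((g \o cl) (h *: 1 + x) - (g \o cl) x)) @ 0^' --> (0 : R).
    have K1 : 0 < K + 1 by rewrite ltr_wpDl.
    apply/cvgrPdist_lt => e e0; near=> k.
    have k0 : k != 0 by near: k; exact: nbhs_dnbhs_neq.
    rewrite sub0r normrN /GRing.scale/= mulr1 normrM normfV.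
    rewrite ltr_pdivrMl ?normr_gt0//.
    have kd : `|cl (k + x) - cl x| <= `|k| by rewrite (le_trans (cl2 _ _))// addrK.
    have kd' : `|cl (k + x) - cl x| < d.
      apply: le_lt_trans kd _; near: k; apply: dnbhs0_lt => //.
    apply: le_lt_trans (h _ (cl1 _) kd') _.
    rewrite -(real_normK (num_real (_ - cl x))).
    apply: (@le_lt_trans _ _ (K * `|k| ^+ 2)).
      by rewrite ler_wpM2l// lerXn2r ?nnegrE.
    rewrite expr2 mulrCA ltr_pM2l ?normr_gt0//.
    apply: (@le_lt_trans _ _ ((K + 1) * `|k|)); first by rewrite ler_wpM2r// lerDl.
    rewrite mulrC -ltr_pdivlMr//; near: k; apply: dnbhs0_lt.
    by rewrite divr_gt0.
  split; first by apply/cvg_ex; exists 0.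
  exact/cvg_lim.
have := is_derive_0_is_cst a b hd; rewrite /= /cl.
by rewrite minxx (min_idPl ab) maxxx (max_idPr ab).
Unshelve. all: by end_near. Qed.

(* The combination of increments along u - v and w - v with (u - v) + i (w - v)
   of second order eliminates the derivative. *)
Lemma hol_at_three_points (H : C -> C) z0 : hol_at H z0 ->
  exists K e : R, [/\ 0 < e, 0 <= K & forall u w v, nc (u - z0) < e ->
    nc (w - z0) < e -> nc (v - z0) < e ->
    nc ((H u - H v) + 'i%C * (H w - H v)) <=
    K * (nc (u - v) ^+ 2 + nc (w - v) ^+ 2 + nc ((u - v) + 'i%C * (w - v)))].
Proof.
move=> [dH [K [e [e0 K0 h]]]]; exists K, e; split => // u w v hu hw hv.
have [_ h2 h3] := h _ _ hu hv; have [_ _ h4] := h _ _ hw hv.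
rewrite (_ : _ + _ * _ = (H u - H v - dH v * (u - v)) +
   'i%C * (H w - H v - dH v * (w - v)) + dH v * ((u - v) + 'i%C * (w - v))); last by ring.
rewrite [leRHS]mulrDr [X in _ <= X + _]mulrDr; apply: le_trans (ncD _ _) _; rewrite lerD//.
  by apply: le_trans (ncD _ _) _; rewrite lerD// ncM nc_i mul1r.
by rewrite ncM ler_wpM2r ?nc_ge0.
Qed.

(** Compactness of the circle makes the local constants uniform. In [P n] one integer controls both
    of them, n as the constant and 1/(n+1) as the radius. *)
Lemma hol_at_three_points_circle (H : C -> C) (r : R) :
  (forall t, hol_at H (polar r t)) ->
  exists K e : R, [/\ 0 < e, 0 <= K & forall t, 0 <= t <= 2 * pi -> forall u w v,
    nc (u - polar r t) < e -> nc (w - polar r t) < e -> nc (v - polar r t) < e ->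
    nc ((H u - H v) + 'i%C * (H w - H v)) <=
    K * (nc (u - v) ^+ 2 + nc (w - v) ^+ 2 + nc ((u - v) + 'i%C * (w - v)))].
Proof.
move=> hH.
pose P (n : nat) (t : R) := forall u w v,
    nc (u - polar r t) < n.+1%:R^-1 -> nc (w - polar r t) < n.+1%:R^-1 ->
    nc (v - polar r t) < n.+1%:R^-1 ->
    nc ((H u - H v) + 'i%C * (H w - H v)) <=
    n%:R * (nc (u - v) ^+ 2 + nc (w - v) ^+ 2 + nc ((u - v) + 'i%C * (w - v))).
have hcov : \forall n \near \oo, `[0, 2 * pi]%classic `<=` P n.
  apply: (compact_near_coveringP _).1; first exact: segment_compact.
  move=> t _; have [K [e [e0 K0 h]]] := hol_at_three_points (hH t).
  have e2 : 0 < e / 2 by rewrite divr_gt0.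
  have L0 : 0 < 2 * `|r| + 1 by rewrite ltr_wpDl// mulr_ge0.
  have c0 : 0 < e / 2 / (2 * `|r| + 1) by rewrite divr_gt0.
  (* Half of e is spent on moving the centre from t to s, the other half on the radius around the
     new centre. *)
  exists (ball t (e / 2 / (2 * `|r| + 1)),
     [set n : nat | K <= n%:R /\ n.+1%:R^-1 < e / 2]) => /=.
    split; first exact: nbhsx_ballx.
    apply: filterI; first exact: nbhs_infty_ger.
    exact: near_infty_natSinv_lt (PosNum e2).
  move=> [s n] [/= hs [Kn ne]] u w v hu hw hv.
  have hst : nc (polar r s - polar r t) < e / 2.
    apply: le_lt_trans (nc_polarB_le _ _ _) _.
    rewrite /ball/= distrC ltr_pdivlMr// in hs; apply: le_lt_trans hs.
    by rewrite mulrC ler_wpM2l// lerDl.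
  have tri z : nc (z - polar r s) < n.+1%:R^-1 -> nc (z - polar r t) < e.
    move=> hz; rewrite (_ : z - _ = (z - polar r s) + (polar r s - polar r t)); last by ring.
    apply: le_lt_trans (ncD _ _) _; rewrite (splitr e) ltrD//.
    exact: lt_trans ne.
  apply: le_trans (h _ _ _ (tri _ hu) (tri _ hw) (tri _ hv)) _.
  by rewrite ler_wpM2r// !addr_ge0 ?exprn_ge0 ?nc_ge0.
have [N _ /(_ N (leqnn N)) hN] := hcov.
exists N%:R, N.+1%:R^-1; split => // t ht; exact: hN.
Qed.

Lemma three_points_identity (x s c c' : C) :
  x * c + x * s * c - x * c + 'i%C * (x * (c * c') - x * c) =
  'i%C * x * c * (c' - 1 - 'i%C * s).
Proof.
have : ('i%C : C) * 'i%C = -1 by rewrite -expr2 sqr_i.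
move: ('i%C : C) => j jj.
transitivity (j * x * c * (c' - 1) - j * j * (x * c * s)); last by ring.
by rewrite jj; ring.
Qed.

Lemma conjM (a b : C) : (a * b)^*%C = a^*%C * b^*%C.
Proof. exact: rmorphM. Qed.

Lemma conjB (a b : C) : (a - b)^*%C = a^*%C - b^*%C.
Proof. exact: rmorphB. Qed.

Lemma realM (a b : R) : (a * b)%:C = a%:C * b%:C.
Proof. exact: rmorphM. Qed.

Lemma realB (a b : R) : (a - b)%:C = a%:C - b%:C.
Proof. exact: rmorphB. Qed.

Lemma realV (a : R) : (a^-1)%:C = (a%:C)^-1.
Proof. exact: fmorphV. Qed.

Lemma reflected_kernel_identity (z w : C) : z != 0 -> z - w != 0 ->
  (z * z^*%C * (z * z^*%C - w^*%C * z)^-1)^*%C = z / (z - w).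
Proof.
move=> z0 zw0; rewrite conjM conjc_inv conjB !conjM !conjcK.
have : z^*%C != 0 by rewrite conjc_eq0.
move: (z^*%C) => y y0.
rewrite (_ : y * z - w * y = y * (z - w)); last by ring.
by field; rewrite y0 zw0.
Qed.

(** The Cauchy-Riemann equations in polar form, by finite increments: a radial step k is paired with
    the rotation by k/x, whose increment integrates to zero. The two increments cancel to first
    order by the three-point estimate, so the integral changes by O(k^2). *)
Lemma circle_integral_const (H : C -> C) (a b : R) : 0 < a -> a <= b ->
  (forall z, a <= nc z <= b -> hol_at H z) ->
  circle_integral H a = circle_integral H b.
Proof.
move=> a0 ab hH.
have hcirc r : a <= r <= b -> forall t, hol_at H (polar r t).
  move=> /andP[ar rb] t; apply: hH; rewrite nc_polar ger0_norm ?ar//.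
  exact: le_trans (ltW a0) ar.
have key x : a <= x <= b -> exists K d : R, [/\ 0 < d, 0 <= K &
   forall y, a <= y <= b -> `|y - x| < d ->
     nc (circle_integral H y - circle_integral H x) <= K * (y - x) ^+ 2].
  move=> xab; have x0 : 0 < x by case/andP: xab => ax _; exact: lt_le_trans a0 ax.
  have [K [e [e0 K0 h]]] := hol_at_three_points_circle (hcirc _ xab).
  pose d := Num.min x (e / 2).
  (* 5 = 1 + 4 bounds the squared radial and tangential steps and 2 / x the second-order error of
     [cis]; the outer 2 is the constant of [nc_cintegral_le], and 2 pi the length of the
     interval. *)
  exists (2 * (K * (5 + 2 / x)) * (2 * pi)), d; split.
  - by rewrite lt_min x0 divr_gt0.
  - by rewrite !mulr_ge0 ?pi_ge0 ?addr_ge0 ?divr_ge0 ?(ltW x0).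
  move=> y yab; rewrite lt_min => /andP[yx yx'].
  set k := y - x in yx yx' *; pose s := k / x.
  have cx := hol_ccont (hcirc _ xab); have cy := hol_ccont (hcirc _ yab).
  have ci (f : R -> C) : ccont f -> cintegrable `[0, 2 * pi] f by move=> cf; exact: ccont_cintegrable.
  have mD : measurable (`[0, 2 * pi]%classic : set R) by [].
  have rot : cintegral `[0, 2 * pi] (fun t => H (polar x (t + s))) = circle_integral H x.
    rewrite (@cintegral_rotate (fun t => H (polar x t)))// => t.
    by rewrite polar_periodic.
  have cs : ccont (fun t => H (polar x (t + s))).
    exact: (@ccont_shift _ (fun t => H (polar x t))).
  have -> : circle_integral H y - circle_integral H x = cintegral `[0, 2 * pi] (fun t =>
      (H (polar y t) - H (polar x t)) + 'i%C * (H (polar x (t + s)) - H (polar x t))).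
    rewrite cintegralD//; [|exact/ci/ccontB|apply/cintegrableZ => //; exact/ci/ccontB].
    rewrite cintegralZ//; last exact/ci/ccontB.
    rewrite !cintegralB ?rot//; try exact: ci.
    by rewrite subrr mulr0 addr0.
  apply: le_trans (nc_cintegral_le (h := fun=> K * (5 + 2 / x) * k ^+ 2) mD _ _ _) _.
  - apply: ci; apply: ccontD; first exact: ccontB.
    by apply: ccontM; [exact: ccont_cst|exact: ccontB].
  - by apply: continuous_itv_integrable => t; exact: cvg_cst.
  - move=> t; rewrite /= in_itv/= => ht.
    have u1 : nc (polar y t - polar x t) = `|k|.
      by rewrite !polarE -mulrBl ncM nc_cis mulr1 -rmorphB nc_real.
    have w1 : nc (polar x (t + s) - polar x t) <= 2 * `|k|.
      apply: le_trans (nc_polarB_le _ _ _) _.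
      rewrite addrAC subrr add0r /s normrM normfV (gtr0_norm x0).
      by apply: eq_ler; field; rewrite gt_eqF.
    have ke : `|k| < e by lra.
    apply: le_trans (h t ht _ _ _ _ _ _) _.
    + by rewrite u1.
    + by apply: le_lt_trans w1 _; lra.
    + by rewrite subrr nc0.
    rewrite -mulrA ler_wpM2l//.
    have s1 : `|s| <= 1.
      by rewrite /s normrM normfV (gtr0_norm x0) ler_pdivrMr// mul1r ltW.
    have -> : polar y t - polar x t + 'i%C * (polar x (t + s) - polar x t) =
       'i%C * x%:C * cis t * (cis s - 1 - 'i%C * s%:C).
      have -> : polar y t = polar x t + x%:C * s%:C * cis t.
        rewrite !polarE -mulrDl -rmorphM -rmorphD; congr (_%:C * _).
        by rewrite /s /k; field; rewrite gt_eqF.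
      rewrite !polarE cisD.
      exact: three_points_identity.
    rewrite !ncM nc_i nc_cis nc_real (gtr0_norm x0) mul1r mulr1 u1 real_normK ?num_real//.
    have := nc_cis_taylor s1 => /(ler_wpM2l (ltW x0)).
    have -> : x * (2 * s ^+ 2) = 2 / x * k ^+ 2 by rewrite /s; field; rewrite gt_eqF.
    have : nc (polar x (t + s) - polar x t) ^+ 2 <= 4 * k ^+ 2.
      rewrite -(real_normK (num_real k)) (_ : 4 * _ = (2 * `|k|) ^+ 2); last by ring.
      by rewrite lerXn2r ?nnegrE ?nc_ge0// mulr_ge0.
    lra.
  - rewrite Rintegral_cst//= lebesgue_measure_itv/= lte_fin pi2_gt0/= subr0.
    by apply: eq_ler; ring.
apply: complex_eqP.
- apply: (@eq_of_quadratic_increments (fun r => re (circle_integral H r))) => // x /key[K [d [d0 K0 h]]].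
  exists K, d; split => // y hy yx; apply: le_trans (h _ hy yx).
  by rewrite -ReN -ReD le_Re_nc.
- apply: (@eq_of_quadratic_increments (fun r => im (circle_integral H r))) => // x /key[K [d [d0 K0 h]]].
  exists K, d; split => // y hy yx; apply: le_trans (h _ hy yx).
  by rewrite -ImN -ImD le_Im_nc.
Qed.


(** The integral is the same on all smaller circles, and on the circle of small radius a the
    function is within K a of [H 0]. *)
Lemma mean_value (H : C -> C) (r : R) : 0 < r ->
  (forall z, nc z <= r -> hol_at H z) ->
  circle_integral H r = (2 * pi)%:C * H 0.
Proof.
move=> r0 hH.
have h0 : hol_at H 0 by apply: hH; rewrite nc0 ltW.
have [K [e [e0 K0 h]]] := hol_at_continuous h0.
have mD : measurable (`[0, 2 * pi]%classic : set R) by [].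
apply/eqP; rewrite -subr_eq0 -nc_eq0 eq_le nc_ge0 andbT.
apply/ler_addgt0Pr => eps eps0; rewrite add0r.
have K1 : 0 < 2 * (2 * pi) * (K + 1).
  by rewrite !mulr_gt0 ?pi_gt0// ltr_wpDl.
pose a := Num.min r (Num.min (e / 2) (eps / (2 * (2 * pi) * (K + 1)))).
have a0 : 0 < a by rewrite !lt_min r0 !divr_gt0.
have ar : a <= r by rewrite ge_min lexx.
have ae : a < e.
  apply: (@le_lt_trans _ _ (e / 2)); first by rewrite !ge_min lexx !orbT.
  by rewrite ltr_pdivrMr// ltr_pMr// ltr1n.
have aeps : a * (2 * (2 * pi) * (K + 1)) <= eps.
  by rewrite -ler_pdivlMr// !ge_min lexx !orbT.
rewrite -(circle_integral_const a0 ar); last first.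
  by move=> z /andP[_ ?]; exact: hH.
have ca : ccont (fun t => H (polar a t)).
  by apply: hol_ccont => t; apply: hH; rewrite nc_polar gtr0_norm.
rewrite (_ : (2 * pi)%:C * H 0 = cintegral `[0, 2 * pi] (fun=> H 0)); last first.
  by rewrite cintegral_cst ?subr0// ltW// pi2_gt0.
rewrite /circle_integral -cintegralB//; [|exact: ccont_cintegrable..|]; last first.
  exact/ccont_cintegrable/ccont_cst.
apply: le_trans (nc_cintegral_le (h := fun=> K * a) mD _ _ _) _.
- by apply: ccont_cintegrable; apply: ccontB => //; exact: ccont_cst.
- by apply: continuous_itv_integrable => t; exact: cvg_cst.
- move=> t _; apply: le_trans (h _ _) _; rewrite subr0 nc_polar gtr0_norm//.
- rewrite Rintegral_cst//= lebesgue_measure_itv/= lte_fin pi2_gt0/= subr0.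
  apply: le_trans aeps; rewrite (_ : 2 * _ = a * (2 * (2 * pi) * K)); last by ring.
  by rewrite ler_wpM2l ?(ltW a0)// ler_wpM2l ?lerDl// ltW// mulr_gt0// pi2_gt0.
Qed.

Lemma hol_at_affine_inv (a c z0 : C) : a * z0 != c -> hol_at (fun z => (c - a * z)^-1) z0.
Proof.
move=> az.
have hg : hol_at (fun z => c + - a * z) z0.
  apply: hol_at_add; first exact: hol_at_cst.
  by apply: hol_at_mul; [exact: hol_at_cst|exact: hol_at_id].
have h0 : c + - a * z0 != 0 by rewrite mulNr subr_eq0 eq_sym.
apply: (hol_at_near (e := 1) _ _ (hol_at_comp hg (hol_at_inv h0))) => //= z _.
by rewrite subr0 mulNr.
Qed.

Lemma conj_mul_nc2 (z : C) : z * z^*%C = (nc z ^+ 2)%:C.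
Proof.
rewrite nc_sqr; case: z => a b; simpc; rewrite -!expr2; congr (_ +i* _).
by rewrite addrC mulrC subrr.
Qed.

Lemma cintegral_conj (D : set R) (f : R -> C) : measurable D -> cintegrable D f ->
  cintegral D (fun t => (f t)^*%C) = (cintegral D f)^*%C.
Proof.
move=> mD [f1 f2]; rewrite /cintegral; apply: complex_eqP => /=.
- by apply: eq_Rintegral => t _; case: (f t).
- rewrite -mulN1r -RintegralZl//; apply: eq_Rintegral => t _; rewrite mulN1r.
  by case: (f t).
Qed.

Lemma hol_at_reflected_kernel (w z0 : C) (r : R) : 0 < r -> nc w < r -> nc z0 <= r ->
  hol_at (fun z => (r ^+ 2)%:C * ((r ^+ 2)%:C - w^*%C * z)^-1) z0.
Proof.
move=> r0 wr zr; apply: hol_at_mul; first exact: hol_at_cst.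
apply: hol_at_affine_inv; apply/negP => /eqP/(congr1 nc).
rewrite ncM nc_conj nc_real gtr0_norm ?exprn_gt0// => e.
have : nc w * nc z0 < r ^+ 2; last by rewrite e ltxx.
have [->|z1] := eqVneq (nc z0) 0; first by rewrite mulr0 exprn_gt0.
rewrite expr2; apply: (@lt_le_trans _ _ (r * nc z0)); last by rewrite ler_pM2l.
by rewrite ltr_pM2r// lt0r z1 nc_ge0.
Qed.

Lemma polar_neq (r t : R) (w : C) : 0 < r -> nc w < r -> polar r t - w != 0.
Proof.
move=> r0 wr; rewrite subr_eq0; apply/negP => /eqP e.
by move: wr; rewrite -e nc_polar gtr0_norm// ltxx.
Qed.

(* Conjugation on |z| = r turns z / (z - w) into r^2 / (r^2 - conj(w) z), which is
   holomorphic in the closed disk of radius r. *)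
Lemma cauchy_kernel_integral (w : C) (r : R) : 0 < r -> nc w < r ->
  circle_integral (fun z => z / (z - w)) r = (2 * pi)%:C.
Proof.
move=> r0 wr.
have hk z : nc z <= r -> hol_at (fun z => (r ^+ 2)%:C * ((r ^+ 2)%:C - w^*%C * z)^-1) z.
  exact: hol_at_reflected_kernel.
have := mean_value r0 hk; rewrite mulr0 subr0 divff ?mulr1; last first.
  by rewrite -nc_gt0 nc_real normr_gt0 expf_eq0 gt_eqF.
move=> /(congr1 (fun z : C => z^*%C)); rewrite conjc_real => <-.
rewrite /circle_integral -cintegral_conj//; last first.
  apply: ccont_cintegrable; apply: (hol_ccont (H := fun z => _ * (_ - _ * z)^-1)) => t.
  by apply: hk; rewrite nc_polar gtr0_norm.
congr cintegral; apply/funext => t.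
have p0 : polar r t != 0 by rewrite -nc_gt0 nc_polar gtr0_norm.
have := conj_mul_nc2 (polar r t); rewrite nc_polar gtr0_norm// => <-.
by rewrite reflected_kernel_identity// polar_neq.
Qed.

(** With Q the difference quotient at w, z Q(z) is holomorphic and vanishes at 0, so its mean is 0.
    When it is split, the part F(w) z / (z - w) integrates to 2 pi F(w). *)
Lemma cauchy_formula (F : C -> C) (w : C) (r : R) : analytic_on disk F ->
  0 < r -> r < 1 -> nc w < r ->
  circle_integral (fun z => F z * (z / (z - w))) r = (2 * pi)%:C * F w.
Proof.
move=> aF r0 r1 wr.
have inD z : nc z <= r -> disk z.
  by move=> zr; rewrite /disk/= normE ltcR (le_lt_trans zr).
have [Q [hQ Qe]] := hol_at_slope aF (inD _ (ltW wr)).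
have hQ' z : nc z <= r -> hol_at Q z.
  move=> zr; have [->//|zw] := eqVneq z w.
  have d0 : 0 < nc (z - w) by rewrite nc_gt0 subr_eq0.
  have hz : hol_at (fun z => (F z + - F w) * (z - w)^-1) z.
    apply: hol_at_mul; last exact: hol_at_inv.
    by apply: hol_at_add; [exact: analytic_hol_at aF (inD _ zr)|exact: hol_at_cst].
  apply: (hol_at_near d0 _ hz) => y yz; rewrite Qe//.
  by apply/negP => /eqP yw; move: yz; rewrite yw ncC ltxx.
have hzQ z : nc z <= r -> hol_at (fun z => z * Q z) z.
  by move=> zr; apply: hol_at_mul; [exact: hol_at_id|exact: hQ'].
have := mean_value r0 hzQ; rewrite mul0r mulr0.
have onC t : nc (polar r t) <= r by rewrite nc_polar gtr0_norm.
have cF : ccont (fun t => F (polar r t)).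
  by apply: hol_ccont => t; exact: analytic_hol_at aF (inD _ _).
have ck : ccont (fun t => polar r t / (polar r t - w)).
  apply: ccontM; first exact: ccont_polar.
  apply: ccont_inv; last by move=> t; exact: polar_neq.
  by apply: ccontB; [exact: ccont_polar|exact: ccont_cst].
have -> : circle_integral (fun z => z * Q z) r = circle_integral
    (fun z => F z * (z / (z - w)) - F w * (z / (z - w))) r.
  congr cintegral; apply/funext => t; rewrite Qe ?mulrBl; first by ring.
  by rewrite -subr_eq0 polar_neq.
rewrite /circle_integral cintegralB//; last 2 first.
- by apply: ccont_cintegrable; exact: ccontM.
- by apply: cintegrableZ => //; exact: ccont_cintegrable.
rewrite (@cintegralZ _ _ (fun t => polar r t / (polar r t - w)))//; last exact: ccont_cintegrable.
have := cauchy_kernel_integral r0 wr; rewrite /circle_integral => ->.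
by move=> /eqP; rewrite subr_eq0 => /eqP ->; rewrite mulrC.
Qed.

Definition poisson_kernel (q x : R) : R := (1 - q ^+ 2) / (1 - 2 * q * cos x + q ^+ 2).

(** Cauchy's kernel plus a correction that is holomorphic in the closed disk and zero at its centre.
    With c = cis (t - s) the left side becomes (1 - q/c)^-1 + (1 - q c)^-1 - 1, whose common
    denominator is that of the Poisson kernel. *)
Lemma poisson_kernel_complex (r q t s : R) : 0 < r -> 0 <= q -> q < 1 ->
  polar r t / (polar r t - polar (q * r) s) +
  ((r ^+ 2)%:C * ((r ^+ 2)%:C - (polar (q * r) s)^*%C * polar r t)^-1 - 1) =
  (poisson_kernel q (t - s))%:C :> C.
Proof.
move=> r0 q0 q1; have rq : nc (polar (q * r) s) < r.
  by rewrite nc_polar ger0_norm ?mulr_ge0 ?(ltW r0)// gtr_pMl.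
have rC : (r%:C : C) != 0 by rewrite -nc_gt0 nc_real normr_gt0 gt_eqF.
pose c := cis (t - s) : C.
have c0 : c != 0 by rewrite -nc_gt0 nc_cis.
have et : cis t = cis s * c :> C by rewrite -cisD addrCA subrr addr0.
have s0 : (cis s : C) != 0 by rewrite -nc_gt0 nc_cis.
have ncqc x : nc x = 1 -> 1 - q%:C * x != 0 :> C.
  move=> x1; rewrite subr_eq0; apply/negP => /eqP/(congr1 nc).
  by rewrite nc1 ncM x1 mulr1 nc_real ger0_norm// => e; move: q1; rewrite -e ltxx.
have h1 : 1 - q%:C * c != 0 by apply: ncqc; exact: nc_cis.
have h2 : 1 - q%:C * c^-1 != 0 by apply: ncqc; rewrite -conj_cis nc_conj nc_cis.
have -> : polar r t / (polar r t - polar (q * r) s) = (1 - q%:C * c^-1)^-1.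
  rewrite !polarE et realM.
  have h3 : c - q%:C != 0.
    have -> : c - q%:C = c * (1 - q%:C * c^-1) by field.
    by rewrite mulf_neq0.
  move: (r%:C : C) (q%:C : C) (cis s : C) c rC s0 c0 h3 {et h1 h2 ncqc} => x y z u x0 z0 u0 v0.
  rewrite (_ : _ - _ = x * z * (u - y)); last by ring.
  by field; rewrite x0 z0 u0 v0.
have -> : (r ^+ 2)%:C * ((r ^+ 2)%:C - (polar (q * r) s)^*%C * polar r t)^-1 = (1 - q%:C * c)^-1.
  rewrite !polarE et realM !conjM !conjc_real conj_cis [(r ^+ 2)%:C]realM.
  move: (r%:C : C) (q%:C : C) (cis s : C) c rC s0 c0 h1 {et h2 ncqc} => x y z u x0 z0 u0 v0.
  rewrite (_ : _ - _ = x * x * (1 - y * u)); last by field.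
  by field; rewrite x0 v0.
have hden : (1 - q%:C * c) * (1 - q%:C * c^-1) = (1 - 2 * q * cos (t - s) + q ^+ 2)%:C.
  rewrite -[c^-1]conj_cis /c /cis.
  apply: complex_eqP; rewrite !(ReM, ImM, ReD, ImD, ReN, ImN)/=; last by ring.
  have := cos2Dsin2 (t - s) => e.
  transitivity (1 - 2 * q * cos (t - s) + q ^+ 2 * (cos (t - s) ^+ 2 + sin (t - s) ^+ 2)).
    by ring.
  by rewrite e mulr1.
rewrite /poisson_kernel realM realV -hden (_ : (1 - q ^+ 2)%:C = 1 - q%:C * q%:C); last first.
  by rewrite -realM -expr2 realB.
move: (q%:C : C) c c0 h1 h2 {et hden ncqc} => y u u0 v0 w0.
have : u - y != 0.
  have -> : u - y = u * (1 - y / u) by field.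
  by rewrite mulf_neq0.
by move=> uy; field; rewrite v0 uy u0.
Qed.

Lemma poisson_kernel_den_gt0 (q x : R) : 0 <= q -> q < 1 ->
  0 < 1 - 2 * q * cos x + q ^+ 2.
Proof.
move=> q0 q1; apply: (@lt_le_trans _ _ ((1 - q) ^+ 2)).
  by rewrite exprn_gt0// subr_gt0.
have : q * cos x <= q * 1 by rewrite ler_wpM2l// cos_le1.
by rewrite sqrrB expr1n mul1r mulr1 mulr2n; lra.
Qed.

Lemma continuous_poisson_kernel (q s : R) : 0 <= q -> q < 1 ->
  continuous (fun t => poisson_kernel q (t - s)).
Proof.
move=> q0 q1 t; apply: cvgM; first exact: cvg_cst.
apply: cvgV; first by rewrite gt_eqF// poisson_kernel_den_gt0.
apply: cvgD; last exact: cvg_cst.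
apply: cvgB; first exact: cvg_cst.
apply: cvgM; first exact: cvg_cst.
apply: (@continuous_comp _ _ _ (fun t : R => t - s) cos); last exact: continuous_cos.
by apply: cvgB; [exact: cvg_id|exact: cvg_cst].
Qed.

(** F times the correction term of [poisson_kernel_complex] has mean 0 and may be added to Cauchy's
    formula. *)
Lemma poisson_formula (F : C -> C) (r q s : R) : analytic_on disk F ->
  0 < r -> r < 1 -> 0 <= q -> q < 1 ->
  cintegral `[0, 2 * pi] (fun t => F (polar r t) * (poisson_kernel q (t - s))%:C) =
  (2 * pi)%:C * F (polar (q * r) s).
Proof.
move=> aF r0 r1 q0 q1; set w := polar (q * r) s.
have wr : nc w < r by rewrite nc_polar ger0_norm ?mulr_ge0 ?(ltW r0)// gtr_pMl.
have inD z : nc z <= r -> disk z.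
  by move=> zr; rewrite /disk/= normE ltcR (le_lt_trans zr).
have hG z : nc z <= r -> hol_at (fun z => F z *
    ((r ^+ 2)%:C * ((r ^+ 2)%:C - w^*%C * z)^-1 + - 1)) z.
  move=> zr; apply: hol_at_mul; first exact: analytic_hol_at aF (inD _ zr).
  by apply: hol_at_add; [exact: hol_at_reflected_kernel|exact: hol_at_cst].
have := mean_value r0 hG.
rewrite mulr0 subr0 divff ?subrr ?mulr0; last first.
  by rewrite -nc_gt0 nc_real normr_gt0 expf_eq0 gt_eqF.
have onC t : nc (polar r t) <= r by rewrite nc_polar gtr0_norm.
move=> m0; rewrite -(cauchy_formula aF r0 r1 wr) -[RHS]addr0 -[X in _ = _ + X]m0.
rewrite /circle_integral -cintegralD//.
- congr cintegral; apply/funext => t.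
  by rewrite -(poisson_kernel_complex t s r0 q0 q1) mulrDr.
- apply: ccont_cintegrable; apply: ccontM.
    by apply: hol_ccont => t; exact: analytic_hol_at aF (inD _ _).
  apply: ccontM; first exact: ccont_polar.
  apply: ccont_inv; last by move=> t; exact: polar_neq.
  by apply: ccontB; [exact: ccont_polar|exact: ccont_cst].
- by apply: ccont_cintegrable; apply: (hol_ccont (H := fun z => F z *
    ((r ^+ 2)%:C * ((r ^+ 2)%:C - w^*%C * z)^-1 + - 1))) => t; exact: hG.
Qed.

End CircleIntegrals.

(** * Square means on circles *)

Section SquareMeans.
Context {R : realType}.
Local Notation C := R[i].
Local Notation nc := (@Normc.normc R).
Local Notation re := (@complex.Re R).
Local Notation mu := (@lebesgue_measure R).
Variable F : C -> C.
Hypothesis aF : analytic_on disk F.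

Lemma disk_nc (z : C) : nc z < 1 -> disk z.
Proof. by move=> z1; rewrite /disk/= normE ltcR. Qed.

Lemma disk_polar (r t : R) : 0 <= r -> r < 1 -> disk (polar r t : C).
Proof. by move=> r0 r1; apply: disk_nc; rewrite nc_polar ger0_norm. Qed.

Lemma analytic_ccont (r : R) : 0 <= r -> r < 1 -> ccont (fun t => F (polar r t)).
Proof.
by move=> r0 r1; apply: hol_ccont => t; exact: analytic_hol_at aF (disk_polar _ _ _).
Qed.

(** Unnormalized: the factor 1/(2 pi) of the Hardy norm is left out. *)
Definition sqmean (r : R) : R := \int[mu]_(t in `[0, 2 * pi]) (nc (F (polar r t)) ^+ 2).

Lemma nc_sqrB (x y : C) : nc (x - y) ^+ 2 = nc x ^+ 2 + nc y ^+ 2 - 2 * re (x * y^*%C).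
Proof. by case: x => a b; case: y => c d; rewrite !nc_sqr/=; ring. Qed.

(* On |z| = r the map z |-> ab / conj z is the dilation onto the circle of radius
   ab / r, so F(z) conj(F(ab / conj z)) is holomorphic and its mean does not
   depend on r; the two sides are its values for r = b and r = sqrt(ab). *)
Lemma sqmean_cross (a b : R) : 0 < a -> a <= b -> b < 1 ->
  \int[mu]_(t in `[0, 2 * pi]) re (F (polar b t) * (F (polar a t))^*%C) =
  sqmean (Num.sqrt (a * b)).
Proof.
move=> a0 ab b1; have b0 : 0 < b := lt_le_trans a0 ab.
set c := Num.sqrt (a * b).
have c0 : 0 < c by rewrite sqrtr_gt0 mulr_gt0.
have c2 : c ^+ 2 = a * b by rewrite sqr_sqrtr// ltW// mulr_gt0.
have cb : c <= b.
  rewrite -(@ler_pXn2r _ 2) ?nnegrE ?(ltW c0) ?(ltW b0)// c2 expr2.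
  by rewrite ler_wpM2r// ltW.
pose H (z : C) := F z * (fun u => (F u^*%C)^*%C) ((a * b)%:C * (z - 0)^-1).
have hH z : c <= nc z <= b -> hol_at H z.
  move=> /andP[cz zb]; have z0 : 0 < nc z := lt_le_trans c0 cz.
  apply: hol_at_mul; first exact: analytic_hol_at aF (disk_nc (le_lt_trans zb b1)).
  apply: (@hol_at_comp _ (fun u => (F u^*%C)^*%C) (fun z => (a * b)%:C * (z - 0)^-1)).
    by apply: hol_at_mul; [exact: hol_at_cst|apply: hol_at_inv; rewrite -nc_gt0].
  apply: hol_at_conj; apply: analytic_hol_at aF (disk_nc _).
  rewrite nc_conj ncM Normc.normcV nc_real -c2 subr0 gtr0_norm ?exprn_gt0//.
  rewrite ltr_pdivrMr// mul1r (lt_le_trans _ cz)// expr2 gtr_pMl//.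
  exact: le_lt_trans cb b1.
have Hp r t : 0 < r -> H (polar r t) = F (polar r t) * (F (polar (a * b / r) t))^*%C.
  move=> r0; rewrite /H subr0; congr (_ * (F _)^*%C).
  rewrite conjM conjc_real conjc_inv !polarE conjM conjc_real conj_cis.
  rewrite [(a * b / r)%:C]realM realV.
  have rC : (r%:C : C) != 0 by rewrite -nc_gt0 nc_real normr_gt0 gt_eqF.
  have s0 : (cis t : C) != 0 by rewrite -nc_gt0 nc_cis.
  by field; rewrite rC s0.
have := circle_integral_const c0 cb hH => /(congr1 re)/=.
rewrite /circle_integral/= => e; transitivity (\int[mu]_(t in `[0, 2 * pi]) re (H (polar b t))).
  apply: eq_Rintegral => t _; rewrite Hp//; congr (re (_ * (F (polar _ _))^*%C)).
  by field; rewrite gt_eqF.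
rewrite -e; apply: eq_Rintegral => t _; rewrite Hp// -c2.
have -> : c ^+ 2 / c = c by field; rewrite gt_eqF.
by rewrite conj_mul_nc2.
Qed.

Lemma continuous_sqmod (a : R) : 0 <= a -> a < 1 ->
  mu.-integrable `[0, 2 * pi] (fun t => (nc (F (polar a t)) ^+ 2)%:E).
Proof.
move=> a0 a1; apply: continuous_itv_integrable.
by apply: ccont_nc2; exact: analytic_ccont.
Qed.

(** Takes the place of Parseval's identity. The right side is a second difference of [sqmean] in log
    r, so that its nonnegativity is a convexity statement. *)
Lemma sqmean_diff (a b : R) : 0 < a -> a <= b -> b < 1 ->
  \int[mu]_(t in `[0, 2 * pi]) (nc (F (polar b t) - F (polar a t)) ^+ 2) =
  sqmean a + sqmean b - 2 * sqmean (Num.sqrt (a * b)).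
Proof.
move=> a0 ab b1; have b0 : 0 < b := lt_le_trans a0 ab.
have a1 : a < 1 := le_lt_trans ab b1.
have mD : measurable (`[0, 2 * pi]%classic : set R) by [].
have ia := continuous_sqmod (ltW a0) a1; have ib := continuous_sqmod (ltW b0) b1.
have ic : mu.-integrable `[0, 2 * pi]
    (fun t => (re (F (polar b t) * (F (polar a t))^*%C))%:E).
  apply: continuous_itv_integrable.
  have : ccont (fun t => F (polar b t) * (F (polar a t))^*%C); last by case.
  by apply: ccontM; [|apply: ccont_conj]; apply: analytic_ccont => //; exact: ltW.
have iab := integrable_lin 1 1 mD ia ib.
transitivity (\int[mu]_(t in `[0, 2 * pi]) (1 * (1 * nc (F (polar a t)) ^+ 2 +
    1 * nc (F (polar b t)) ^+ 2) + (- 2) * re (F (polar b t) * (F (polar a t))^*%C))).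
  by apply: eq_Rintegral => t _; rewrite nc_sqrB; ring.
rewrite (@Rintegral_lin _ _ (fun t => 1 * nc (F (polar a t)) ^+ 2 +
    1 * nc (F (polar b t)) ^+ 2))// Rintegral_lin//.
by rewrite (sqmean_cross a0 ab b1) -/(sqmean a) -/(sqmean b); ring.
Qed.

(** A positive first increment would be inherited by all later ones and force linear growth. *)
Lemma convex_bounded_le (u : nat -> R) (B : R) :
  (forall k, 2 * u k.+1 <= u k + u k.+2) -> (forall k, u k <= B) -> u 1 <= u 0.
Proof.
move=> hu hB; rewrite leNgt; apply/negP => h; pose d := u 1 - u 0.
have d0 : 0 < d by rewrite subr_gt0.
have inc k : d <= u k.+1 - u k by elim: k => // k ih; have := hu k; lra.
have lin k : u 0 + k%:R * d <= u k.
  by elim: k => [|k ih]; rewrite ?mul0r ?addr0// -natr1; have := inc k; lra.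
have [n hn] : exists n : nat, (B - u 0) / d < n%:R.
  exists (Num.bound `|(B - u 0) / d|).
  exact: le_lt_trans (ler_norm _) (archi_boundP (normr_ge0 _)).
have := le_trans (lin n) (hB n); rewrite ltr_pdivrMr// in hn; lra.
Qed.

Variable B : R.
Hypothesis hB : forall r, 0 < r -> r < 1 -> sqmean r <= B.

(* By sqmean_diff, sqmean (b (a / b)^k) is a convex sequence; being bounded, it is
   nonincreasing. *)
Lemma sqmean_le (a b : R) : 0 < a -> a <= b -> b < 1 -> sqmean a <= sqmean b.
Proof.
move=> a0 ab b1; have b0 : 0 < b := lt_le_trans a0 ab.
pose q := a / b; have q0 : 0 < q by rewrite divr_gt0.
have q1 : q <= 1 by rewrite ler_pdivrMr// mul1r.
pose c k := b * q ^+ k.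
have c0 k : 0 < c k by rewrite mulr_gt0// exprn_gt0.
have cS k : c k.+1 <= c k.
  by rewrite /c exprS mulrCA -[leRHS]mul1r ler_wpM2r// ltW// c0.
have c1 k : c k < 1.
  by elim: k => [|k ih]; [rewrite /c expr0 mulr1|exact: le_lt_trans (cS k) ih].
have e0 : c 0%N = b by rewrite /c expr0 mulr1.
have e1 : c 1%N = a by rewrite /c expr1 /q; field; rewrite gt_eqF.
have := @convex_bounded_le (sqmean \o c) B; rewrite /= e0 e1.
apply=> k; last exact: hB.
have := sqmean_diff (c0 k.+2) (le_trans (cS k.+1) (cS k)) (c1 k).
have -> : Num.sqrt (c k.+2 * c k) = c k.+1.
  rewrite (_ : _ * _ = c k.+1 ^+ 2) ?sqrtr_sqr ?gtr0_norm//.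
  by rewrite /c !exprS; ring.
have : 0 <= \int[mu]_(t in `[0, 2 * pi])
    (nc (F (polar (c k) t) - F (polar (c k.+2) t)) ^+ 2).
  by apply: Rintegral_ge0 => t _; rewrite exprn_ge0 ?nc_ge0.
by move=> + h2; rewrite h2 subr_ge0 addrC.
Qed.

(** Beyond a radius whose mean is within e of the supremum, monotonicity puts [sqmean a] below the
    mean at sqrt(a b), and that mean above sup - e; the second difference is then at most e. *)
Lemma sqmean_cauchy (e : R) : 0 < e -> exists r0 : R, [/\ 0 < r0, r0 < 1 &
  forall a b, r0 <= a -> a <= b -> b < 1 ->
  \int[mu]_(t in `[0, 2 * pi]) (nc (F (polar b t) - F (polar a t)) ^+ 2) <= e].
Proof.
move=> e0; pose S := [set sqmean r | r in [set r : R | 0 < r < 1]].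
have hS : has_sup S.
  split; last by exists B => _ [r /andP[r0 r1] <-]; exact: hB.
  by exists (sqmean 2^-1), 2^-1 => //=; rewrite invr_gt0 ltr0n/= invf_lt1// ltr1n.
have [_ [r /andP[r0 r1] <-] hr] := sup_adherent e0 hS.
exists r; split => // a b ra ab b1; have a0 : 0 < a := lt_le_trans r0 ra.
have b0 : 0 < b := lt_le_trans a0 ab.
rewrite sqmean_diff//.
have ac : a <= Num.sqrt (a * b).
  rewrite -(@ler_pXn2r _ 2) ?nnegrE ?sqrtr_ge0 ?(ltW a0)//.
  by rewrite sqr_sqrtr ?mulr_ge0 ?(ltW a0) ?(ltW b0)// expr2 ler_wpM2l// ltW.
have cb : Num.sqrt (a * b) <= b.
  rewrite -(@ler_pXn2r _ 2) ?nnegrE ?sqrtr_ge0 ?(ltW b0)//.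
  by rewrite sqr_sqrtr ?mulr_ge0 ?(ltW a0) ?(ltW b0)// expr2 ler_wpM2r// ltW.
have h1 := sqmean_le a0 ac (le_lt_trans cb b1).
have h2 := sqmean_le r0 (le_trans ra ac) (le_lt_trans cb b1).
have h3 : sqmean b <= sup S by apply: ub_le_sup; [exact: hS.2|exists b; rewrite //= b0].
lra.
Qed.

Lemma mean_cauchy (e : R) : 0 < e -> exists r0 : R, [/\ 0 < r0, r0 < 1 &
  forall a b, r0 <= a -> a <= b -> b < 1 ->
  \int[mu]_(t in `[0, 2 * pi]) nc (F (polar b t) - F (polar a t)) <= e].
Proof.
(* The constant d integrates to e/2 over the circle, and the bound d e/2 on the square mean becomes
   e/2 after division by d. *)
move=> e0; pose d := e / (2 * (2 * pi)).
have p0 := @pi2_gt0 R.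
have d0 : 0 < d by rewrite divr_gt0// mulr_gt0.
have [|r0 [r00 r01 h]] := @sqmean_cauchy (d * (e / 2)).
  by rewrite mulr_gt0// divr_gt0.
exists r0; split => // a b ra ab b1.
have a0 : 0 < a := lt_le_trans r00 ra; have b0 : 0 < b := lt_le_trans a0 ab.
have mD : measurable (`[0, 2 * pi]%classic : set R) by [].
have cf : ccont (fun t => F (polar b t) - F (polar a t)).
  by apply: ccontB; apply: analytic_ccont => //; rewrite ?ltW// (le_lt_trans ab).
have i2 : mu.-integrable `[0, 2 * pi]
    (fun t => (nc (F (polar b t) - F (polar a t)) ^+ 2)%:E).
  by apply: continuous_itv_integrable; exact: (@ccont_nc2 _ (fun t => _ - _)).
have i1 : mu.-integrable `[0, 2 * pi] (fun=> 1%:E).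
  by apply: continuous_itv_integrable => t; exact: cvg_cst.
(* AM-GM: x <= d + x^2 / d *)
apply: (@le_trans _ _ (\int[mu]_(t in `[0, 2 * pi])
   (d * 1 + d^-1 * nc (F (polar b t) - F (polar a t)) ^+ 2))).
  apply: le_Rintegral => //.
  - by apply: continuous_itv_integrable; exact: (@ccont_nc _ (fun t => _ - _)).
  - exact: integrable_lin.
  move=> t _; move: (nc (_ - _)) (nc_ge0 (F (polar b t) - F (polar a t))) => x x0.
  rewrite -(ler_pM2l d0) (_ : d * (_ + _) = d ^+ 2 + x ^+ 2); last by field; rewrite gt_eqF.
  by have := sqr_ge0 (d - x); rewrite sqrrB; have := mulr_ge0 (ltW d0) x0; lra.
rewrite Rintegral_lin// Rintegral_cst//= lebesgue_measure_itv/= lte_fin p0/= subr0 mul1r.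
have := h a b ra ab b1; rewrite -(ler_pM2l (_ : 0 < d^-1)) ?invr_gt0//.
rewrite (_ : d^-1 * (d * (e / 2)) = e / 2); last by field; rewrite gt_eqF.
have e2 (P : R) : 0 < P -> e / (2 * P) * P = e / 2.
  by move=> P0; field; rewrite gt_eqF.
rewrite [d * _]e2//.
lra.
Qed.

End SquareMeans.

Lemma hardy2_sqmean_bound {R : realType} (F : R[i] -> R[i]) : hardy2 F ->
  exists B : R, forall r, 0 < r -> r < 1 -> sqmean F r <= B.
Proof.
move=> [aF]; set S := ereal_sup _ => Sfin.
have h r : 0 < r -> r < 1 -> (((2 * pi)^-1 * sqmean F r)%:E <= S)%E.
  move=> r0 r1; apply: ereal_sup_ubound; exists r; first by rewrite /= r0.
  rewrite EFinM /sqmean /Rintegral fineK; last first.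
    apply: integrable_fin_num => //; apply: continuous_sqmod => //; exact: ltW.
  by congr (_ * _)%E; apply: eq_integral => t _; rewrite normE.
exists (2 * pi * fine S) => r r0 r1; have := h r r0 r1.
have Snum : S \is a fin_num.
  rewrite fin_numE; apply/andP; split; last by rewrite lt_eqF.
  apply/negP => /eqP SN; have := h r r0 r1; by rewrite SN leeNy_eq.
rewrite -(fineK Snum) lee_fin mulrC ler_pdivrMr ?pi2_gt0//.
by rewrite mulrC.
Qed.

(** * The radial maximal inequality *)

Section RadialMaximal.
Context {R : realType}.
Local Notation C := R[i].
Local Notation nc := (@Normc.normc R).
Local Notation mu := (@lebesgue_measure R).

Lemma HL_maximal_ball (f : R -> R) (x M r : R) : 0 < r ->
  (HL_maximal f x <= M%:E)%E ->
  (\int[mu]_(y in ball x r) `|(f y)%:E| <= (2 * r * M)%:E)%E.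
Proof.
move=> r0 hM.
have : (iavg f (ball x r) <= M%:E)%E.
  apply: le_trans hM; apply: ereal_sup_ubound; exists r => //=.
  by rewrite in_itv/= r0.
have r2 : 0 < r *+ 2 by rewrite mulrn_wgt0.
rewrite /iavg lebesgue_measure_ball ?(ltW r0)// inver gt_eqF//.
by rewrite lee_pdivrMl// -EFinM; move=> /le_trans; apply; rewrite lee_fin mulr2n; lra.
Qed.

(* The ring 2^n d <= |y - x| < 2^(n+1) d contributes at most 4 M / 2^n. *)
Lemma dyadic_kernel_bound (f : R -> R) (x M d : R) : measurable_fun setT f ->
  (forall y, 0 <= f y) -> 0 < d ->
  (forall r, 0 < r -> (\int[mu]_(y in ball x r) (f y)%:E <= (2 * r * M)%:E)%E) ->
  forall n, (\int[mu]_(y in ball x (2 ^+ n * d))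
     (f y * (d / (d ^+ 2 + (y - x) ^+ 2)))%:E <= ((10 - 8 * 2^-1 ^+ n) * M)%:E)%E.
Proof.
move=> mf f0 d0 hf.
have d20 : 0 < d ^+ 2 by rewrite exprn_gt0.
have den y : 0 < d ^+ 2 + (y - x) ^+ 2 by rewrite ltr_wpDr ?sqr_ge0.
have K0 y : 0 <= d / (d ^+ 2 + (y - x) ^+ 2) by rewrite divr_ge0// ltW.
have mK : measurable_fun setT (fun y => f y * (d / (d ^+ 2 + (y - x) ^+ 2))).
  apply: measurable_funM => //; apply: continuous_measurable_fun => y.
  apply: cvgM; first exact: cvg_cst.
  apply: cvgV; first by rewrite gt_eqF.
  apply: cvgD; first exact: cvg_cst.
  by apply: cvgM; apply: cvgB; [exact: cvg_id|exact: cvg_cst|exact: cvg_id|exact: cvg_cst].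
have mKE D : measurable_fun D (fun y => (f y * (d / (d ^+ 2 + (y - x) ^+ 2)))%:E).
  by apply/measurable_EFinP; exact: measurable_funTS.
have mfE D : measurable_fun D (fun y => (f y)%:E).
  by apply/measurable_EFinP; exact: measurable_funTS.
(* Where the kernel is at most c, its integral against f is at most c times the mass of f in a
   surrounding ball. *)
have cmp (D : set R) (c r : R) : measurable D -> 0 <= c -> 0 < r -> D `<=` ball x r ->
    (forall y, D y -> d / (d ^+ 2 + (y - x) ^+ 2) <= c) ->
    (\int[mu]_(y in D) (f y * (d / (d ^+ 2 + (y - x) ^+ 2)))%:E <= (c * (2 * r * M))%:E)%E.
  move=> mD c0 r0 Dr hc.
  apply: (@le_trans _ _ (\int[mu]_(y in D) (c%:E * (f y)%:E))%E).
    apply: ge0_le_integral => //.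
    - by move=> y _; rewrite lee_fin mulr_ge0.
    - exact: mKE.
    - by apply/measurable_EFinP; apply: measurable_funM => //; exact: measurable_funTS.
    - by move=> y Dy; rewrite -EFinM lee_fin mulrC ler_wpM2r// hc.
  rewrite (@ge0_integralZl_EFin _ _ _ mu D mD (fun y => (f y)%:E)).
  - rewrite EFinM lee_wpmul2l ?lee_fin//; apply: le_trans (hf _ r0).
    apply: ge0_subset_integral => //.
    + exact: measurable_ball.
    + exact: mfE.
    + by move=> y _; rewrite lee_fin.
  - by move=> y _; rewrite lee_fin.
  - exact: mfE.
  - exact: c0.
(* On the central ball the kernel is at most 1/d, which gives 2 M; the rings then add up to 8 (1 -
   2^-n) M. *)
elim=> [|n ih].
  apply: le_trans (cmp _ d^-1 (2 ^+ 0 * d) _ _ _ _ _) _ => //.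
  - exact: measurable_ball.
  - by rewrite invr_ge0 ltW.
  - by rewrite expr0 mul1r.
  - move=> y _; rewrite ler_pdivrMr// mulrDr.
    have -> : d^-1 * d ^+ 2 = d by field; rewrite gt_eqF.
    by rewrite lerDl mulr_ge0 ?sqr_ge0// invr_ge0 ltW.
  - by rewrite lee_fin !expr0 mulr1 mul1r; apply: eq_ler; field; rewrite gt_eqF.
set B := ball x (2 ^+ n * d) in ih *; set B' := ball x (2 ^+ n.+1 * d).
have rn0 : 0 < 2 ^+ n * d by rewrite mulr_gt0// exprn_gt0.
have mB : measurable B by exact: measurable_ball.
have mB' : measurable B' by exact: measurable_ball.
have BB' : B `<=` B' by apply: le_ball; rewrite ler_pM2r// exprS ler_peMl// ?exprn_ge0// ler1n.
rewrite -(setDUK BB') ge0_integral_setU//; last 4 first.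
- exact: measurableD.
- exact: mKE.
- by move=> y _; rewrite lee_fin mulr_ge0.
- by apply/disj_setPS; rewrite setDE => y [? []].
have p0 : 0 < (2 : R) ^+ n by rewrite exprn_gt0.
have h2 : (\int[mu]_(y in B' `\` B) (f y * (d / (d ^+ 2 + (y - x) ^+ 2)))%:E <=
     ((d / (2 ^+ n * d) ^+ 2) * (2 * (2 ^+ n.+1 * d) * M))%:E)%E.
  apply: cmp.
  - exact: measurableD.
  - by rewrite divr_ge0 ?exprn_ge0 ?(ltW d0)// ltW.
  - by rewrite mulr_gt0// exprn_gt0.
  - exact: subDsetl.
  - move=> y [_]; rewrite /B ball_itv /= in_itv/= => /negP hy.
    rewrite ler_wpM2l ?(ltW d0)// lef_pV2 ?posrE ?exprn_gt0//.
    apply: (@le_trans _ _ ((y - x) ^+ 2)); last by rewrite lerDr sqr_ge0.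
    rewrite -[leRHS]real_normK ?num_real// lerXn2r ?nnegrE ?(ltW rn0)//.
    by rewrite leNgt; apply: contra hy; rewrite ltr_distl.
apply: le_trans (leeD ih h2) _.
rewrite -EFinD lee_fin; apply: eq_ler.
rewrite !exprS !exprVn; field.
by rewrite !gt_eqF.
Qed.

(** The denominator is (1 - q)^2 + 2 q (1 - cos x) with 2 q >= 1 and 1 - cos x >= x^2/18, and the
    numerator is at most 2 (1 - q); hence 36, twice 18. *)
Lemma poisson_kernel_le (q x : R) : 2^-1 <= q -> q < 1 -> `|x| <= pi ->
  poisson_kernel q x <= 36 * ((1 - q) / ((1 - q) ^+ 2 + x ^+ 2)).
Proof.
move=> q2 q1 xpi; have q0 : 0 <= q by rewrite (le_trans _ q2)// invr_ge0.
have hc := one_minus_cos_ge xpi.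
have d0 : 0 < 1 - q by rewrite subr_gt0.
have x20 : 0 <= x ^+ 2 by rewrite sqr_ge0.
have dd : 0 < (1 - q) ^+ 2 by rewrite exprn_gt0.
have D0 : 0 < (1 - q) ^+ 2 + x ^+ 2 by lra.
have hD := poisson_kernel_den_gt0 x q0 q1.
rewrite /poisson_kernel ler_pdivrMr// mulrAC mulrA ler_pdivlMr//.
have key : ((1 - q) ^+ 2 + x ^+ 2) / 18 <= 1 - 2 * q * cos x + q ^+ 2.
  have -> : 1 - 2 * q * cos x + q ^+ 2 = (1 - q) ^+ 2 + 2 * q * (1 - cos x) by ring.
  have : 1 * (x ^+ 2 / 18) <= 2 * q * (1 - cos x).
    by apply: ler_pM => //; rewrite ?divr_ge0//; lra.
  lra.
have -> : 1 - q ^+ 2 = (1 - q) * (1 + q) by ring.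
have h1 : (1 - q) * (1 + q) <= (1 - q) * 2 by rewrite ler_wpM2l ?(ltW d0)//; lra.
apply: (@le_trans _ _ ((1 - q) * 2 * ((1 - q) ^+ 2 + x ^+ 2))).
  by rewrite ler_wpM2r// ltW.
have : (1 - q) * (((1 - q) ^+ 2 + x ^+ 2) / 18) <= (1 - q) * (1 - 2 * q * cos x + q ^+ 2).
  by rewrite ler_wpM2l// ltW.
lra.
Qed.

Variable F : C -> C.
Hypothesis aF : analytic_on disk F.

Definition increment (r s : R) (t : R) : R := nc (F (polar r t) - F (polar (s * r) t)).

Lemma increment_ge0 r s t : 0 <= increment r s t.
Proof. exact: nc_ge0. Qed.

Lemma continuous_increment (r s : R) : 0 <= r -> r < 1 -> 0 <= s -> s <= 1 ->
  ccont (fun t => F (polar r t) - F (polar (s * r) t)).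
Proof.
move=> r0 r1 s0 s1; apply: ccontB; apply: analytic_ccont => //; first exact: mulr_ge0.
by apply: le_lt_trans r1; rewrite ler_piMl.
Qed.

(** Poisson's formula on the circles of radii r and s r, with the same q, expresses the difference
    through the boundary increments. By periodicity the integral is taken over [x - pi, x + pi],
    which lies in [-pi, 3 pi] and on which the kernel is dominated by the dyadic one. As 2 pi >= 4,
    the constant is 2 times 36 times 10 over 4. *)
Lemma radial_increment_le (r s q x M : R) : 0 < r -> r < 1 -> 0 < s -> s <= 1 ->
  2^-1 <= q -> q < 1 -> 0 <= x <= 2 * pi ->
  (HL_maximal (increment r s \_ `[(- pi)%R, (3 * pi)%R]) x <= M%:E)%E ->
  nc (F (polar (q * r) x) - F (polar (s * (q * r)) x)) <= 180 * M.
Proof.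
move=> r0 r1 s0 s1 q2 q1 /andP[x0 x2] hM.
have q0 : 0 <= q by rewrite (le_trans _ q2)// invr_ge0.
have p0 : 0 < (pi : R) := pi_gt0 R.
pose I := (`[- pi, 3 * pi]%classic : set R).
have ci := continuous_increment (ltW r0) r1 (ltW s0) s1.
have ck : continuous (increment r s) by exact: (@ccont_nc _ (fun t => _ - _)).
have sr0 : 0 < s * r by rewrite mulr_gt0.
have sr1 : s * r < 1 by apply: le_lt_trans r1; rewrite ler_piMl// ltW.
have cp := @continuous_poisson_kernel _ q x q0 q1.
have P0 t : 0 <= poisson_kernel q (t - x).
  rewrite divr_ge0 ?(ltW (poisson_kernel_den_gt0 _ q0 q1))//.
  by rewrite subr_ge0 expr_le1// ltW.
have mD : measurable (`[0, 2 * pi]%classic : set R) by [].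
have h1 : (2 * pi) * nc (F (polar (q * r) x) - F (polar (s * (q * r)) x)) <=
    2 * \int[mu]_(t in `[0, 2 * pi]) (increment r s t * poisson_kernel q (t - x)).
  rewrite -{1}(gtr0_norm (@pi2_gt0 R)) -nc_real -ncM mulrBr.
  rewrite -(poisson_formula x aF r0 r1 q0 q1) (_ : s * (q * r) = q * (s * r)); last by ring.
  rewrite -(poisson_formula x aF sr0 sr1 q0 q1) -cintegralB//; last 2 first.
  - apply: ccont_cintegrable; apply: ccontM; last exact: ccont_real.
    by apply: analytic_ccont => //; exact: ltW.
  - apply: ccont_cintegrable; apply: ccontM; last exact: ccont_real.
    by apply: analytic_ccont => //; exact: ltW.
  apply: nc_cintegral_le => //.
  - apply: ccont_cintegrable; apply: ccontB; apply: ccontM; try exact: ccont_real;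
      by apply: analytic_ccont => //; exact: ltW.
  - by apply: continuous_itv_integrable => t; apply: cvgM; [exact: ck|exact: cp].
  - by move=> t _; rewrite -mulrBl ncM nc_real ger0_norm.
set g := fun t => increment r s t * poisson_kernel q (t - x).
have cg : continuous g by move=> t; apply: cvgM; [exact: ck|exact: cp].
have pg t : g (t + 2 * pi) = g t.
  rewrite /g /increment !polar_periodic /poisson_kernel.
  by rewrite (_ : t + 2 * pi - x = (t - x) + pi *+ 2) ?cosD2pi// -mulr_natl; ring.
have h2 : (\int[mu]_(t in `[0, 2 * pi]) g t =
    \int[mu]_(t in `[(x - pi), (x - pi + 2 * pi)]) g t)%R.
  by rewrite Rintegral_periodic// pi2_gt0.
have d0 : 0 < 1 - q by rewrite subr_gt0.
(* For this n the dyadic ball contains [x - pi, x + pi]. *)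
have [n hn] : exists n : nat, pi < 2 ^+ n * (1 - q).
  exists (Num.bound `|pi / (1 - q)|); rewrite -ltr_pdivrMr//.
  apply: le_lt_trans (ler_norm _) _; apply: lt_le_trans (archi_boundP (normr_ge0 _)) _.
  by rewrite -natrX ler_nat ltnW// ltn_expl.
set f := increment r s \_ I.
have f0 y : 0 <= f y by rewrite /f patchE; case: ifP => // _; exact: increment_ge0.
have mI : measurable I by exact: measurable_itv.
have mf : measurable_fun setT f.
  apply/(measurable_restrictT _ _).1 => //.
  by apply: measurable_funTS; exact: continuous_measurable_fun.
have hB r' : 0 < r' -> (\int[mu]_(y in ball x r') (f y)%:E <= (2 * r' * M)%:E)%E.
  move=> r'0; apply: le_trans (HL_maximal_ball r'0 hM).
  apply: ge0_le_integral => //.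
  - exact: measurable_ball.
  - by move=> y _; rewrite lee_fin.
  - by apply/measurable_EFinP; exact: measurable_funTS.
  - by apply/measurable_EFinP; apply: measurableT_comp => //; exact: measurable_funTS.
  - by move=> y _; rewrite lee_fin ler_norm.
have h3 := dyadic_kernel_bound mf f0 d0 hB n.
have M0 : 0 <= M.
  have : (0 <= (2 * 1 * M)%:E)%E.
    by apply: le_trans (hB 1 ltr01); apply: integral_ge0 => y _; rewrite lee_fin.
  by rewrite lee_fin; lra.
have ex : x - pi + 2 * pi = x + pi by ring.
have h4 : (\int[mu]_(t in `[(x - pi), (x + pi)]) g t <= 36 * (10 * M))%R.
  have ig : mu.-integrable `[x - pi, x + pi] (fun t => (g t)%:E).
    exact: continuous_itv_integrable.
  rewrite -lee_fin /Rintegral fineK; last exact: integrable_fin_num.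
  pose K y := (1 - q) / ((1 - q) ^+ 2 + (y - x) ^+ 2).
  have den y : 0 < (1 - q) ^+ 2 + (y - x) ^+ 2 by rewrite ltr_wpDr ?sqr_ge0// exprn_gt0.
  have K0 y : 0 <= K y by rewrite divr_ge0// ltW.
  have mfK : measurable_fun setT (fun y => f y * K y).
    apply: measurable_funM => //; apply: continuous_measurable_fun => y.
    apply: cvgM; first exact: cvg_cst.
    apply: cvgV; first by rewrite gt_eqF.
    apply: cvgD; first exact: cvg_cst.
    by apply: cvgM; apply: cvgB; [exact: cvg_id|exact: cvg_cst|exact: cvg_id|exact: cvg_cst].
  apply: (@le_trans _ _ (\int[mu]_(y in `[(x - pi)%R, (x + pi)%R]) (36%:E * (f y * K y)%:E))%E).
    apply: ge0_le_integral => //.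
    - by move=> y _; rewrite lee_fin mulr_ge0// increment_ge0.
    - by apply/measurable_EFinP/measurable_funTS; exact: continuous_measurable_fun.
    - by apply/measurable_EFinP; apply: measurable_funM => //; exact: measurable_funTS.
    move=> y /=; rewrite in_itv/= => /andP[y1 y2]; rewrite -EFinM lee_fin.
    have -> : f y = increment r s y.
      by rewrite /f patchE mem_set// /I /= in_itv/=; apply/andP; split; lra.
    rewrite mulrCA ler_wpM2l ?increment_ge0//; apply: poisson_kernel_le => //.
    by rewrite ler_distlC; apply/andP; split; lra.
  have mJ : measurable (`[x - pi, x + pi]%classic : set R) by [].
  rewrite (@ge0_integralZl_EFin _ _ _ mu _ mJ (fun y => (f y * K y)%:E))//; last 2 first.
  - by move=> y _; rewrite lee_fin mulr_ge0.
  - by apply/measurable_EFinP; exact: measurable_funTS.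
  rewrite EFinM lee_wpmul2l ?lee_fin//.
  apply: (@le_trans _ _ ((10 - 8 * 2^-1 ^+ n) * M)%:E); last first.
    by rewrite lee_fin ler_wpM2r// gerBl mulr_ge0// exprn_ge0// invr_ge0.
  apply: le_trans h3; apply: ge0_subset_integral => //.
  - exact: measurable_ball.
  - by apply/measurable_EFinP; exact: measurable_funTS.
  - by move=> y _; rewrite lee_fin mulr_ge0.
  - move=> y /=; rewrite in_itv/= => /andP[y1 y2]; rewrite ball_itv/= in_itv/=.
    by apply/andP; split; lra.
move: h1; rewrite -/g h2 ex.
have : 4 * nc (F (polar (q * r) x) - F (polar (s * (q * r)) x)) <=
   (2 * pi) * nc (F (polar (q * r) x) - F (polar (s * (q * r)) x)).
  by rewrite ler_wpM2r ?nc_ge0//; have := pi_ge2 R; lra.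
have fin (a b c N : R) : c <= 36 * (10 * N) -> 4 * a <= b -> b <= 2 * c -> a <= 180 * N.
  by clear; lra.
exact: fin.
Qed.

(** The weak type inequality at level c/180. The interval [-pi, 3 pi] holds two periods, so 1080 is
    3 times 180 times 2. The set A serves all q at once, as the maximal function does not involve
    q. *)
Lemma radial_increment_weak (r s c : R) : 0 < r -> r < 1 -> 0 < s -> s <= 1 -> 0 < c ->
  exists A : set R, [/\ measurable A,
    (mu A <= (1080 / c * \int[mu]_(t in `[0, 2 * pi]) increment r s t)%:E)%E &
    forall x q, 0 <= x <= 2 * pi -> 2^-1 <= q -> q < 1 ->
      c < nc (F (polar (q * r) x) - F (polar (s * (q * r)) x)) -> A x].
Proof.
move=> r0 r1 s0 s1 c0.
have p0 : 0 < (pi : R) := pi_gt0 R.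
have ci := continuous_increment (ltW r0) r1 (ltW s0) s1.
have ck : continuous (increment r s) by exact: (@ccont_nc _ (fun t => _ - _)).
set f := increment r s \_ `[- pi, 3 * pi].
have lf : locally_integrable setT f.
  apply: integrable_locally_restrict => //.
  exact: continuous_itv_integrable.
have c1 : 0 < c / 180 by rewrite divr_gt0.
exists [set x | (HL_maximal f x > (c / 180)%:E)%E]; split.
- rewrite -[X in measurable X]setTI; apply: emeasurable_fun_o_infty => //.
  exact: measurable_HL_maximal.
- apply: le_trans (maximal_inequality lf c1) _.
  have -> : (\int[mu]_y `|(f y)%:E| = (2 * \int[mu]_(t in `[0, 2 * pi]) increment r s t)%:E)%E.
    transitivity (\int[mu]_(t in `[(- pi)%R, (3 * pi)%R]) (increment r s t)%:E)%E.
      rewrite [RHS]integral_mkcond; apply: eq_integral => y _.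
      rewrite /f !patchE; case: ifP => _; last first.
        by first [rewrite abse0|rewrite /= normr0].
      by rewrite abse_EFin ger0_norm// increment_ge0.
    have i3 : mu.-integrable `[- pi, 3 * pi] (fun t => (increment r s t)%:E).
      exact: continuous_itv_integrable.
    rewrite -[LHS]fineK; last exact: integrable_fin_num.
    congr EFin; rewrite -/(Rintegral mu _ _).
    (* Additivity over the two periods is obtained by telescoping a primitive. *)
    have [h hd] := continuous_primitive (- pi - 1) ck.
    have prim a b : - pi <= a -> a < b ->
        (\int[mu]_(t in `[a, b]) increment r s t = h b - h a)%R.
      move=> ha ab; apply: Rintegral_derive => // y /andP[ay _]; apply: hd; lra.
    have per a : (\int[mu]_(t in `[a, (a + 2 * pi)]) increment r s t =
         \int[mu]_(t in `[0, 2 * pi]) increment r s t)%R.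
      apply: Rintegral_periodic => //; first exact: pi2_gt0.
      by move=> t; rewrite /increment !polar_periodic.
    have e1 := per (- pi); have e2 := per pi.
    rewrite prim in e1; [|lra|lra]; rewrite prim in e2; [|lra|lra].
    rewrite prim; [|lra|lra].
    have e3 : - pi + 2 * pi = pi :> R by ring.
    rewrite e3 in e1; rewrite (_ : 3 * pi = pi + 2 * pi); last by ring.
    lra.
  rewrite -EFinM lee_fin; apply: eq_ler; field.
  by rewrite gt_eqF.
- move=> x q hx q2 q1 hc /=; rewrite ltNge; apply/negP => hM.
  have := radial_increment_le r0 r1 s0 s1 q2 q1 hx hM.
  by rewrite (_ : 180 * (c / 180) = c) ?leNgt ?hc//; field.
Qed.

End RadialMaximal.

(** * Radial limits and boundary values *)

Section RadialLimits.
Context {R : realType}.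
Local Notation C := R[i].
Local Notation nc := (@Normc.normc R).
Local Notation re := (@complex.Re R).
Local Notation im := (@complex.Im R).
Local Notation mu := (@lebesgue_measure R).
Variables (F : C -> C) (B : R).
Hypothesis aF : analytic_on disk F.
Hypothesis hB : forall r, 0 < r -> r < 1 -> sqmean F r <= B.

Lemma exists_natSinv_lt (e : R) : 0 < e -> exists n : nat, n.+1%:R^-1 < e.
Proof.
move=> e0; exists (Num.bound e^-1).
have h : e^-1 < (Num.bound e^-1).+1%:R.
  apply: (@lt_trans _ _ (Num.bound e^-1)%:R); last by rewrite ltr_nat.
  by apply: archi_boundP; rewrite invr_ge0 ltW.
by rewrite -[ltRHS]invrK ltf_pV2 ?posrE ?invr_gt0.
Qed.

(** The weak estimate reaches only radii below a fixed r < 1. Along radii [r n] tending to 1 every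
    rho is eventually q [r n] with q = rho / [r n]. The dilation s is fixed beforehand so that s
    [r n] >= r0, which keeps the mean increment below e c / 1080. *)
Lemma radial_dilation_small_measure (c e : R) : 0 < c -> 0 < e ->
  exists s : R, exists A : set R, [/\ 0 < s, s < 1, measurable A, (mu A <= e%:E)%E &
    forall x rho, 0 <= x <= 2 * pi -> 2^-1 <= rho -> rho < 1 ->
      c < nc (F (polar rho x) - F (polar (s * rho) x)) -> A x].
Proof.
move=> c0 e0; have e1 : 0 < e * c / 1080 by rewrite divr_gt0 ?mulr_gt0 ?ltr0n.
have [r0 [r00 r01 hr0]] := mean_cauchy aF hB e1.
pose s := (1 + r0) / 2.
have s0 : 0 < s by rewrite /s; lra.
have s1 : s < 1 by rewrite /s; lra.
have rs : r0 < s by rewrite /s; lra.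
(* [r 0] equals r0 / s, the smallest radius whose dilation by s is still at least r0. *)
pose k := 1 - r0 / s.
have k0 : 0 < k by rewrite subr_gt0 ltr_pdivrMr// mul1r.
have k1 : k < 1 by rewrite gtrBl divr_gt0.
pose r n : R := 1 - k / n.+1%:R.
have kn n : 0 < k / n.+1%:R by rewrite divr_gt0.
have kn' n : k / n.+1%:R <= k by rewrite ler_pdivrMr// ler_peMr ?(ltW k0)// ler1n.
have rn1 n : r n < 1 by rewrite gtrBl.
have rn0 n : r0 / s <= r n by rewrite -[leLHS](subKr 1) -/k lerD2l lerN2.
have rn00 n : 0 < r n by rewrite (lt_le_trans _ (rn0 n))// divr_gt0.
have hA n : exists A : set R, [/\ measurable A, (mu A <= e%:E)%E &
    forall x q, 0 <= x <= 2 * pi -> 2^-1 <= q -> q < 1 ->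
      c < nc (F (polar (q * r n) x) - F (polar (s * (q * r n)) x)) -> A x].
  have [A [mA muA hA]] := radial_increment_weak aF (rn00 n) (rn1 n) s0 (ltW s1) c0.
  exists A; split => //; apply: le_trans muA _; rewrite lee_fin.
  have h : \int[mu]_(t in `[0, 2 * pi]) increment F (r n) s t <= e * c / 1080.
    apply: hr0; [|by rewrite ler_piMl ?(ltW s1)// ltW|exact: rn1].
    by rewrite mulrC -ler_pdivrMr.
  have c1 : 0 <= 1080 / c by rewrite divr_ge0 ?ler0n ?(ltW c0).
  apply: le_trans (ler_wpM2l c1 h) _; apply: eq_ler; field.
  by rewrite gt_eqF.
have [A' hA'] := boolp.choice hA.
(* The sets A' n are not monotone, hence the inferior limit. *)
pose Bm m := \bigcap_(n in [set n | (m <= n)%N]) A' n.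
have mBm m : measurable (Bm m).
  apply: bigcap_measurable; first by exists m => /=.
  by move=> n _; case: (hA' n).
have mU : measurable (\bigcup_m Bm m) by exact: bigcup_measurable.
exists s, (\bigcup_m Bm m); split => //.
  (* Each [Bm m] lies in [A' m], and continuity from below carries the bound e to the increasing
     union. *)
  have hc : mu \o Bm @ \oo --> mu (\bigcup_m Bm m).
    apply: nondecreasing_cvg_mu => // m n mn; apply/subsetPset => x hx k' nk'.
    by apply: hx => /=; exact: leq_trans nk'.
  rewrite -(cvg_lim _ hc)//; apply: lime_le; first by apply/cvg_ex; exists (mu (\bigcup_m Bm m)).
  apply: nearW => m; have [mA muA _] := hA' m.
  apply: le_trans muA; apply: le_measure; rewrite ?inE//; first exact: mBm.
  by move=> x hx; apply: hx => /=.
move=> x rho hx rho2 rho1 hc.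
have rho0 : 0 < rho by rewrite (lt_le_trans _ rho2)// invr_gt0.
have [m hm] : exists m : nat, k / (1 - rho) < m%:R.
  exists (Num.bound `|k / (1 - rho)|).
  exact: le_lt_trans (ler_norm _) (archi_boundP (normr_ge0 _)).
exists m => // n /= mn; have [_ _ hAn] := hA' n; apply: (hAn x (rho / r n)) => //.
- by apply: le_trans rho2 _; rewrite ler_pdivlMr// ler_piMr// ltW.
- rewrite ltr_pdivrMr// mul1r /r ltrBrDl -ltrBrDr ltr_pdivrMr//.
  rewrite mulrC -ltr_pdivrMr ?subr_gt0//; apply: lt_le_trans hm _.
  by rewrite ler_nat leqW.
- by rewrite divfK// gt_eqF.
Qed.

(** Take exceptional sets of measure at most 1/(n+1), each with its own dilation. Their intersection
    is null, and off it one of the dilations serves x; hence s depends on x. *)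
Lemma radial_dilation_ae (c : R) : 0 < c -> exists2 N : set R, mu.-negligible N &
  forall x, 0 <= x <= 2 * pi -> ~ N x -> exists s : R, [/\ 0 < s, s < 1 &
    forall rho, 2^-1 <= rho -> rho < 1 ->
      nc (F (polar rho x) - F (polar (s * rho) x)) <= c].
Proof.
move=> c0.
have h (n : nat) : exists sA : R * set R, [/\ 0 < sA.1, sA.1 < 1, measurable sA.2,
    (mu sA.2 <= (n.+1%:R^-1)%:E)%E &
    forall x rho, 0 <= x <= 2 * pi -> 2^-1 <= rho -> rho < 1 ->
      c < nc (F (polar rho x) - F (polar (sA.1 * rho) x)) -> sA.2 x].
  have n0 : 0 < n.+1%:R^-1 :> R by rewrite invr_gt0.
  by have [s [A hA]] := radial_dilation_small_measure c0 n0; exists (s, A).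
have [u hu] := boolp.choice h.
exists (\bigcap_n (u n).2).
  exists (\bigcap_n (u n).2); split => //.
    by apply: bigcap_measurable; [exists 0%N|move=> n _; case: (hu n)].
  apply/eqP; rewrite eq_le measure_ge0 andbT; apply/lee_addgt0Pr => e e0; rewrite add0e.
  have [n hn] : exists n : nat, n.+1%:R^-1 < e.
    exact: exists_natSinv_lt.
  have [_ _ mA muA _] := hu n.
  apply: (@le_trans _ _ (mu (u n).2)); last first.
    by apply: le_trans muA _; rewrite lee_fin ltW.
  apply: le_measure; rewrite ?inE//; last exact: bigcap_inf.
  by apply: bigcap_measurable; [exists 0%N|move=> m _; case: (hu m)].
move=> x hx /existsNP[n /not_implyP[_ hn]].
have [s0 s1 _ _ hA] := hu n; exists (u n).1; split => // rho rho2 rho1.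
by rewrite leNgt; apply/negP => hc; apply: hn; exact: hA hx rho2 rho1 hc.
Qed.

Definition radially_cauchy (x : R) := forall c : R, 0 < c -> exists2 eta : R, eta < 1 &
  forall r r', eta < r < 1 -> eta < r' < 1 -> nc (F (polar r x) - F (polar r' x)) <= c.

(** For fixed s < 1 the value at radius s rho converges as rho tends to 1, the limit point being
    interior. The two comparisons with the dilation cost c/3 each, the two dilated values c/6
    each. *)
Lemma radially_cauchy_ae : exists2 N : set R, mu.-negligible N &
  forall x, 0 <= x <= 2 * pi -> ~ N x -> radially_cauchy x.
Proof.
have h (m : nat) : exists N : set R, mu.-negligible N /\
  forall x, 0 <= x <= 2 * pi -> ~ N x -> exists s : R, [/\ 0 < s, s < 1 &
    forall rho, 2^-1 <= rho -> rho < 1 ->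
      nc (F (polar rho x) - F (polar (s * rho) x)) <= m.+1%:R^-1].
  have m0 : 0 < m.+1%:R^-1 :> R by rewrite invr_gt0.
  by have [N ? ?] := radial_dilation_ae m0; exists N.
have [N hN] := boolp.choice h.
exists (\bigcup_m N m); first by apply: negligible_bigcup => m; case: (hN m).
move=> x hx nN c c0; have c3 : 0 < c / 3 by rewrite divr_gt0.
have [m hm] : exists m : nat, m.+1%:R^-1 < c / 3.
  exact: exists_natSinv_lt.
have [_ /(_ x hx)[|s [s0 s1 hs]]] := hN m; first by move=> ?; apply: nN; exists m.
have [K [e [e0 K0 hK]]] := hol_at_continuous (analytic_hol_at aF (disk_polar x (ltW s0) s1)).
pose d := Num.min (2^-1) (Num.min e (c / 6 / (K + 1))).
have K1 : 0 < K + 1 by rewrite ltr_wpDl.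
have d0 : 0 < d by rewrite !lt_min invr_gt0 ltr0n e0 !divr_gt0.
exists (1 - d); first by rewrite gtrBl.
have near_s r : 1 - d < r < 1 ->
    2^-1 <= r /\ nc (F (polar (s * r) x) - F (polar s x)) <= c / 6.
  move=> /andP[r1 r2]; have : 1 - r < d by lra.
  rewrite !lt_min => /and3P[h1 h2 h3]; split; first lra.
  have hp : nc (polar (s * r) x - polar s x) <= 1 - r.
    rewrite !polarE -mulrBl ncM nc_cis mulr1 -realB nc_real.
    rewrite -{2}[s]mulr1 -mulrBr normrM gtr0_norm// distrC gtr0_norm ?subr_gt0//.
    by rewrite ler_piMl ?subr_ge0 ?ltW.
  apply: le_trans (hK _ (le_lt_trans hp h2)) _.
  rewrite ltr_pdivlMr// in h3; apply: le_trans (ltW h3).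
  rewrite mulrC; apply: ler_pM; rewrite ?nc_ge0//; lra.
move=> r r' hr hr'; have [r2 h1] := near_s _ hr; have [r'2 h1'] := near_s _ hr'.
have h2 := hs _ r2 (andP hr).2; have h2' := hs _ r'2 (andP hr').2.
rewrite (_ : _ - _ = (F (polar r x) - F (polar (s * r) x)) +
   (F (polar (s * r) x) - F (polar s x)) - (F (polar (s * r') x) - F (polar s x))
   - (F (polar r' x) - F (polar (s * r') x))); last by ring.
apply: le_trans (ncB _ _) _; apply: le_trans (lerD (ncB _ _) (lexx _)) _.
apply: le_trans (lerD (lerD (ncD _ _) (lexx _)) (lexx _)) _.
by move: h1 h1' h2 h2' (ltW hm); move: (m.+1%:R^-1) => q; lra.
Qed.

Lemma radially_cauchyP (x : R) :
  radially_cauchy x <-> cvg (F (polar rho x) @[rho --> (1 : R)^'-]).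
Proof.
split=> [h|/cvg_ex[l /cplx_dist_lt hl] c c0].
  have key (f : C -> R) : (forall z w, `|f z - f w| <= nc (z - w)) ->
      cvg (f (F (polar rho x)) @[rho --> (1 : R)^'-]).
    move=> hf; apply: cauchy_cvg; apply: cauchy_exP => e e0.
    have e2 : 0 < e / 2 by rewrite divr_gt0.
    have [eta eta1 he] := h _ e2.
    pose r := (eta + 1) / 2; exists (f (F (polar r x))).
    rewrite /=; near=> rho.
    apply: le_lt_trans (hf _ _) _; apply: (@le_lt_trans _ _ (e / 2)); last lra.
    apply: he; first by rewrite /r; lra.
    by apply/andP; split; near: rho; [exact: nbhs_left_gt|exact: nbhs_left_lt].
  have /key/cvg_ex[a ha] : forall z w, `|re z - re w| <= nc (z - w).
    by move=> z w; rewrite -ReN -ReD le_Re_nc.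
  have /key/cvg_ex[b hb] : forall z w, `|im z - im w| <= nc (z - w).
    by move=> z w; rewrite -ImN -ImD le_Im_nc.
  apply/cvg_ex; exists (a +i* b); apply/cplx_dist_lt => e e0.
  have e2 : 0 < e / 2 by rewrite divr_gt0.
  near=> rho; apply: le_lt_trans (nc_le_ReIm _) _; rewrite ReD ReN ImD ImN/=.
  rewrite (splitr e) ltrD//; rewrite distrC; near: rho; exact: cvgr_dist_lt.
have c2 : 0 < c / 2 by rewrite divr_gt0.
have /nbhs_ballP[d /= d0 hd] := hl _ c2.
exists (1 - d); first by rewrite gtrBl.
have hd' r : 1 - d < r < 1 -> nc (F (polar r x) - l) < c / 2.
  move=> /andP[r1 r2]; apply: hd => //=.
  by rewrite /ball/= gtr0_norm ?subr_gt0//; lra.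
move=> r r' /hd' h1 /hd' h2.
rewrite (_ : _ - _ = (F (polar r x) - l) - (F (polar r' x) - l)); last by ring.
by apply: le_trans (ncB _ _) _; lra.
Unshelve. all: by end_near. Qed.

(** The set on which the radial limit is genuine. It is measurable and of full measure, and the
    integrals of boundary values are taken over it. *)
Definition radial_domain : set R := [set x | 0 <= x <= 2 * pi /\ radially_cauchy x].

(** Uncountably many radii are compared, but for fixed m and k the set where two radii beyond 1 -
    1/(k+1) give values more than 1/(m+1) apart is open, F being continuous on each circle. *)
Lemma measurable_radial_domain : measurable radial_domain.
Proof.
pose U (m k : nat) : set R := [set x | exists r r' : R,
   [/\ 1 - k.+1%:R^-1 < r < 1, 1 - k.+1%:R^-1 < r' < 1 &
     m.+1%:R^-1 < nc (F (polar r x) - F (polar r' x))]].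
have mU m k : measurable (U m k).
  apply: open_measurable; rewrite openE => x [r [r' [hr hr' hx]]].
  have pos (s : R) : 1 - k.+1%:R^-1 < s < 1 -> 0 <= s /\ s < 1.
    move=> /andP[s1 s2]; split => //; apply: ltW; apply: le_lt_trans s1.
    by rewrite subr_ge0 invf_le1// ler1n.
  have [[r0 r1] [r'0 r'1]] := (pos _ hr, pos _ hr').
  have : ccont (fun t => F (polar r t) - F (polar r' t)).
    by apply: ccontB; exact: analytic_ccont.
  move=> /ccont_nc /(_ x) cx.
  have : \forall y \near x, m.+1%:R^-1 < nc (F (polar r y) - F (polar r' y)).
    exact: (cvgr_gt _ cx).
  by apply: filterS => y hy; exists r, r'.
have -> : radial_domain = `[0, 2 * pi]%classic `&` \bigcap_m \bigcup_k ~` U m k.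
  apply/seteqP; split => x.
    move=> [hx hc]; split; first by rewrite /= in_itv.
    move=> m _; have m0 : 0 < m.+1%:R^-1 :> R by rewrite invr_gt0.
    have [eta eta1 he] := hc _ m0.
    have d0 : 0 < 1 - eta by rewrite subr_gt0.
    have [k hk] : exists k : nat, k.+1%:R^-1 < 1 - eta.
      exact: exists_natSinv_lt.
    exists k => // -[r [r' [/andP[r1 r2] /andP[r3 r4] hx']]].
    have : nc (F (polar r x) - F (polar r' x)) <= m.+1%:R^-1.
      have hek : eta < 1 - k.+1%:R^-1 by rewrite ltrBrDr -ltrBrDl.
      by apply: he; apply/andP; split => //; exact: lt_trans hek _.
    by rewrite leNgt hx'.
  move=> [hx hU]; split; first by move: hx; rewrite /= in_itv.
  move=> c c0; have [m hm] : exists m : nat, m.+1%:R^-1 < c.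
    exact: exists_natSinv_lt.
  have [k _ hk] := hU m I.
  exists (1 - k.+1%:R^-1); first by rewrite gtrBl invr_gt0.
  move=> r r' hr hr'; apply: le_trans (ltW hm); rewrite leNgt; apply/negP => h.
  by apply: hk; exists r, r'.
apply: measurableI => //; apply: bigcap_measurable; first by exists 0%N.
move=> m _; apply: bigcup_measurable => k _; exact: measurableC.
Qed.

Lemma radial_domain_sub : radial_domain `<=` `[0, 2 * pi].
Proof. by move=> x [hx _]; rewrite /= in_itv. Qed.

Lemma radial_domain_full : mu (`[0, 2 * pi] `\` radial_domain) = 0%E.
Proof.
have [N [N' [mN' N'0 NN']] hN] := radially_cauchy_ae.
have mD : measurable (`[0, 2 * pi] `\` radial_domain).
  by apply: measurableD => //; exact: measurable_radial_domain.
apply/eqP; rewrite eq_le measure_ge0 andbT -N'0.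
apply: le_measure; rewrite ?inE//.
move=> x [/= hx nx]; apply: NN'; apply: contrapT => nN; apply: nx.
by rewrite in_itv/= in hx; split => //; exact: hN.
Qed.

End RadialLimits.

(** * Convergence in the mean to the boundary function and Cauchy's formula on the unit circle *)

Section BoundaryValues.
Context {R : realType}.
Local Notation C := R[i].
Local Notation nc := (@Normc.normc R).
Local Notation re := (@complex.Re R).
Local Notation im := (@complex.Im R).
Local Notation mu := (@lebesgue_measure R).

Lemma fatou_le (D : set R) (h : nat -> R -> R) (k : R -> R) (c : R) : measurable D ->
  (forall n, measurable_fun D (h n)) -> (forall n t, D t -> 0 <= h n t) ->
  (forall t, D t -> h ^~ t @ \oo --> k t) ->
  (exists N, forall n, (N <= n)%N -> (\int[mu]_(t in D) (h n t)%:E <= c%:E)%E) ->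
  (\int[mu]_(t in D) (k t)%:E <= c%:E)%E.
Proof.
move=> mD mh h0 hk [N hN].
have mhE n : measurable_fun D (fun t => (h n t)%:E) by exact/measurable_EFinP.
have h0E n t : D t -> (0 <= (h n t)%:E)%E by move=> Dt; rewrite lee_fin h0.
have := @fatou _ _ _ mu D mD (fun n t => (h n t)%:E) mhE h0E.
have -> : (\int[mu]_(x in D) limn_einf (fun n => (h n x)%:E) = \int[mu]_(t in D) (k t)%:E)%E.
  apply: eq_integral => t; rewrite inE => Dt.
  have ct : (fun n => (h n t)%:E) @ \oo --> (k t)%:E.
    by apply: cvg_EFin; [exact: nearW|exact: hk].
  by have [] := cvg_limn_einf_sup ct.
move=> /le_trans; apply; rewrite limn_einf_lim; apply: lime_le; first exact: is_cvg_einfs.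
exists N => // n /= Nn; apply: le_trans (hN n Nn).
by apply: ereal_inf_lbound; exists n => /=.
Qed.

Lemma cintegrable_dominated (D : set R) (f : R -> C) (g : R -> R) : measurable D ->
  measurable_fun D (fun t => re (f t)) -> measurable_fun D (fun t => im (f t)) ->
  (forall t, D t -> nc (f t) <= g t) -> mu.-integrable D (fun t => (g t)%:E) ->
  cintegrable D f.
Proof.
move=> mD mr mi fg ig; split.
- apply: le_integrable ig => //; first exact/measurable_EFinP.
  move=> t Dt; rewrite !abse_EFin lee_fin (le_trans (le_Re_nc _))//.
  by rewrite (le_trans (fg _ Dt))// ler_norm.
- apply: le_integrable ig => //; first exact/measurable_EFinP.
  move=> t Dt; rewrite !abse_EFin lee_fin (le_trans (le_Im_nc _))//.
  by rewrite (le_trans (fg _ Dt))// ler_norm.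
Qed.

Variables (F : C -> C) (B : R).
Hypothesis aF : analytic_on disk F.
Hypothesis hB : forall r, 0 < r -> r < 1 -> sqmean F r <= B.
Let D := radial_domain F.
Let Fs := radial_boundary F.
Let mD : measurable D := measurable_radial_domain aF.

Lemma radial_boundary_cvg x : D x ->
  F (polar rho x) @[rho --> (1 : R)^'-] --> Fs x.
Proof. by move=> [_ /radially_cauchyP]. Qed.

(** The offset n + 2, rather than n + 1, keeps the first radius positive. *)
Definition radii (n : nat) : R := 1 - n.+2%:R^-1.

Lemma radii_lt1 n : radii n < 1.
Proof. by rewrite gtrBl invr_gt0. Qed.

Lemma radii_gt0 n : 0 < radii n.
Proof. by rewrite subr_gt0 invf_lt1// ltr1n. Qed.

Lemma radii_eventually (r : R) : r < 1 -> exists N, forall n, (N <= n)%N -> r <= radii n.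
Proof.
rewrite -subr_gt0 => /exists_natSinv_lt[N hN]; exists N => n Nn.
rewrite /radii lerBrDr -lerBrDl; apply: le_trans (ltW hN).
by rewrite lef_pV2 ?posrE// ler_nat ltnS leqW.
Qed.

Lemma radii_boundary_lt x (e : R) : D x -> 0 < e ->
  exists N, forall n, (N <= n)%N -> nc (F (polar (radii n) x) - Fs x) < e.
Proof.
move=> /radial_boundary_cvg /cplx_dist_lt h e0.
have /nbhs_ballP[d /= d0 hd] := h _ e0.
have [|N hN] := @radii_eventually (1 - d / 2).
  by rewrite gtrBl divr_gt0.
exists N => n /hN hn; have r1 := radii_lt1 n; apply: hd => //=.
by rewrite /ball/= gtr0_norm ?subr_gt0//; lra.
Qed.

Lemma radii_lipschitz_cvg (f : C -> R) x : D x -> (forall z w, `|f z - f w| <= nc (z - w)) ->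
  (fun n => f (F (polar (radii n) x))) @ \oo --> f (Fs x).
Proof.
move=> Dx hf; apply/cvgrPdist_lt => e /(radii_boundary_lt Dx)[N hN].
exists N => // n /= /hN; apply: le_lt_trans; by rewrite distrC.
Qed.

Lemma lipschitz_Re (z w : C) : `|re z - re w| <= nc (z - w).
Proof. by rewrite -ReN -ReD le_Re_nc. Qed.

Lemma lipschitz_Im (z w : C) : `|im z - im w| <= nc (z - w).
Proof. by rewrite -ImN -ImD le_Im_nc. Qed.

Lemma lipschitz_ncB (c z w : C) : `|nc (z - c) - nc (w - c)| <= nc (z - w).
Proof.
rewrite ler_norml; apply/andP; split.
- rewrite lerNl opprB lerBlDr [nc (z - w)]ncC.
  by rewrite (_ : w - c = (w - z) + (z - c)) ?ncD//; ring.
- by rewrite lerBlDr (_ : z - c = (z - w) + (w - c)) ?ncD//; ring.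
Qed.

Lemma ccont_radii n : ccont (fun t => F (polar (radii n) t)).
Proof. by apply: analytic_ccont => //; [exact: ltW (radii_gt0 n)|exact: radii_lt1]. Qed.

Lemma continuous_measurableTS (E : set R) (f : R -> R) : continuous f -> measurable_fun E f.
Proof. by move=> cf; apply: measurable_funTS; exact: continuous_measurable_fun. Qed.

Lemma measurable_Re_boundary : measurable_fun D (fun t => re (Fs t)).
Proof.
apply: (@measurable_fun_cvg _ _ _ _ (fun n t => re (F (polar (radii n) t)))).
- by move=> n; apply: continuous_measurableTS; case: (ccont_radii n).
- by move=> x Dx; exact: (radii_lipschitz_cvg Dx lipschitz_Re).
Qed.

Lemma measurable_Im_boundary : measurable_fun D (fun t => im (Fs t)).
Proof.
apply: (@measurable_fun_cvg _ _ _ _ (fun n t => im (F (polar (radii n) t)))).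
- by move=> n; apply: continuous_measurableTS; case: (ccont_radii n).
- by move=> x Dx; exact: (radii_lipschitz_cvg Dx lipschitz_Im).
Qed.

(** Fatou's lemma along radii tending to 1, applied to the outer radius in [mean_cauchy]. *)
Lemma boundary_dist_le (e : R) : 0 < e -> exists r0 : R, [/\ 0 < r0, r0 < 1 &
  forall r, r0 <= r -> r < 1 ->
    (\int[mu]_(t in D) (nc (Fs t - F (polar r t)))%:E <= e%:E)%E].
Proof.
move=> e0; have [r0 [r00 r01 hr0]] := mean_cauchy aF hB e0.
exists r0; split => // r r0r r1.
have r_0 : 0 <= r by rewrite (le_trans (ltW r00)).
have cr := analytic_ccont aF r_0 r1.
have cd n : ccont (fun t => F (polar (radii n) t) - F (polar r t)).
  by apply: ccontB => //; exact: ccont_radii.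
apply: (@fatou_le D (fun n t => nc (F (polar (radii n) t) - F (polar r t)))) => //.
- by move=> n; apply: continuous_measurableTS; exact: (ccont_nc (cd n)).
- by move=> n t _; exact: nc_ge0.
- by move=> t Dt; apply: (radii_lipschitz_cvg Dt (lipschitz_ncB (F (polar r t)))).
have [N hN] := radii_eventually r1; exists N => n /hN hn.
have cn := ccont_nc (cd n).
apply: (@le_trans _ _ (\int[mu]_(t in `[0%R, (2 * pi)%R])
    (nc (F (polar (radii n) t) - F (polar r t)))%:E)%E).
  apply: ge0_subset_integral => //.
  - by apply/measurable_EFinP; exact: continuous_measurableTS.
  - by move=> t _; rewrite lee_fin nc_ge0.
  - exact: radial_domain_sub.
rewrite -[leLHS]fineK; last by apply: integrable_fin_num => //; exact: continuous_itv_integrable.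
by rewrite lee_fin; apply: hr0 => //; exact: radii_lt1.
Qed.

Lemma sqr_cvg (u : nat -> R) (l : R) : u @ \oo --> l -> (fun n => u n ^+ 2) @ \oo --> l ^+ 2.
Proof. by move=> ul; apply: cvgM. Qed.

Lemma boundary_sqr_le : (\int[mu]_(t in D) (nc (Fs t) ^+ 2)%:E <= B%:E)%E.
Proof.
have cn n := ccont_nc2 (ccont_radii n).
apply: (@fatou_le D (fun n t => nc (F (polar (radii n) t)) ^+ 2)) => //.
- by move=> n; exact: continuous_measurableTS.
- by move=> n t _; rewrite exprn_ge0 ?nc_ge0.
- move=> t Dt; apply: sqr_cvg; apply: (radii_lipschitz_cvg (f := nc) Dt) => z w.
  by have := lipschitz_ncB 0 z w; rewrite !subr0.
exists 0%N => n _.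
apply: (@le_trans _ _ (\int[mu]_(t in `[0%R, (2 * pi)%R]) (nc (F (polar (radii n) t)) ^+ 2)%:E)%E).
  apply: ge0_subset_integral => //.
  - by apply/measurable_EFinP; exact: continuous_measurableTS.
  - by move=> t _; rewrite lee_fin exprn_ge0 ?nc_ge0.
  - exact: radial_domain_sub.
rewrite -[leLHS]fineK; last by apply: integrable_fin_num => //; exact: continuous_itv_integrable.
by rewrite lee_fin; apply: hB; [exact: radii_gt0|exact: radii_lt1].
Qed.

Lemma integrable_sqr_boundary : mu.-integrable D (fun t => (nc (Fs t) ^+ 2)%:E).
Proof.
apply/integrableP; split.
  apply/measurable_EFinP; under eq_fun do rewrite nc_sqr.
  apply: measurable_funD; apply: measurable_funX; first exact: measurable_Re_boundary.
  exact: measurable_Im_boundary.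
apply: le_lt_trans (ltry B); apply: le_trans boundary_sqr_le.
rewrite le_eqVlt; apply/orP; left; apply/eqP; apply: eq_integral => t _.
by rewrite abse_EFin ger0_norm// exprn_ge0 ?nc_ge0.
Qed.

Lemma integrable_cst_domain (c : R) : mu.-integrable D (fun=> c%:E).
Proof.
have mI : measurable (`[0, 2 * pi]%classic : set R) by [].
apply: (@integrableS _ _ _ mu _ _ _ mI mD (radial_domain_sub (F := F))).
by apply: continuous_itv_integrable => t; exact: cvg_cst.
Qed.

Lemma le1D_sqr (x : R) : x <= 1 + x ^+ 2.
Proof. by have := sqr_ge0 (x - 1); rewrite sqrrB; have := sqr_ge0 x; lra. Qed.

(** |Fs| <= 1 + |Fs|^2, and both terms are integrable on a bounded interval. *)
Lemma cintegrable_boundary_mul (k : R -> C) (b : R) : ccont k -> (forall t, nc (k t) <= b) ->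
  cintegrable D (fun t => Fs t * k t).
Proof.
move=> [kr ki] kb.
have b0 : 0 <= b := le_trans (nc_ge0 _) (kb 0).
apply: (@cintegrable_dominated _ _ (fun t => b * 1 + b * nc (Fs t) ^+ 2)) => //.
- under eq_fun do rewrite ReM; apply: measurable_funB; apply: measurable_funM.
  + exact: measurable_Re_boundary.
  + exact: continuous_measurableTS.
  + exact: measurable_Im_boundary.
  + exact: continuous_measurableTS.
- under eq_fun do rewrite ImM; apply: measurable_funD; apply: measurable_funM.
  + exact: measurable_Re_boundary.
  + exact: continuous_measurableTS.
  + exact: measurable_Im_boundary.
  + exact: continuous_measurableTS.
- move=> t _; rewrite ncM -mulrDr mulrC; apply: ler_pM; rewrite ?nc_ge0//.
  exact: le1D_sqr.
- apply: integrable_lin => //; first exact: integrable_cst_domain.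
  exact: integrable_sqr_boundary.
Qed.

Lemma cintegrable_domain (f : R -> C) : ccont f -> cintegrable D f.
Proof.
move=> cf; have [f1 f2] := ccont_cintegrable 0 (2 * pi) cf.
have mI : measurable (`[0, 2 * pi]%classic : set R) by [].
by split; apply: (@integrableS _ _ _ mu _ _ _ mI mD (radial_domain_sub (F := F))).
Qed.

Lemma Rintegral_domain (f : R -> R) : continuous f ->
  (\int[mu]_(t in `[0, 2 * pi]) f t = \int[mu]_(t in D) f t)%R.
Proof.
move=> cf; rewrite /Rintegral; congr fine.
have mI : measurable (`[0, 2 * pi]%classic : set R) by [].
have mN : measurable (`[0, 2 * pi]%classic `\` D : set R) by exact: measurableD.
rewrite (@negligible_integral _ _ _ mu _ _ (fun t => (f t)%:E) mN mI)//.
- congr (integral _ _ _); rewrite setDD; apply/seteqP; split => [x []//|x Dx].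
  by split => //; exact: radial_domain_sub Dx.
- exact: continuous_itv_integrable.
- exact: radial_domain_full aF hB.
Qed.

Lemma cintegral_domain (f : R -> C) : ccont f -> cintegral `[0, 2 * pi] f = cintegral D f.
Proof. by move=> [f1 f2]; rewrite /cintegral !Rintegral_domain. Qed.

Lemma nc_cisB_ge (t : R) (w : C) : 1 - nc w <= nc (cis t - w).
Proof.
rewrite lerBlDr -(nc_cis t); rewrite {1}(_ : cis t = (cis t - w) + w) ?ncD//; ring.
Qed.

(** On the circle of radius r, Cauchy's kernel at the point r w equals the unit-circle kernel at w,
    whatever r is. Only F varies with r, and its convergence in L^1 is enough against a bounded
    kernel. *)
Lemma cauchy_boundary (w : C) : nc w < 1 ->
  cintegral D (fun t => Fs t * (cis t / (cis t - w))) = (2 * pi)%:C * F w.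
Proof.
move=> w1; have w10 : 0 < 1 - nc w by rewrite subr_gt0.
pose k t := cis t / (cis t - w).
have q0 t : cis t - w != 0 by rewrite -nc_gt0 (lt_le_trans w10)// nc_cisB_ge.
have ck : ccont k.
  apply: ccontM; first exact: ccont_cis.
  by apply: ccont_inv => //; apply: ccontB; [exact: ccont_cis|exact: ccont_cst].
pose b := (1 - nc w)^-1; have b0 : 0 < b by rewrite invr_gt0.
have kb t : nc (k t) <= b.
  rewrite ncM nc_cis mul1r Normc.normcV lef_pV2 ?posrE ?nc_gt0//.
  exact: nc_cisB_ge.
have [K [d [d0 K0 hK]]] := hol_at_continuous (analytic_hol_at aF (disk_nc w1)).
apply/eqP; rewrite -subr_eq0 -nc_eq0 eq_le nc_ge0 andbT.
apply/ler_addgt0Pr => e e0; rewrite add0r.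
(* b bounds the kernel, and 2 is the constant of [nc_cintegral_le]. *)
pose e1 := e / 2 / (2 * b); have e10 : 0 < e1 by rewrite !divr_gt0// mulr_gt0.
have [r0 [r00 r01 hr0]] := boundary_dist_le e10.
have p0 := @pi2_gt0 R.
have K1 : 0 < (2 * pi) * (K + 1) by rewrite mulr_gt0// ltr_wpDl.
pose m := Num.min (1 - r0) (Num.min (d / 2) (e / 2 / ((2 * pi) * (K + 1)))).
have m0 : 0 < m by rewrite !lt_min subr_gt0 r01 !divr_gt0.
pose r := 1 - m.
have m1 : m <= 1 - r0 by rewrite ge_min lexx.
have m2 : m <= d / 2 by rewrite !ge_min lexx orbT.
have m3 : m * ((2 * pi) * (K + 1)) <= e / 2.
  by rewrite -ler_pdivlMr// !ge_min lexx !orbT.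
have r0r : r0 <= r by rewrite /r; lra.
have r1 : r < 1 by rewrite /r; lra.
have rp : 0 < r := lt_le_trans r00 r0r.
have rC : (r%:C : C) != 0 by rewrite -nc_gt0 nc_real normr_gt0 gt_eqF.
have cr := analytic_ccont aF (ltW rp) r1.
have rw : nc (r%:C * w) < r by rewrite ncM nc_real gtr0_norm// gtr_pMr.
have hc := cauchy_formula aF rp r1 rw.
have hcD : cintegral D (fun t => F (polar r t) * k t) = (2 * pi)%:C * F (r%:C * w).
  rewrite -hc /circle_integral -cintegral_domain; last exact: ccontM.
  congr cintegral; apply/funext => t; rewrite /k polarE -mulrBr.
  by rewrite invfM mulrACA divff// mul1r.
have -> : cintegral D (fun t => Fs t * (cis t / (cis t - w))) - (2 * pi)%:C * F w =
   cintegral D (fun t => (Fs t - F (polar r t)) * k t) +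
   (2 * pi)%:C * (F (r%:C * w) - F w).
  under [X in _ = cintegral D X + _]eq_fun do rewrite mulrBl.
  rewrite cintegralB//; last 2 first.
  - exact: cintegrable_boundary_mul kb.
  - by apply: cintegrable_domain; exact: ccontM.
  by rewrite hcD; rewrite /k; ring.
apply: le_trans (ncD _ _) _; rewrite (splitr e); apply: lerD.
  have ig : mu.-integrable D (fun t => (nc (Fs t - F (polar r t)))%:E).
    apply/integrableP; split.
      apply/measurable_EFinP.
      apply: (@measurable_fun_cvg _ _ _ _ (fun n t => nc (F (polar (radii n) t) - F (polar r t)))).
        move=> n; apply: continuous_measurableTS.
        by apply: (@ccont_nc _ (fun t => _ - _)); apply: ccontB => //; exact: ccont_radii.
      by move=> t Dt; apply: (radii_lipschitz_cvg Dt (lipschitz_ncB (F (polar r t)))).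
    apply: le_lt_trans (ltry e1); apply: le_trans (hr0 r r0r r1).
    rewrite le_eqVlt; apply/orP; left; apply/eqP; apply: eq_integral => t _.
    by rewrite abse_EFin ger0_norm// nc_ge0.
  (* The null second term gives the dominating function the shape required by [integrable_lin]. *)
  have ib : mu.-integrable D (fun t => (b * nc (Fs t - F (polar r t)) + 0 * 0)%:E).
    by apply: (integrable_lin b 0 mD ig); exact: integrable_cst_domain.
  apply: le_trans (nc_cintegral_le (h := fun t => b * nc (Fs t - F (polar r t)) + 0 * 0) mD _ ib _) _.
  - under eq_fun do rewrite mulrBl -mulN1r.
    apply: cintegrableD => //; first exact: cintegrable_boundary_mul kb.
    by apply: cintegrableZ => //; apply: cintegrable_domain; exact: ccontM.
  - by move=> t _; rewrite mulr0 addr0 ncM mulrC ler_wpM2r ?nc_ge0.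
  rewrite (@Rintegral_lin _ _ _ (fun=> 0))//; last exact: integrable_cst_domain.
  rewrite mul0r addr0 mulrA -ler_pdivlMl ?mulr_gt0//.
  rewrite -lee_fin /Rintegral fineK; last exact: integrable_fin_num.
  by apply: le_trans (hr0 r r0r r1) _; rewrite lee_fin mulrC.
rewrite ncM nc_real gtr0_norm//.
have dist : nc (r%:C * w - w) <= m.
  have -> : r%:C * w - w = - (m%:C * w) by rewrite /r realB; ring.
  by rewrite ncN ncM nc_real gtr0_norm// ler_piMr// ltW.
have h1 : nc (F (r%:C * w) - F w) <= K * m.
  apply: le_trans (hK _ _) _; last by rewrite ler_wpM2l.
  by apply: le_lt_trans dist _; lra.
apply: le_trans m3; rewrite mulrCA ler_wpM2l ?(ltW p0)//.
apply: le_trans h1 _; rewrite mulrC ler_wpM2l ?(ltW m0)//; lra.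
Qed.

End BoundaryValues.

(** * First-order conditions *)

Section ComplexDerivative.
Context {R : realType}.
Local Notation C := R[i].
Local Notation nc := (@Normc.normc R).
Local Notation re := (@complex.Re R).

(** The estimate of [hol_at] with the base point frozen and the derivative named; quadratic
    remainders make the product and chain rules elementary, and the passage to [derive1] is made
    once. *)
Definition hder (H : C -> C) (z0 d : C) := exists K e : R, [/\ 0 < e, 0 <= K &
  forall u, nc (u - z0) < e -> nc (H u - H z0 - d * (u - z0)) <= K * nc (u - z0) ^+ 2].

Lemma hol_at_hder (H : C -> C) z0 : hol_at H z0 -> exists d, hder H z0 d.
Proof.
move=> [dH [K [e [e0 K0 h]]]]; exists (dH z0), K, e; split => // u hu.
by have [|//] := h u z0 hu; rewrite subrr nc0.
Qed.

Lemma hder_near (H G : C -> C) z0 d (e : R) : 0 < e ->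
  (forall z, nc (z - z0) < e -> H z = G z) -> hder H z0 d -> hder G z0 d.
Proof.
move=> e0 HG [K [e' [e'0 K0 h]]]; exists K, (Num.min e e'); split => //.
  by rewrite lt_min e0.
move=> u; rewrite lt_min => /andP[u1 u2].
by rewrite -!HG//; [exact: h|rewrite subrr nc0].
Qed.

Lemma hder_lipschitz (H : C -> C) z0 d : hder H z0 d -> exists L e : R, [/\ 0 < e, 0 <= L &
  forall u, nc (u - z0) < e -> nc (H u - H z0) <= L * nc (u - z0)].
Proof.
move=> [K [e [e0 K0 h]]]; exists (K + nc d), (Num.min e 1); split => //.
- by rewrite lt_min e0 ltr01.
- by rewrite addr_ge0 ?nc_ge0.
move=> u; rewrite lt_min => /andP[u1 u2].
rewrite (_ : H u - H z0 = (H u - H z0 - d * (u - z0)) + d * (u - z0)); last by ring.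
apply: le_trans (ncD _ _) _; rewrite ncM mulrDl lerD//.
apply: le_trans (h _ u1) _; rewrite ler_wpM2l// expr2 ler_piMl ?nc_ge0//.
exact: ltW.
Qed.

Lemma hder_cvg (H : C -> C) z0 d : hder H z0 d ->
  (fun h : C => h^-1 *: (H (h + z0) - H z0)) @ 0^' --> d.
Proof.
move=> [K [e [e0 K0 h]]]; apply/cplx_dist_lt => eps eps0.
have K1 : 0 < K + 1 by rewrite ltr_wpDl.
pose m := Num.min e (eps / (K + 1)).
have m0 : 0 < m by rewrite lt_min e0 divr_gt0.
have mC : (0 : C) < m%:C by rewrite ltcR.
have key k : k != 0 -> nc k < m -> nc (k^-1 *: (H (k + z0) - H z0) - d) < eps.
  move=> k0; rewrite lt_min => /andP[k1 k2].
  have := h (k + z0); rewrite addrK => /(_ k1) hk.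
  have nk0 : 0 < nc k by rewrite nc_gt0.
  rewrite (_ : _ - d = k^-1 * (H (k + z0) - H z0 - d * k)); last first.
    by rewrite /GRing.scale/=; field.
  rewrite ncM Normc.normcV ltr_pdivrMl//; apply: le_lt_trans hk _.
  rewrite expr2 mulrA mulrC ltr_pM2l//.
  rewrite ltr_pdivlMr// in k2; apply: le_lt_trans k2.
  by rewrite mulrC ler_wpM2l ?nc_ge0// lerDl.
near=> k; apply: key.
- by near: k; exact: nbhs_dnbhs_neq.
- have : `|k| < m%:C by near: k; exact: dnbhs0_lt.
  by rewrite normE ltcR.
Unshelve. all: by end_near. Qed.

Lemma hder_derive1 (H : C -> C) z0 d : hder H z0 d -> derive1 H z0 = d.
Proof. by move=> /hder_cvg h; apply: (cvg_lim _ h); exact: norm_hausdorff. Qed.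

Lemma hder_unique (H : C -> C) z0 d d' : hder H z0 d -> hder H z0 d' -> d = d'.
Proof. by move=> /hder_derive1 <- /hder_derive1. Qed.

Lemma hderB (H G : C -> C) z0 a b : hder H z0 a -> hder G z0 b ->
  hder (fun z => H z - G z) z0 (a - b).
Proof.
move=> [K [e [e0 K0 h]]] [L [e' [e'0 L0 h']]].
exists (K + L), (Num.min e e'); split; [by rewrite lt_min e0|by rewrite addr_ge0|].
move=> u; rewrite lt_min => /andP[u1 u2].
rewrite (_ : _ - _ - _ = (H u - H z0 - a * (u - z0)) - (G u - G z0 - b * (u - z0))); last by ring.
by rewrite (le_trans (ncB _ _))// mulrDl lerD ?h ?h'.
Qed.

Lemma hder_mul (H G : C -> C) z0 a b : hder H z0 a -> hder G z0 b ->
  hder (fun z => H z * G z) z0 (a * G z0 + H z0 * b).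
Proof.
move=> hH hG; have [M [e2 [e20 M0 h2]]] := hder_lipschitz hH.
have [N [e3 [e30 N0 h3]]] := hder_lipschitz hG.
case: hH => [K [e [e0 K0 h]]]; case: hG => [L [e' [e'0 L0 h']]].
exists (K * nc (G z0) + nc (H z0) * L + M * N), (Num.min (Num.min e e') (Num.min e2 e3)).
split.
- by rewrite !lt_min e0 e'0 e20.
- by rewrite !addr_ge0// mulr_ge0// nc_ge0.
move=> u; rewrite !lt_min => /andP[/andP[u1 u2] /andP[u3 u4]].
rewrite (_ : _ - _ - _ = (H u - H z0 - a * (u - z0)) * G z0 +
   H z0 * (G u - G z0 - b * (u - z0)) + (H u - H z0) * (G u - G z0)); last by ring.
rewrite [leRHS]mulrDl [X in _ <= X + _]mulrDl; apply: le_trans (ncD _ _) _; rewrite lerD//.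
  apply: le_trans (ncD _ _) _; rewrite lerD//.
    by rewrite ncM mulrAC ler_wpM2r ?nc_ge0// h.
  by rewrite ncM -mulrA ler_wpM2l ?nc_ge0// h'.
rewrite ncM (_ : _ * _ ^+ 2 = (M * nc (u - z0)) * (N * nc (u - z0))); last by ring.
by rewrite ler_pM ?nc_ge0// ?h2 ?h3.
Qed.

Lemma hder_comp (H g : C -> C) z0 a b : hder g z0 a -> hder H (g z0) b ->
  hder (H \o g) z0 (b * a).
Proof.
move=> hg; have [M [e2 [e20 M0 h2]]] := hder_lipschitz hg.
case: hg => [K [e [e0 K0 h]]] [L [e' [e'0 L0 h']]].
have M1 : 0 < M + 1 by rewrite ltr_wpDl.
exists (L * M ^+ 2 + nc b * K), (Num.min (Num.min e e2) (e' / (M + 1))); split.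
- by rewrite !lt_min e0 e20 divr_gt0.
- by rewrite addr_ge0// mulr_ge0 ?nc_ge0 ?exprn_ge0.
move=> u; rewrite !lt_min => /andP[/andP[u1 u2] u3] /=.
have gu : nc (g u - g z0) < e'.
  apply: le_lt_trans (h2 _ u2) _; rewrite ltr_pdivlMr// in u3; apply: le_lt_trans u3.
  by rewrite mulrC ler_wpM2l ?nc_ge0// lerDl.
rewrite (_ : _ - _ - _ = (H (g u) - H (g z0) - b * (g u - g z0)) +
   b * (g u - g z0 - a * (u - z0))); last by ring.
apply: le_trans (ncD _ _) _; rewrite mulrDl lerD//.
  apply: le_trans (h' _ gu) _; rewrite -mulrA ler_wpM2l// -exprMn.
  by rewrite lerXn2r ?nnegrE ?nc_ge0 ?h2// mulr_ge0 ?nc_ge0.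
by rewrite ncM -mulrA ler_wpM2l ?nc_ge0// h.
Qed.

Lemma hder0_eq0 (H : C -> C) z0 (e : R) : 0 < e ->
  (forall z, nc (z - z0) < e -> H z = 0) -> hder H z0 0.
Proof.
move=> e0 h; exists 0, e; split => // u hu.
by rewrite !h ?subrr ?nc0// mul0r subrr nc0 mul0r.
Qed.

(** Test with s = t conj z for small t > 0: 2 t |z|^2 <= K t^2 |z|^2 is impossible once t K < 2,
    unless z = 0. *)
Lemma linear_le_quadratic_eq0 (z : C) (K e : R) : 0 < e ->
  (forall s, nc s < e -> 2 * re (s * z) <= K * nc s ^+ 2) -> z = 0.
Proof.
move=> e0 h; apply/eqP; apply: contraT; rewrite -nc_gt0 => z0.
pose t := Num.min (`|K| + 1)^-1 (e / (2 * nc z)).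
have K1 : 0 < `|K| + 1 by rewrite ltr_wpDl.
have t0 : 0 < t by rewrite lt_min invr_gt0 K1 divr_gt0// mulr_gt0.
have t1 : t * (`|K| + 1) <= 1 by rewrite -ler_pdivlMr// div1r ge_min lexx.
have t2 : t * (2 * nc z) <= e by rewrite -ler_pdivlMr ?mulr_gt0// ge_min lexx orbT.
have ns : nc (t%:C * z^*%C) = t * nc z by rewrite ncM nc_conj nc_real gtr0_norm.
have tz : 0 < t * nc z by rewrite mulr_gt0.
have sl : nc (t%:C * z^*%C) < e by rewrite ns; lra.
have := h _ sl; rewrite ns.
have -> : re (t%:C * z^*%C * z) = t * nc z ^+ 2.
  by rewrite -mulrA [_^*%C * _]mulrC conj_mul_nc2 -realM.
have tz2 : 0 < t * nc z ^+ 2 by rewrite mulr_gt0// exprn_gt0.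
rewrite (_ : K * _ ^+ 2 = (t * K) * (t * nc z ^+ 2)); last by ring.
rewrite ler_pM2r// => hK.
have : t * K <= t * `|K| by rewrite ler_wpM2l ?(ltW t0)// ler_norm.
lra.
Qed.

Lemma analytic_onB (U : set C) (F G : C -> C) : analytic_on U F -> analytic_on U G ->
  analytic_on U (fun z => F z - G z).
Proof.
move=> hF hG z Uz; have [a [e [e0 ha]]] := hF z Uz; have [b [e' [e'0 hb]]] := hG z Uz.
exists (fun n => a n - b n), (Num.min e e'); split; first by rewrite lt_min e0.
move=> w; rewrite normE ltcR lt_min => /andP[w1 w2].
have h1 : `|w - z| < e%:C by rewrite normE ltcR.
have h2 : `|w - z| < e'%:C by rewrite normE ltcR.
rewrite (_ : series _ = fun n => [series a n * (w - z) ^+ n]_n n -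
    [series b n * (w - z) ^+ n]_n n); first exact: cvgB (ha _ h1) (hb _ h2).
apply/funext => n; rewrite /series/= -sumrB.
by apply: eq_bigr => i _; rewrite mulrBl.
Qed.

End ComplexDerivative.

(** * Comparison of the cost at two parameters *)

Section Variation.
Context {R : realType}.
Local Notation C := R[i].
Local Notation nc := (@Normc.normc R).
Local Notation re := (@complex.Re R).
Local Notation mu := (@lebesgue_measure R).

Lemma left_nbhs_polar (F G : C -> C) (x : R) : (forall z, disk z -> F z = G z) ->
  {near (1 : R)^'-, (fun rho => F (polar rho x)) =1 (fun rho => G (polar rho x))}.
Proof.
move=> FG; near=> rho; apply: FG; apply: disk_polar.
- by apply: ltW; near: rho; exact: nbhs_left_gt.
- by near: rho; exact: nbhs_left_lt.
Unshelve. all: by end_near. Qed.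

Lemma ccont_polar_cvg (h : C -> C) (x : R) : hol_at h (cis x) ->
  h (polar rho x) @[rho --> (1 : R)^'-] --> h (cis x).
Proof.
move=> /hol_at_continuous[K [e [e0 K0 hK]]]; apply/cplx_dist_lt => eps eps0.
have K1 : 0 < K + 1 by rewrite ltr_wpDl.
have m0 : 0 < Num.min e (eps / (K + 1)) by rewrite lt_min e0 divr_gt0.
near=> rho.
have r1 : rho < 1 by near: rho; exact: nbhs_left_lt.
have r2 : 1 - Num.min e (eps / (K + 1)) < rho.
  by near: rho; apply: nbhs_left_gt; rewrite gtrBl.
have : 1 - rho < Num.min e (eps / (K + 1)) by lra.
rewrite lt_min => /andP[h1 h2].
have hp : nc (polar rho x - cis x) = 1 - rho.
  rewrite polarE -[X in _ - X]mul1r -mulrBl ncM nc_cis mulr1.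
  by rewrite -[1]/(1%:C) -realB nc_real distrC gtr0_norm ?subr_gt0.
apply: le_lt_trans (hK _ _) _; rewrite hp//.
rewrite ltr_pdivlMr// in h2; apply: le_lt_trans h2.
by rewrite mulrC ler_wpM2l ?lerDl// subr_ge0 ltW.
Unshelve. all: by end_near. Qed.

Variables (F : C -> C) (B : R).
Hypothesis aF : analytic_on disk F.
Hypothesis hB : forall r, 0 < r -> r < 1 -> sqmean F r <= B.
Let D := radial_domain F.
Let Fs := radial_boundary F.
Let mD : measurable D := measurable_radial_domain aF.

(** A divergent limit defaults to [point], which is 0 here; the integrand of the norm therefore
    vanishes off [radial_domain F], and not merely almost everywhere. *)
Lemma point_complex : nc (point : C) = 0.
Proof. by rewrite [point]/(0 : C) nc0. Qed.

(* Off the set where the radial limits of F exist, those of F - h do not exist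
   either, and both sides are the same junk value. *)
Lemma hardy2_norm_perturb (E h : C -> C) : (forall z, disk z -> E z = F z - h z) ->
  (forall x, hol_at h (cis x)) ->
  hardy2_norm E =
  Num.sqrt ((2 * pi)^-1 * \int[mu]_(t in D) (nc (Fs t - h (cis t)) ^+ 2)).
Proof.
move=> Eh hh; rewrite /hardy2_norm; congr Num.sqrt.
rewrite /hardy2_inner /cintegral ReM/= mul0r subr0; congr (_ * _).
rewrite Rintegral_mkcond [RHS]Rintegral_mkcond.
apply: eq_Rintegral => t _; rewrite !patchE.
have hE : E (polar rho t) @[rho --> (1 : R)^'-] = (F (polar rho t) - h (polar rho t)) @[rho --> (1 : R)^'-].
  have e := left_nbhs_polar t Eh; apply/seteqP; split.
    by apply: near_eq_cvg; apply: filterS e => ? ->.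
  by apply: near_eq_cvg; apply: filterS e => ? ->.
case: ifPn => [tI|]; last first.
  case: ifPn => // /set_mem /radial_domain_sub tI.
  by move=> /negP; case; exact/mem_set.
case: ifPn => [/set_mem tD|tD].
  have -> : radial_boundary E t = Fs t - h (cis t).
    rewrite /radial_boundary hE; apply: cvg_lim; first exact: norm_hausdorff.
    apply: cvgB; first exact: radial_boundary_cvg tD.
    exact: ccont_polar_cvg.
  by rewrite conj_mul_nc2.
have -> : radial_boundary E t = point.
  rewrite /radial_boundary hE; apply: dvgP => hc.
  move/negP: tD; apply; apply/mem_set; split.
    by move/set_mem: tI; rewrite /= in_itv.
  apply/radially_cauchyP.
  have : cvg ((F (polar rho t) - h (polar rho t) + h (polar rho t)) @[rho --> (1 : R)^'-]).
    apply/cvg_ex; eexists; apply: cvgD; first exact: hc.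
    exact: ccont_polar_cvg.
  by under eq_fun do rewrite subrK.
by rewrite conj_mul_nc2 point_complex expr0n.
Qed.

Lemma integrable_sqr_perturb (h : R -> C) (b : R) : ccont h -> (forall t, nc (h t) <= b) ->
  mu.-integrable D (fun t => (nc (Fs t - h t) ^+ 2)%:E) /\
  (\int[mu]_(t in D) (nc (Fs t - h t) ^+ 2) =
   \int[mu]_(t in D) (nc (Fs t) ^+ 2) + \int[mu]_(t in D) (nc (h t) ^+ 2) -
   2 * re (cintegral D (fun t => Fs t * (h t)^*%C)))%R.
Proof.
move=> ch hb.
have cc := ccont_conj ch.
have cb t : nc (h t)^*%C <= b by rewrite nc_conj.
have [i3 _] := cintegrable_boundary_mul aF hB cc cb.
have i1 := integrable_sqr_boundary aF hB.
have i2 : mu.-integrable D (fun t => (nc (h t) ^+ 2)%:E).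
  have : ccont (fun t => (nc (h t) ^+ 2)%:C) by apply: ccont_real; exact: ccont_nc2.
  by move=> /(cintegrable_domain aF) [].
have i12 := integrable_lin 1 1 mD i1 i2.
have e t : nc (Fs t - h t) ^+ 2 = 1 * (1 * nc (Fs t) ^+ 2 + 1 * nc (h t) ^+ 2) +
    (- 2) * re (Fs t * (h t)^*%C) by rewrite nc_sqrB; ring.
split; first by under eq_fun do rewrite e; exact: (integrable_lin 1 (- 2) mD i12 i3).
under eq_Rintegral do rewrite e.
rewrite (@Rintegral_lin _ _ (fun t => 1 * nc (Fs t) ^+ 2 + 1 * nc (h t) ^+ 2))//.
by rewrite Rintegral_lin// /cintegral/=; ring.
Qed.

(** Expanding |F - h|^2 turns minimality into 2 Re <F, h> <= |h|^2. The right side is kept as a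
    uniform bound b, to be taken of first order in the variation. *)
Lemma variational_inequality (h : C -> C) (b : R) (E0 E1 : C -> C) :
  (forall x, hol_at h (cis x)) -> (forall t, nc (h (cis t)) <= b) ->
  (forall z, disk z -> E0 z = F z) -> (forall z, disk z -> E1 z = F z - h z) ->
  hardy2_norm E0 <= hardy2_norm E1 ->
  2 * re (cintegral D (fun t => Fs t * (h (cis t))^*%C)) <= (2 * pi) * b ^+ 2.
Proof.
move=> hh hb h0 h1.
have ch : ccont (fun t => h (cis t)).
  have p1 t : polar 1 t = cis t :> C by rewrite polarE -[RHS]mul1r.
  have -> : (fun t => h (cis t)) = (fun t => h (polar 1 t)) by apply/funext => t; rewrite p1.
  by apply: hol_ccont => t; rewrite p1.
have p0 := @pi2_gt0 R.
rewrite (@hardy2_norm_perturb E0 (fun=> 0)); last 2 first.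
- by move=> z /h0 ->; rewrite subr0.
- by move=> x; exact: hol_at_cst.
rewrite (@hardy2_norm_perturb E1 h)//.
under eq_Rintegral do rewrite subr0.
have pos (f : R -> R) : (forall t, 0 <= f t) -> 0 <= (2 * pi)^-1 * \int[mu]_(t in D) f t.
  by move=> f0; rewrite mulr_ge0 ?invr_ge0 ?(ltW p0)// Rintegral_ge0.
rewrite ler_sqrt; last by apply: pos => t; rewrite exprn_ge0 ?nc_ge0.
rewrite ler_pM2l ?invr_gt0// (integrable_sqr_perturb ch hb).2 -addrA lerDl subr_ge0.
move=> /le_trans; apply.
have i2 : mu.-integrable D (fun t => (nc (h (cis t)) ^+ 2)%:E).
  have : ccont (fun t => (nc (h (cis t)) ^+ 2)%:C) by apply: ccont_real; exact: ccont_nc2.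
  by move=> /(cintegrable_domain aF) [].
apply: (@le_trans _ _ (\int[mu]_(t in D) (b ^+ 2))).
  apply: le_Rintegral => //; first exact: integrable_cst_domain.
  by move=> t _; rewrite lerXn2r ?nnegrE ?nc_ge0// (le_trans (nc_ge0 _) (hb 0)).
rewrite -(Rintegral_domain aF hB); last by move=> t; exact: cvg_cst.
by rewrite Rintegral_cst//= lebesgue_measure_itv/= lte_fin p0/= subr0 mulrC.
Qed.

(** On the unit circle conj z = 1/z, so with w = 1 / conj l the conjugate of 1/(z - l) is - w z / (z
    - w), a multiple of Cauchy's kernel at the reflected point. *)
Lemma inner_pole (l : C) : 1 < nc l ->
  cintegral D (fun t => Fs t * ((cis t - l)^-1)^*%C) =
  (2 * pi)%:C * (- ((l^*%C)^-1 * F (l^*%C)^-1)).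
Proof.
move=> l1; set w := (l^*%C)^-1.
have l0 : l != 0 by rewrite -nc_gt0 (lt_trans _ l1).
have w0 : w != 0 by rewrite invr_eq0 conjc_eq0.
have w1 : nc w < 1 by rewrite Normc.normcV nc_conj invf_lt1// (lt_trans ltr01 l1).
have q0 t : cis t - w != 0.
  by rewrite -nc_gt0 (lt_le_trans _ (nc_cisB_ge t w))// subr_gt0.
have -> : (fun t => Fs t * ((cis t - l)^-1)^*%C) =
    (fun t => - w * (Fs t * (cis t / (cis t - w)))).
  apply/funext => t; rewrite mulrCA; congr (_ * _).
  have c0 : (cis t : C) != 0 by rewrite -nc_gt0 nc_cis.
  have -> : ((cis t - l)^-1)^*%C = ((cis t)^-1 - w^-1)^-1.
    by rewrite conjc_inv conjB conj_cis /w invrK.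
  have q := q0 t; move: (cis t : C) q c0 => c q c0.
  rewrite (_ : c^-1 - w^-1 = - ((c - w) / (c * w))); last by field; rewrite c0 w0.
  by rewrite invrN invf_div; ring.
rewrite (@cintegralZ _ _ (fun t => Fs t * (cis t / (cis t - w)))) ?(cauchy_boundary aF hB w1)//.
  by rewrite mulrCA mulNr.
apply: (@cintegrable_boundary_mul _ _ _ aF hB _ (1 - nc w)^-1).
  apply: ccontM; first exact: ccont_cis.
  by apply: ccont_inv => //; apply: ccontB; [exact: ccont_cis|exact: ccont_cst].
move=> t; rewrite ncM nc_cis mul1r Normc.normcV lef_pV2 ?posrE ?subr_gt0 ?nc_gt0//.
exact: nc_cisB_ge.
Qed.

Lemma inner_cst : cintegral D Fs = (2 * pi)%:C * F 0.
Proof.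
rewrite -(cauchy_boundary aF hB) ?nc0//; congr cintegral; apply/funext => t.
by rewrite subr0 divff ?mulr1// -nc_gt0 nc_cis.
Qed.

Lemma nc_pole_ge (t : R) (l : C) : nc l - 1 <= nc (cis t - l).
Proof.
have := ncB (cis t) (cis t - l); rewrite nc_cis (_ : cis t - (cis t - l) = l); last by ring.
by rewrite lerBlDl.
Qed.

(** The conjugated factor is the exact variation of the rational part when one pole, its residue and
    the constant change. *)
Lemma inner_three_terms (l l' f f' d : C) : 1 < nc l -> 1 < nc l' ->
  cintegral D (fun t => Fs t * (f' / (cis t - l') - f / (cis t - l) + d)^*%C) =
  (2 * pi)%:C * (f'^*%C * (- ((l'^*%C)^-1 * F (l'^*%C)^-1)) -
    f^*%C * (- ((l^*%C)^-1 * F (l^*%C)^-1)) + d^*%C * F 0).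
Proof.
move=> l1 l'1.
have ip (m : C) : 1 < nc m -> cintegrable D (fun t => Fs t * ((cis t - m)^-1)^*%C).
  move=> m1; apply: (@cintegrable_boundary_mul _ _ _ aF hB _ (nc m - 1)^-1).
    apply: ccont_conj; apply: ccont_inv.
      by apply: ccontB; [exact: ccont_cis|exact: ccont_cst].
    by move=> t; rewrite -nc_gt0 (lt_le_trans _ (nc_pole_ge t m))// subr_gt0.
  move=> t; rewrite nc_conj Normc.normcV.
  have q : 0 < nc m - 1 by rewrite subr_gt0.
  by rewrite lef_pV2 ?posrE ?(lt_le_trans q) ?nc_pole_ge.
have i1 : cintegrable D Fs.
  have h1 (t : R) : nc (1 : C) <= 1 by rewrite nc1.
  have := @cintegrable_boundary_mul _ _ _ aF hB (fun=> 1) 1 (ccont_cst _) h1.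
  by under eq_fun do rewrite mulr1.
have -> : (fun t => Fs t * (f' / (cis t - l') - f / (cis t - l) + d)^*%C) =
  (fun t => (f'^*%C * (Fs t * ((cis t - l')^-1)^*%C) +
     (- f^*%C) * (Fs t * ((cis t - l)^-1)^*%C)) + d^*%C * Fs t).
  apply/funext => t; rewrite [(_ + d)^*%C]rmorphD/= conjB !conjM; ring.
rewrite cintegralD//; last 2 first.
- by apply: cintegrableD => //; apply: cintegrableZ => //; exact: ip.
- exact: cintegrableZ.
rewrite cintegralD//; [|by apply: cintegrableZ => //; exact: ip..].
rewrite (@cintegralZ _ _ (fun t => Fs t * ((cis t - l')^-1)^*%C))//; last exact: ip.
rewrite (@cintegralZ _ _ (fun t => Fs t * ((cis t - l)^-1)^*%C))//; last exact: ip.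
by rewrite cintegralZ// !inner_pole// inner_cst; ring.
Qed.

End Variation.

(** * The rational family and its one-pole variations *)

Section ReducedModels.
Context {R : realType}.
Local Notation C := R[i].
Local Notation nc := (@Normc.normc R).

Lemma sqmeanB_le (F G : C -> C) (r : R) : analytic_on disk F -> analytic_on disk G ->
  0 < r -> r < 1 -> sqmean (fun z => F z - G z) r <= 2 * sqmean F r + 2 * sqmean G r.
Proof.
move=> aF aG r0 r1; have mI : measurable (`[0, 2 * pi]%classic : set R) by [].
have iF := continuous_sqmod aF (ltW r0) r1; have iG := continuous_sqmod aG (ltW r0) r1.
have iFG := continuous_sqmod (analytic_onB aF aG) (ltW r0) r1.
rewrite /sqmean -Rintegral_lin//; apply: le_Rintegral => //; first exact: integrable_lin.
move=> t _; move: (F _) (G _) => x y.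
apply: (@le_trans _ _ ((nc x + nc y) ^+ 2)).
  by rewrite lerXn2r ?nnegrE ?addr_ge0 ?nc_ge0// ncB.
by have := sqr_ge0 (nc x - nc y); rewrite sqrrB sqrrD; lra.
Qed.

Definition rational_part (r : nat) (lam phi : 'rV[C]_r) (d z : C) : C :=
  \sum_(j < r) phi 0 j / (z - lam 0 j) + d.

Definition update_coord (r : nat) (v : 'rV[C]_r) (p : 'I_r) (c : C) : 'rV[C]_r :=
  \row_j (if j == p then c else v 0 j).

Lemma rational_part_update (r : nat) (lam phi : 'rV[C]_r) (p : 'I_r) (d d' l f z : C) :
  rational_part (update_coord lam p l) (update_coord phi p f) d' z -
  rational_part lam phi d z =
  f / (z - l) - phi 0 p / (z - lam 0 p) + (d' - d).
Proof.
rewrite /rational_part (bigD1 p)//= [in X in _ - X](bigD1 p)//= !mxE eqxx.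
rewrite (eq_bigr (fun j => phi 0 j / (z - lam 0 j))); last first.
  by move=> j /negPf jp; rewrite !mxE jp.
by ring.
Qed.

Lemma ball_update_coord (r : nat) (v : 'rV[C]_r) (p : 'I_r) (c : C) (e : C) :
  ball (v 0 p) e c -> 0 < e -> ball v e (update_coord v p c).
Proof.
move=> hc e0; split=> // i j; rewrite ord1 mxE; case: eqP => [->//|_].
exact: ballxx.
Qed.

Lemma pull_reduced (A : set C) (vphi s : C -> C) (r : nat) (lam phi : 'rV[C]_r) (d z : C) :
  set_bij disk A vphi -> s z != 0 -> disk z ->
  reduced_fun vphi s lam phi d (vphi z) * s z = rational_part lam phi d z.
Proof.
move=> [_ inj _] sz dz; rewrite /reduced_fun.
have -> : pinv disk vphi (vphi z) = z by rewrite pinvKV ?inE.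
by rewrite divfK.
Qed.

End ReducedModels.

(** * Interpolation conditions for the error *)

Section Stationarity.
Context {R : realType}.
Local Notation C := R[i].
Local Notation nc := (@Normc.normc R).
Local Notation re := (@complex.Re R).
Variables (F : C -> C) (l f : C) (eta : R).
Hypothesis aF : analytic_on disk F.
Hypothesis eta0 : 0 < eta.
Hypothesis l1 : 1 < nc l.
(** The comparison inequality with 2 pi divided out. Here d is the increment of the constant, and b
    any bound of the variation on the unit circle. *)
Hypothesis first_order : forall l' f' d b, nc (l' - l) < eta -> nc (f' - f) < eta ->
  nc d < eta -> 1 < nc l' ->
  (forall t, nc (f' / (cis t - l') - f / (cis t - l) + d) <= b) ->
  2 * re (f'^*%C * (- ((l'^*%C)^-1 * F (l'^*%C)^-1)) -
    f^*%C * (- ((l^*%C)^-1 * F (l^*%C)^-1)) + d^*%C * F 0) <= b ^+ 2.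
Let w : C := (l^*%C)^-1.

Lemma nc_simple_pole_le (t : R) (m c : C) : 1 < nc m ->
  nc (c / (cis t - m)) <= nc c / (nc m - 1).
Proof.
move=> m1; have q : 0 < nc m - 1 by rewrite subr_gt0.
rewrite ncM Normc.normcV ler_wpM2l ?nc_ge0// lef_pV2 ?posrE//; first exact: nc_pole_ge.
by rewrite (lt_le_trans q)// nc_pole_ge.
Qed.

(** Only the constant varies; the increment conj d makes the left side the real part of a linear
    function of d. *)
Lemma stationary_constant : F 0 = 0.
Proof.
apply: (@linear_le_quadratic_eq0 _ _ 1 eta eta0) => d hd.
have := @first_order l f d^*%C (nc d).
rewrite !subrr nc0 nc_conj => /(_ eta0 eta0 hd l1).
by rewrite add0r conjcK mul1r; apply=> t; rewrite subrr add0r nc_conj.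
Qed.

(* If f = 0 the pole is irrelevant, so any l' near l is as stationary as l. *)
Lemma stationary_residue (l' : C) : nc (l' - l) < eta -> 1 < nc l' ->
  (l' = l \/ f = 0) -> F (l'^*%C)^-1 = 0.
Proof.
move=> ll l'1 hor.
have w'0 : (l'^*%C)^-1 != 0.
  by rewrite invr_eq0 conjc_eq0 -nc_gt0 (lt_trans ltr01).
suff : - ((l'^*%C)^-1 * F (l'^*%C)^-1) = 0.
  by move=> /eqP; rewrite oppr_eq0 mulf_eq0 (negPf w'0) => /eqP.
apply: (@linear_le_quadratic_eq0 _ _ ((nc l' - 1)^-1 ^+ 2) eta eta0) => s hs.
(* The residue at l' moves by conj s. The unperturbed terms cancel when l' = l and are zero when f =
   0. *)
have e1 : (f + s^*%C) - f = s^*%C by ring.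
have := @first_order l' (f + s^*%C) 0 (nc s / (nc l' - 1)) ll.
rewrite e1 nc_conj nc0 => /(_ hs eta0 l'1) h.
have eh t : (f + s^*%C) / (cis t - l') - f / (cis t - l) + 0 = s^*%C / (cis t - l').
  by case: hor => ->; ring.
have := h _ => /(_ _)/wrap[].
  by move=> t; rewrite eh (le_trans (nc_simple_pole_le _ _ l'1))// nc_conj.
rewrite exprMn mulrC [_^-1 ^+ 2 * _]mulrC mulrC; apply: le_trans.
rewrite ler_pM2l//; apply: eq_ler; congr re.
rewrite conjc0 mul0r addr0 rmorphD/= conjcK.
by case: hor => ->; rewrite ?conjc0; ring.
Qed.

Lemma stationary_value : F w = 0.
Proof. by apply: stationary_residue; [rewrite subrr nc0|exact: l1|left]. Qed.

(** Reflection in the unit circle exchanges poles and interpolation points, so a displaced pole m is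
    prescribed by z near w. From |m - l| = |z - w| / (|w| |z|) and |z| >= |w|/2 comes c = 2/|w|^2;
    from |z| <= (1 + |w|)/2 comes g. *)
Lemma inverse_conj_near : exists d c g : R, [/\ 0 < d, 0 <= c, 0 < g &
  forall z, nc (z - w) < d -> let m := (z^*%C)^-1 in
    [/\ (m^*%C)^-1 = z, nc (m - l) < eta, nc (m - l) <= c * nc (z - w) & g <= nc m - 1]].
Proof.
have l0 : l != 0 by rewrite -nc_gt0 (lt_trans ltr01).
have w0 : w != 0 by rewrite invr_eq0 conjc_eq0.
have nw0 : 0 < nc w by rewrite nc_gt0.
have w1 : nc w < 1 by rewrite Normc.normcV nc_conj invf_lt1// (lt_trans ltr01 l1).
pose c := 2 / nc w ^+ 2; have c0 : 0 < c by rewrite divr_gt0// exprn_gt0.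
pose g := (1 - nc w) / (1 + nc w).
have g0 : 0 < g by rewrite divr_gt0 ?subr_gt0 ?addr_gt0.
pose d := Num.min (nc w / 2) (Num.min ((1 - nc w) / 2) (eta / c)).
have d0 : 0 < d by rewrite !lt_min; apply/and3P; split; rewrite divr_gt0// subr_gt0.
exists d, c, g; split => //; first exact: ltW.
move=> z; rewrite !lt_min => /and3P[h1 h2 h3] m.
have zlow : nc w / 2 <= nc z.
  have := ncB z (z - w); rewrite (_ : z - (z - w) = w); last by ring.
  lra.
have zup : nc z <= (1 + nc w) / 2.
  have := ncD (z - w) w; rewrite subrK; lra.
have nz0 : 0 < nc z by rewrite (lt_le_trans _ zlow)// divr_gt0.
have z0 : z != 0 by rewrite -nc_gt0.
have mK : (m^*%C)^-1 = z by rewrite /m conjc_inv conjcK invrK.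
have lw : l = (w^*%C)^-1 by rewrite /w conjc_inv conjcK invrK.
have hm : nc (m - l) <= c * nc (z - w).
  have -> : m - l = ((w - z) / (w * z))^*%C.
    rewrite lw /m -!conjc_inv -conjB; congr (_^*%C); field.
    by rewrite w0 z0.
  rewrite nc_conj ncM Normc.normcV ncM ncC mulrC ler_wpM2r ?nc_ge0//.
  rewrite /c -[2]invrK -invfM lef_pV2 ?posrE ?mulr_gt0 ?exprn_gt0 ?invr_gt0//.
  by rewrite mulrC expr2 -mulrA ler_pM2l.
split => //.
- by apply: le_lt_trans hm _; rewrite mulrC -ltr_pdivlMr.
- rewrite /m Normc.normcV nc_conj lerBrDr /g.
  have -> : (1 - nc w) / (1 + nc w) + 1 = ((1 + nc w) / 2)^-1.
    by field; rewrite gt_eqF// addr_gt0.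
  by rewrite lef_pV2 ?posrE// divr_gt0// addr_gt0.
Qed.

(** The residue is kept and the pole moved to 1 / conj z with z = w + s. As F(w) = 0, the linear
    term is - conj f z F(z) = - conj f w F'(w) s + O(|s|^2), while the variation is O(|s|) on the
    circle; the quadratic bound leaves conj f w F'(w) = 0. *)
Lemma stationary_derivative : hder F w 0.
Proof.
have [d [c [g [d0 c0 g0 hz]]]] := inverse_conj_near.
have l0 : l != 0 by rewrite -nc_gt0 (lt_trans ltr01).
have w0 : w != 0 by rewrite invr_eq0 conjc_eq0.
have w1 : nc w < 1 by rewrite Normc.normcV nc_conj invf_lt1// (lt_trans ltr01 l1).
have [f0|f0] := eqVneq f 0.
  apply: (hder0_eq0 d0) => z /hz[mK m1 _ m2]; rewrite -mK.
  apply: stationary_residue => //; last by right.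
  by rewrite -subr_gt0 (lt_le_trans g0).
have [dF [K [e [e0 K0 hF]]]] := hol_at_hder (analytic_hol_at aF (disk_nc w1)).
suff dF0 : dF = 0 by rewrite -dF0; exists K, e.
have q : 0 < nc l - 1 by rewrite subr_gt0.
suff : - (f^*%C * w * dF) = 0.
  by move=> /eqP; rewrite oppr_eq0 !mulf_eq0 conjc_eq0 (negPf f0) (negPf w0) => /eqP.
(* b |s| bounds the variation f (m - l) / ((cis t - m) (cis t - l)). The further terms of M bound w
   rho, F'(w) s^2 and s rho, where rho is the Taylor remainder of F at w. *)
pose b := nc f * c / (g * (nc l - 1)).
pose M := b ^+ 2 + 2 * (nc f * (nc w * K + nc dF + K)).
have m0 : 0 < Num.min (Num.min d e) 1 by rewrite !lt_min d0 e0 ltr01.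
apply: (@linear_le_quadratic_eq0 _ _ M _ m0) => s.
rewrite !lt_min => /andP[/andP[s1 s2] s3].
pose z := w + s; have zw : z - w = s by rewrite /z; ring.
have := hz z; rewrite zw => /(_ s1); set m := (z^*%C)^-1 => -[mK m1 m2 m3].
have mm : 1 < nc m by rewrite -subr_gt0 (lt_le_trans g0).
have := @first_order m f 0 (b * nc s) m1.
rewrite subrr nc0 => /(_ eta0 eta0 mm) => hfo.
have hb t : nc (f / (cis t - m) - f / (cis t - l) + 0) <= b * nc s.
  have n1 : cis t - m != 0.
    by rewrite -nc_gt0 (lt_le_trans _ (nc_pole_ge t m))// subr_gt0.
  have n2 : cis t - l != 0 by rewrite -nc_gt0 (lt_le_trans _ (nc_pole_ge t l)).
  have -> : f / (cis t - m) - f / (cis t - l) + 0 =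
      f * (m - l) * ((cis t - m)^-1 * (cis t - l)^-1).
    by move: (cis t : C) n1 n2 => c' n1 n2; field; rewrite n1 n2.
  have p1 : nc ((cis t - m)^-1) <= g^-1.
    rewrite Normc.normcV lef_pV2 ?posrE ?nc_gt0//.
    exact: le_trans m3 (nc_pole_ge _ _).
  have p2 : nc ((cis t - l)^-1) <= (nc l - 1)^-1.
    by rewrite Normc.normcV lef_pV2 ?posrE ?nc_gt0//; exact: nc_pole_ge.
  rewrite ncM [nc (f * _)]ncM [nc (_ * _)]ncM.
  have -> : b * nc s = (nc f * (c * nc s)) * (g^-1 * (nc l - 1)^-1).
    by rewrite /b; field; rewrite !gt_eqF.
  apply: ler_pM; rewrite ?mulr_ge0 ?nc_ge0//.
    by rewrite ler_wpM2l ?nc_ge0.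
  by apply: ler_pM; rewrite ?nc_ge0.
have {hfo} := hfo hb.
rewrite mK stationary_value conjc0 mul0r mulr0 oppr0 mulr0 subr0 addr0.
have := hF z; rewrite zw => /(_ s2); rewrite stationary_value subr0.
set rho := F z - dF * s => hrho.
have Fz : F z = dF * s + rho by rewrite /rho; ring.
have -> : f^*%C * - (z * F z) = s * - (f^*%C * w * dF) -
    f^*%C * (w * rho + s * (dF * s) + s * rho) by rewrite Fz /z; ring.
rewrite ReD ReN mulrBr lerBlDr => /le_trans; apply.
rewrite /M [leRHS]mulrDl exprMn lerD2l -mulrA ler_pM2l//.
apply: le_trans (ler_norm _) _; apply: le_trans (le_Re_nc _) _.
rewrite ncM nc_conj -mulrA ler_wpM2l ?nc_ge0//.
have r1 : nc (w * rho) <= nc w * K * nc s ^+ 2.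
  by rewrite ncM -mulrA ler_wpM2l ?nc_ge0.
have r2 : nc (s * (dF * s)) = nc dF * nc s ^+ 2 by rewrite !ncM; ring.
have r3 : nc (s * rho) <= K * nc s ^+ 2.
  rewrite ncM -[leRHS]mul1r; apply: ler_pM; rewrite ?nc_ge0//; exact: ltW.
have := ncD (w * rho + s * (dF * s)) (s * rho).
have := ncD (w * rho) (s * (dF * s)).
rewrite r2; lra.
Qed.

End Stationarity.

(** * Transfer from the disk to the domain *)

Unset Implicit Arguments.

Theorem theorem2 (R : realType) (A : set R[i]) (vphi s : R[i] -> R[i])
    (hA : simply_connected_domain A)
    (hvphi : conformal_on disk vphi) (hbij : set_bij disk A vphi)
    (hs : sqrt_deriv_branch vphi s)
    (G : R[i] -> R[i]) (hG : E2 A vphi s G)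
    (r : nat) (hr : (1 <= r)%N)
    (lam phi : 'rV[R[i]]_r) (d : R[i])
    (hGr : E2 A vphi s (reduced_fun vphi s lam phi d))
    (hmin : local_minimizer (@outside_poles R r)
       (fun q => E2_norm vphi s
          (fun x => G x - reduced_fun vphi s q.1.1 q.1.2 q.2 x))
       (lam, phi, d)) :
  let Gr := reduced_fun vphi s lam phi d in
  G (vphi 0) = Gr (vphi 0) /\
  forall p : 'I_r,
    let x := vphi ((lam 0 p)^*%C)^-1 in
    G x = Gr x /\ derive1 G x = derive1 Gr x.
Proof.
move=> Gr; pose nc := @Normc.normc R.
have [[aA hGH] [aGr hGrH]] := (hG, hGr).
have sz z : disk z -> s z != 0.
  move=> dz; have := hvphi.2 _ dz; rewrite -(hs.2 _ dz) expf_eq0/=.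
  by [].
pose e z := pull vphi s G z - pull vphi s Gr z.
have ae : analytic_on disk e by apply: analytic_onB; [exact: hGH.1|exact: hGrH.1].
have [B1 hB1] := hardy2_sqmean_bound hGH; have [B2 hB2] := hardy2_sqmean_bound hGrH.
have hB t : 0 < t -> t < 1 -> sqmean e t <= 2 * B1 + 2 * B2.
  move=> t0 t1; apply: le_trans (sqmeanB_le hGH.1 hGrH.1 t0 t1) _.
  by rewrite lerD// ler_wpM2l// ?hB1 ?hB2.
have eE z : e z = (G (vphi z) - Gr (vphi z)) * s z by rewrite /e /pull mulrBl.
have lam1 j : 1 < nc (lam 0 j).
  by have := hmin.1 j; rewrite /= normE ltcR.
(* Radii of balls over R[i] are themselves in R[i]; a positive one is real, so its real part serves
   as [eta]. *)
have [eta [eta0 hnear]] : exists eta : R, 0 < eta /\ forall q', ball (lam, phi, d) eta%:C q' ->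
    outside_poles q' -> E2_norm vphi s (fun x => G x - Gr x) <=
    E2_norm vphi s (fun x => G x - reduced_fun vphi s q'.1.1 q'.1.2 q'.2 x).
  have /nbhs_ballP[ep ep0 hep] := hmin.2.
  have ep1 : 0 < ep by exact: ep0.
  have reE : (complex.Re ep)%:C = ep by apply: RRe_real; exact: gtr0_real.
  exists (complex.Re ep); split; first by rewrite -ltcR reE.
  by move=> q'; rewrite reE => hq hout; exact: (hep q' hq hout).
have etaC : (0 : R[i]) < eta%:C by rewrite ltcR.
have first_order p l' f' dd b : nc (l' - lam 0 p) < eta -> nc (f' - phi 0 p) < eta ->
    nc dd < eta -> 1 < nc l' ->
    (forall t, nc (f' / (cis t - l') - phi 0 p / (cis t - lam 0 p) + dd) <= b) ->
    2 * complex.Re (f'^*%C * (- ((l'^*%C)^-1 * e (l'^*%C)^-1)) -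
      (phi 0 p)^*%C * (- (((lam 0 p)^*%C)^-1 * e ((lam 0 p)^*%C)^-1)) + dd^*%C * e 0) <= b ^+ 2.
  move=> hl hf hd l'1 hb.
  pose h z := f' / (z - l') - phi 0 p / (z - lam 0 p) + dd.
  pose q' := (update_coord lam p l', update_coord phi p f', d + dd).
  have hq' : E2_norm vphi s (fun x => G x - Gr x) <=
      E2_norm vphi s (fun x => G x - reduced_fun vphi s q'.1.1 q'.1.2 q'.2 x).
    have bl (x y : R[i]) : nc (y - x) < eta -> ball x eta%:C y.
      by move=> xy; rewrite -ball_normE /= distrC normE ltcR.
    apply: hnear.
      split; last by apply: bl; rewrite addrAC subrr add0r.
      by split; apply: ball_update_coord => //; apply: bl.
    move=> j /=; rewrite mxE normE ltcR; case: eqP => // _; exact: lam1.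
  have hh x : hol_at h (cis x).
    have pole m : 1 < nc m -> (cis x : R[i]) != m.
      move=> m1; apply/negP => /eqP xm; move: m1; rewrite -xm /nc nc_cis ltxx.
      by [].
    apply: (@hol_at_near _ (fun z => (f' * (z - l')^-1 +
        (- phi 0 p) * (z - lam 0 p)^-1) + dd) h _ 1) => //.
      by move=> z _; rewrite /h mulNr.
    apply: hol_at_add; last exact: hol_at_cst.
    by apply: hol_at_add; apply: hol_at_mul;
      [exact: hol_at_cst|apply/hol_at_inv/pole|exact: hol_at_cst|apply/hol_at_inv/pole].
  have h0 z : disk z -> pull vphi s (fun x => G x - Gr x) z = e z.
    by rewrite /pull eE.
  have h1 z : disk z -> pull vphi s
      (fun x => G x - reduced_fun vphi s q'.1.1 q'.1.2 q'.2 x) z = e z - h z.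
    move=> dz; rewrite /pull mulrBl (pull_reduced _ _ _ hbij (sz _ dz) dz).
    rewrite /e /pull (pull_reduced _ _ _ hbij (sz _ dz) dz) /h.
    have := rational_part_update lam phi p d (d + dd) l' f' z.
    rewrite (_ : d + dd - d = dd); last by ring.
    by move=> <-; ring.
  have := variational_inequality ae hB hh hb h0 h1 hq'.
  rewrite (inner_three_terms ae hB)// ReM/= mul0r subr0 mulrCA ler_pM2l//.
  exact: pi2_gt0.
have d0 : disk (0 : R[i]) by rewrite /disk/= normr0 ltr01.
have value z : disk z -> e z = 0 -> G (vphi z) = Gr (vphi z).
  move=> dz /eqP; rewrite eE mulf_eq0 (negPf (sz _ dz)) orbF subr_eq0.
  by move=> /eqP.
split.
  apply: value => //.
  (* The index 0 exists since r >= 1; its pole and residue stay fixed while the constant varies. *)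
  exact: (stationary_constant eta0 (lam1 (Ordinal hr)) (@first_order (Ordinal hr))).
move=> p x; set w := ((lam 0 p)^*%C)^-1 in x *.
have dw : disk w.
  apply: disk_nc; rewrite Normc.normcV nc_conj invf_lt1 ?(lt_trans ltr01 (lam1 p))//.
have ew : e w = 0 := stationary_value eta0 (lam1 p) (@first_order p).
have de : hder e w 0 := stationary_derivative ae eta0 (lam1 p) (@first_order p).
have Gx : G x = Gr x := value _ dw ew.
split; first exact: Gx.
have Ax : A x by have [fA _ _] := hbij; exact: fA.
have [g hg] := hol_at_hder (analytic_hol_at aA Ax).
have [gr hgr] := hol_at_hder (analytic_hol_at aGr Ax).
have [v hv] := hol_at_hder (analytic_hol_at hvphi.1 dw).
have [s' hs'] := hol_at_hder (analytic_hol_at hs.1 dw).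
rewrite (hder_derive1 hg) (hder_derive1 hgr); apply/eqP; rewrite -subr_eq0.
have v0 : v != 0 by rewrite -(hder_derive1 hv); exact: hvphi.2.
(* The error is the product of (G - Gr) composed with [vphi] and of [s]. As G - Gr vanishes at x,
   its derivative at w is (G' - Gr')(x) vphi'(w) s(w), and the last two factors are nonzero. *)
have := hder_mul (hder_comp hv (hderB hg hgr)) hs'.
rewrite /= -/x Gx subrr mul0r addr0 => hd.
have : (g - gr) * v * s w = 0.
  apply: (hder_unique hd); apply: hder_near ltr01 _ de => z _; exact: eE.
by move=> /eqP; rewrite !mulf_eq0 (negPf v0) (negPf (sz _ dw)) !orbF.
Qed.
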